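(* Let $M(z)=\sum_{n\ge1}\frac{m_n}{n!}z^n$ where $m_n$ is the number of labeled cographs with vertex set $\{1,\dots,n\}$, and $V(z)=\sum_{n\ge1}v_nz^n$ where $v_n$ is the number of unlabeled cographs with $n$ vertices. Their radii of convergence are $\rho=2\log(2)-1$ and $\rho_u\approx0.2808$ respectively. For $j\ge1$ set $\pi_j=\rho^j[z^j]M(z)$ and $\pi_j^u=\rho_u^j[z^j]V(z)$. Then $(\pi_j)_{j\ge1}$ and $(\pi_j^u)_{j\ge1}$ are probability distributions and, for every fixed $j\ge1$, $$\mathbb P(\kappa(\bm G_n)=j)\xrightarrow[n\to\infty]{}\pi_j,\qquad \mathbb P(\kappa(\bm G_n^u)=j)\xrightarrow[n\to\infty]{}\pi_j^u,$$ where $\bm G_n$ (resp. $\bm G_n^u$) is a uniform random labeled cograph with vertex set $\{1,\dots,n\}$ (resp. uniform random unlabeled cograph with $n$ vertices) conditioned to be connected.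
   Context: A labeled cograph is a graph obtainable from single-vertex graphs by repeatedly taking disjoint unions and joins (the join of graphs with disjoint vertex sets is their disjoint union plus all edges between vertices of different graphs); an unlabeled cograph is the isomorphism class of a labeled cograph. A connected graph $G$ is $k$-connected if it contains no set of $k-1$ vertices whose removal disconnects it; the vertex connectivity $\kappa(G)$ is the largest $k$ such that $G$ is $k$-connected. $[z^j]A(z)$ denotes the coefficient of $z^j$ in the power series $A$. *)

(* Defs.v *)
From Stdlib Require Import Reals.
From Coquelicot Require Import Coquelicot.
From mathcomp Require Import all_boot perm boolp.

Set Implicit Arguments.
Unset Strict Implicit.
Unset Printing Implicit Defensive.

Local Open Scope nat_scope.

Section Graphs.
Variable T : finType.

(* A graph with vertices taken from T: a pair (vertex set, edge set), edges
   being unordered pairs [set x; y] of distinct vertices.  The side condition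
   is not part of the type; [cograph_simple] derives it for cographs. *)
Definition graph : Type := ({set T} * {set {set T}})%type.
Implicit Types (G H : graph) (X : {set T}).

Definition vset G : {set T} := G.1.
Definition eset G : {set {set T}} := G.2.

Definition simple G : bool :=
  [forall e in eset G, (#|e| == 2) && (e \subset vset G)].

Definition graph1 (x : T) : graph := ([set x], set0).

Definition gunion G H : graph := (vset G :|: vset H, eset G :|: eset H).

Definition gjoin G H : graph :=
  (vset G :|: vset H,
   eset G :|: eset H :|: [set [set x; y] | x in vset G, y in vset H]).

Inductive cograph : graph -> Prop :=
| Cograph1 x : cograph (graph1 x)
| CographU G H : [disjoint vset G & vset H] ->
    cograph G -> cograph H -> cograph (gunion G H)
| CographJ G H : [disjoint vset G & vset H] ->
    cograph G -> cograph H -> cograph (gjoin G H).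

Definition gremove G X : graph :=
  (vset G :\: X, [set e in eset G | [disjoint e & X]]).

Definition adj G : rel T :=
  [rel x y | [&& x \in vset G, y \in vset G & [set x; y] \in eset G]].

Definition gconnected G : bool :=
  (vset G != set0) &&
  [forall x in vset G, forall y in vset G, connect (adj G) x y].

(* The condition k < #|vset G| is the usual convention making the complete
   graph on n vertices (n-1)-connected but not n-connected.  Without it the
   existence of a largest k would fail, as no removal of #|vset G|.-1 vertices
   disconnects anything.  In its presence, forbidding disconnecting sets of
   exactly k.-1 vertices or of at most k.-1 vertices is the same. *)
Definition kconnected (k : nat) G : bool :=
  [&& 0 < k, k < #|vset G|, gconnected G &
      ~~ [exists X : {set T}, [&& X \subset vset G, #|X| == k.-1 &
                                  ~~ gconnected (gremove G X)]]].

Definition kappa G : nat := \max_(k < #|vset G| | kconnected k G) k.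

Definition relabel (s : {perm T}) G : graph :=
  (s @: vset G, [set s @: e | e : {set T} in eset G]).

Definition isomorphic G H : bool := [exists s : {perm T}, H == relabel s G].

Definition iso_class G : {set graph} := [set H | isomorphic G H].

Lemma cograph_vset_neq0 G : cograph G -> vset G != set0.
Proof.
have U0 (A B : {set T}) : A != set0 -> A :|: B != set0.
  by rewrite setU_eq0 negb_and => ->.
elim=> [x|{}G H _ _ hG _ _|{}G H _ _ hG _ _]; rewrite /vset /=; try exact: U0.
by apply/set0Pn; exists x; rewrite in_set1.
Qed.

Lemma cograph_simple G : cograph G -> simple G.
Proof.
have sub (G1 H1 : graph) (e : {set T}) : (e \subset vset G1) || (e \subset vset H1) ->
  e \subset vset G1 :|: vset H1.
  by case/orP=> h; rewrite subsetU ?h ?orbT.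
elim=> [x|{}G H dGH _ /forall_inP hG _ /forall_inP hH
        |{}G H dGH _ /forall_inP hG _ /forall_inP hH];
  apply/forall_inP=> e.
- by rewrite inE.
- rewrite inE => /orP[/hG|/hH] /andP[-> h] /=; apply: sub; rewrite h ?orbT //.
- rewrite !inE -orbA => /or3P[/hG|/hH|].
  + by case/andP=> -> h; apply: sub; rewrite h.
  + by case/andP=> -> h; apply: sub; rewrite h orbT.
  + case/imset2P=> x y xG yH ->; rewrite cards2 subUset !sub1set !inE xG yH.
    rewrite orbT andbT; have [exy|//] := eqVneq x y.
    by rewrite exy (disjointFl dGH yH) in xG.
Qed.

(* Connectedness and vertex connectivity only depend on the isomorphism class. *)
Lemma relabelK s G : relabel s^-1 (relabel s G) = G.
Proof.
have sK (A : {set T}) : s^-1%g @: (s @: A) = A.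
  by rewrite -imset_comp (eq_imset _ (permK s)) imset_id.
case: G => A E; rewrite /relabel /vset /eset /=; congr (_, _); first exact: sK.
by rewrite -imset_comp (eq_imset _ (g := id) sK) imset_id.
Qed.

Lemma adj_relabel s G x y : adj G x y -> adj (relabel s G) (s x) (s y).
Proof.
rewrite /adj /= => /and3P[xG yG xyG]; rewrite !imset_f //=.
by apply/imsetP; exists [set x; y]; rewrite // imsetU1 imset_set1.
Qed.

Lemma gconnected_relabel s G : gconnected (relabel s G) = gconnected G.
Proof.
have imp t H : gconnected H -> gconnected (relabel t H).
  case/andP=> H0 /forall_inP cH; apply/andP; split.
    by case/set0Pn: H0 => x xH; apply/set0Pn; exists (t x); apply: imset_f.
  apply/forall_inP=> _ /imsetP[x xH ->]; apply/forall_inP=> _ /imsetP[y yH ->].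
  have /connectP[p pP ->] := forall_inP (cH x xH) y yH.
  apply/connectP; exists (map t p); last by rewrite last_map.
  elim: p x pP {xH} => //= z p IHp x /andP[xz /IHp ->]; rewrite andbT.
  exact: adj_relabel.
by apply/idP/idP => [/(imp s^-1%g)|/imp//]; rewrite relabelK.
Qed.

Lemma gremove_relabel s G X :
  gremove (relabel s G) (s @: X) = relabel s (gremove G X).
Proof.
rewrite /gremove /relabel /vset /eset /=; congr (_, _).
  apply/setP=> y; rewrite -[y](permKV s) !inE.
  by rewrite !mem_imset ?inE //; apply: perm_inj.
have dE (e : {set T}) : [disjoint s @: e & s @: X] = [disjoint e & X].
  by rewrite -!setI_eq0 -imsetI ?imset_eq0 // => x y _ _; apply: perm_inj.
apply/setP=> f; rewrite inE; apply/andP/imsetP.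
  by case=> /imsetP[e eG ->]; rewrite dE => eX; exists e; rewrite // inE eG.
case=> e; rewrite inE => /andP[eG eX] ->; rewrite dE; split=> //.
by apply/imsetP; exists e.
Qed.

Lemma kconnected_relabel s k G : kconnected k (relabel s G) = kconnected k G.
Proof.
have imp t H : kconnected k H -> kconnected k (relabel t H).
  rewrite /kconnected gconnected_relabel (card_imset _ (@perm_inj _ t)).
  case/and4P=> -> -> -> /existsPn nX; apply/existsPn=> Y.
  have YE : Y = t @: (t^-1%g @: Y).
    by rewrite -imset_comp (eq_imset _ (permKV t)) imset_id.
  rewrite YE gremove_relabel gconnected_relabel (card_imset _ (@perm_inj _ t)).
  have := nX (t^-1%g @: Y); apply: contra => /and3P[sY -> ->]; rewrite !andbT.
  by apply/subsetP=> x /(imset_f t)/(subsetP sY)/imsetP[z zH /perm_inj->].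
by apply/idP/idP => [/(imp s^-1%g)|/imp//]; rewrite relabelK.
Qed.

Lemma kappa_relabel s G : kappa (relabel s G) = kappa G.
Proof.
rewrite /kappa (card_imset _ (@perm_inj _ s)).
by apply: eq_bigl => k; rewrite kconnected_relabel.
Qed.

End Graphs.

Definition cographs (n : nat) : {set graph 'I_n} :=
  [set G | (vset G == setT) && `[< cograph G >]].

Definition ucographs (n : nat) : {set {set graph 'I_n}} :=
  [set iso_class G | G in cographs n].

(* An isomorphism-invariant property of graphs, seen as a property of
   isomorphism classes. *)
Definition on_class (T : finType) (P : pred (graph T)) : pred {set graph T} :=
  fun C => [exists G in C, P G].

Lemma on_class_iso (T : finType) (P : pred (graph T)) G :
  (forall s H, P (relabel s H) = P H) -> on_class P (iso_class G) = P G.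
Proof.
move=> Pinv; apply/exists_inP/idP => [[H]|PG].
  by rewrite inE => /existsP[s /eqP->]; rewrite Pinv.
exists (relabel 1%g G); last by rewrite Pinv.
by rewrite inE; apply/existsP; exists 1%g.
Qed.

Definition labeled_count (n : nat) : nat := #|cographs n|.

Definition unlabeled_count (n : nat) : nat := #|ucographs n|.

Lemma labeled_count0 : labeled_count 0 = 0.
Proof.
apply/eqP; rewrite cards_eq0; apply/eqP/setP=> G; rewrite !inE.
apply/negP=> /andP[_ /asboolP/cograph_vset_neq0/set0Pn[[]]//].
Qed.

Lemma unlabeled_count0 : unlabeled_count 0 = 0.
Proof.
move/eqP: labeled_count0; rewrite cards_eq0 /unlabeled_count /ucographs.
by move/eqP->; rewrite imset0 cards0.
Qed.

Local Open Scope R_scope.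

(* Coefficient sequences of M(z) and V(z).  Both vanish at 0, by
   [labeled_count0] and [unlabeled_count0]. *)
Definition M_coef (n : nat) : R := INR (labeled_count n) / INR (n`!).

Definition V_coef (n : nat) : R := INR (unlabeled_count n).

Definition rho : R := 2 * ln 2 - 1.

Definition rho_u : R := real (CV_radius V_coef).

Definition pi_lab (j : nat) : R := rho ^ j * M_coef j.

Definition pi_unl (j : nat) : R := rho_u ^ j * V_coef j.

(* Probability distributions on the positive integers. *)
Definition is_distribution (p : nat -> R) : Prop :=
  (forall j : nat, (1 <= j)%N -> 0 <= p j) /\ is_series (fun j => p j.+1) 1.

Definition unif_prob (U : finType) (S : {set U}) (A : pred U) : R :=
  INR #|[set x in S | A x]| / INR #|S|.

Definition unif_cond_prob (U : finType) (S : {set U}) (A B : pred U) : R :=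
  unif_prob S (predI A B) / unif_prob S B.

Definition prob_kappa (n j : nat) : R :=
  unif_cond_prob (cographs n) (fun G => kappa G == j) (@gconnected _).

Definition prob_kappa_u (n j : nat) : R :=
  unif_cond_prob (ucographs n)
    (on_class (fun G => kappa G == j)) (on_class (@gconnected _)).

(* Main.v *)
Require Import Defs.
From Stdlib Require Import Reals Ranalysis5 Lra.
From Coquelicot Require Import Coquelicot.
From HB Require Import structures.
From mathcomp Require Import all_boot perm boolp zify.

(** Complementation exchanges connected and disconnected cographs, so both counting
    series are tied to the series of connected cographs, and the vertex connectivity of
    a connected cograph is [n] minus the size of its largest co-component.  Hence, for
    [n > 2j], a connected cograph with connectivity [j] is the join of an arbitrary cograph
    on [j] vertices with a disconnected one on [n - j] vertices; the theorem
    reduces to [M(rho) = V(rho_u) = 1] and to limits of coefficient ratios.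

    Labeled case.  [M' = 1 + M + M M'], that is [2 ln (1 + M) - M = z], which gives the
    radius [rho = 2 ln 2 - 1] and [M(rho) = 1].  Moreover [M' = 2 / (1 - M) - 1], so
    [n m_n / n!] is, up to the factor 2, a renewal sequence with increments [m_n / n!].  By
    induction both sequences are log-convex, so the coefficient ratio is monotone.

    Unlabeled case.  [V = M o Y], where [Y] has nonnegative coefficients [y_n] and a larger
    radius of convergence, and [Y(rho_u) = rho].  Tilting the coefficient [y_j] by [exp L]
    changes the exponential growth rate of [[z^n] V] smoothly in [L]; by convexity this
    determines the limit of [[z^(n-j)] M'(Y) / (n [z^n] V)].  Comparing [j = 1] at [n] with
    [j = 2] at [n + 1] gives the limit of the ratio of consecutive coefficients of [V]. *)

Set Implicit Arguments.
Unset Strict Implicit.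
Unset Printing Implicit Defensive.

Local Open Scope nat_scope.

(** * Graph operations *)

Section GraphOperations.
Variable T : finType.
Implicit Types (G H K : graph T) (A B X : {set T}).

(** Both equations come from the exponential formula. In the labeled case [1 + M = exp C] with
    [2 C = M + z], since complementation pairs connected with disconnected graphs except at size 1.
    Polya's formula turns the unlabeled case into [1 + V = exp (C(z) + sum_(k >= 2) C(z^k) / k)], so
    that [2 ln (1 + V) - V] equals [Y = z + sum_(k >= 2) 2 C(z^k) / k] instead of [z]. No formal
    exponential is used: the operator [z d/dz] turns both formulas into recurrences that fix the
    coefficients. The function [2 ln (1 + x) - x] is maximal at [x = 1]; this is why [rho] is its
    maximum and why [M] takes the value 1 there. The obstacle is the convergence of consecutive
    coefficient ratios, which a radius of convergence does not provide. Monotonicity settles it for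
    [M]. For [V] only the exponential growth rate is at hand; that precision is enough for means
    divided by [n], and the quotient of two means with the same numerator coefficient of [M'(Y)]
    isolates a ratio of coefficients of [V]. *)

Definition gempty : graph T := (set0, set0).

Definition ind G A : graph T := (vset G :&: A, [set e in eset G | e \subset A]).

Definition gcompl G : graph T :=
  (vset G, [set e : {set T} | [&& #|e| == 2, e \subset vset G & e \notin eset G]]).

Lemma gremove_ind G X : gremove G X = ind G (~: X).
Proof.
rewrite /gremove /ind setDE; congr (_, _).
by apply/setP => e; rewrite !inE disjoints_subset.
Qed.

Lemma simpleP G e : simple G -> e \in eset G ->
  exists x y, [/\ x != y, x \in vset G, y \in vset G & e = [set x; y]].
Proof.
move=> /forall_inP sG /sG /andP[/cards2P[x [y [xy ->]]]].
rewrite subUset !sub1set => /andP[xG yG].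
by exists x, y; split.
Qed.

Lemma adjE G x y : simple G -> adj G x y = ([set x; y] \in eset G).
Proof.
move=> sG; rewrite /adj /=; apply/and3P/idP => [[]//|xyG].
have /andP[_] := forall_inP sG _ xyG.
by rewrite subUset !sub1set => /andP[].
Qed.

Lemma adjC G x y : adj G x y = adj G y x.
Proof. by rewrite /adj /= setUC andbCA. Qed.

Lemma adj_vset G x y : adj G x y -> (x \in vset G) && (y \in vset G).
Proof. by case/and3P=> -> ->. Qed.

Lemma adj_irr G x : simple G -> adj G x x = false.
Proof.
move=> sG; rewrite adjE //; apply/negP => xG.
have /andP[] := forall_inP sG _ xG.
by rewrite setUid cards1.
Qed.

Lemma simple_eq G H : simple G -> simple H -> vset G = vset H ->
  adj G =2 adj H -> G = H.
Proof.
move=> sG sH eV eA; case: (G) (H) eV eA sG sH => [V E] [V' E'] /= eV eA sG sH.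
rewrite -[V]/(vset (V, E)) eV; congr (_, _); apply/setP => e; apply/idP/idP => eE.
  have [x [y [_ _ _ exy]]] := simpleP sG eE; rewrite exy in eE *.
  by have := eA x y; rewrite !adjE // /eset /= eE => <-.
have [x [y [_ _ _ exy]]] := simpleP sH eE; rewrite exy in eE *.
by have := eA x y; rewrite !adjE // /eset /= eE => ->.
Qed.

Lemma simple_gempty : simple gempty.
Proof. by apply/forall_inP => e; rewrite inE. Qed.

Lemma simple_ind G A : simple G -> simple (ind G A).
Proof.
move=> /forall_inP sG; apply/forall_inP => e; rewrite inE => /andP[eG eA].
by have /andP[-> eV] := sG _ eG; rewrite subsetI eV.
Qed.

Lemma simple_gcompl G : simple (gcompl G).
Proof. by apply/forall_inP => e; rewrite inE => /and3P[-> ->]. Qed.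

Lemma simple_gunion G H : simple G -> simple H -> simple (gunion G H).
Proof.
move=> /forall_inP sG /forall_inP sH; apply/forall_inP => e; rewrite inE.
by case/orP=> [/sG|/sH] /andP[-> eV]; rewrite subsetU ?eV ?orbT.
Qed.

Lemma simple_gjoin G H : [disjoint vset G & vset H] ->
  simple G -> simple H -> simple (gjoin G H).
Proof.
move=> dGH /forall_inP sG /forall_inP sH; apply/forall_inP => e; rewrite !inE -orbA.
case/or3P=> [/sG|/sH|/imset2P[x y xG yH ->]].
- by case/andP=> -> eV; rewrite subsetU ?eV ?orbT.
- by case/andP=> -> eV; rewrite subsetU ?eV ?orbT.
rewrite cards2 subUset !sub1set !inE xG yH orbT andbT.
have [exy|//] := eqVneq x y.
by rewrite exy (disjointFl dGH yH) in xG.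
Qed.

Lemma vset_ind G A : A \subset vset G -> vset (ind G A) = A.
Proof. by move/setIidPr. Qed.

Lemma adj_ind G A x y : adj (ind G A) x y = [&& adj G x y, x \in A & y \in A].
Proof.
rewrite /adj /= !inE subUset !sub1set.
by case: (x \in vset G); case: (y \in vset G); case: (x \in A); case: (y \in A);
   rewrite ?andbT ?andbF.
Qed.

Lemma adj_gcompl G x y : adj (gcompl G) x y =
  [&& x != y, x \in vset G, y \in vset G & ~~ adj G x y].
Proof.
rewrite /adj /= !inE cards2 subUset !sub1set.
by case: (x \in vset G); case: (y \in vset G); case: (x == y).
Qed.

Lemma adj_gunion G H x y : simple G -> simple H ->
  adj (gunion G H) x y = adj G x y || adj H x y.
Proof. by move=> sG sH; rewrite !adjE ?simple_gunion // inE. Qed.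

Lemma adj_gjoin G H x y : [disjoint vset G & vset H] -> simple G -> simple H ->
  adj (gjoin G H) x y = [|| adj G x y, adj H x y,
    (x \in vset G) && (y \in vset H) | (x \in vset H) && (y \in vset G)].
Proof.
move=> dGH sG sH; rewrite !adjE ?simple_gjoin // !inE -orbA; do 2!congr orb.
apply/imset2P/orP => [[a b aG bH e]|[/andP[xG yH]|/andP[xH yG]]]; last 2 first.
- by exists x y.
- by exists y x; rewrite // setUC.
have: (x \in [set a; b]) && (y \in [set a; b]) by rewrite -e !inE !eqxx orbT.
have: (a \in [set x; y]) && (b \in [set x; y]) by rewrite e !inE !eqxx orbT.
have ab : a != b by apply: contraTneq aG => ->; rewrite (disjointFl dGH bH).
rewrite !inE => /andP[/orP[]/eqP ea /orP[]/eqP eb] _; subst; rewrite ?aG ?bH ?eqxx in ab *.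
- by [].
- by left.
- by right.
- by [].
Qed.

Lemma gcomplK G : simple G -> gcompl (gcompl G) = G.
Proof.
move=> sG; apply: simple_eq => //; first exact: simple_gcompl.
move=> x y; rewrite !adj_gcompl -[vset (gcompl G)]/(vset G).
have [->|xy] := eqVneq x y; first by rewrite adj_irr.
case xG: (x \in vset G); case yG: (y \in vset G) => //=; rewrite ?negbK //.
  by apply/esym/negP => /adj_vset; rewrite xG yG.
by apply/esym/negP => /adj_vset; rewrite xG.
by apply/esym/negP => /adj_vset; rewrite xG.
Qed.

Lemma gcompl_gunion G H : [disjoint vset G & vset H] -> simple G -> simple H ->
  gcompl (gunion G H) = gjoin (gcompl G) (gcompl H).
Proof.
move=> dGH sG sH; apply: simple_eq => [||//|x y].
- exact: simple_gcompl.
- by apply: simple_gjoin => //; apply: simple_gcompl.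
rewrite adj_gjoin ?simple_gcompl // !adj_gcompl adj_gunion //.
rewrite -[vset (gcompl G)]/(vset G) -[vset (gcompl H)]/(vset H) !in_setU.
have dF z : z \in vset G -> z \in vset H = false by apply: disjointFr.
have [->|xy] := eqVneq x y.
  by case yG: (y \in vset G); [rewrite dF | rewrite andbF].
rewrite /adj /=; move: (dF x) (dF y).
by case: (x \in vset G) => [/(_ isT)->|_]; case: (y \in vset G) => [/(_ isT)->|_];
  case: (_ \in eset G); case: (_ \in eset H); case: (x \in vset H); case: (y \in vset H).
Qed.

Lemma gcompl_gjoin G H : [disjoint vset G & vset H] -> simple G -> simple H ->
  gcompl (gjoin G H) = gunion (gcompl G) (gcompl H).
Proof.
move=> dGH sG sH; have sGH := simple_gunion (simple_gcompl G) (simple_gcompl H).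
by rewrite -[RHS]gcomplK // gcompl_gunion ?simple_gcompl // !gcomplK.
Qed.

Lemma gcompl_ind G A : simple G -> gcompl (ind G A) = ind (gcompl G) A.
Proof.
move=> sG; apply: simple_eq => [||//|x y]; rewrite ?simple_ind ?simple_gcompl //.
rewrite adj_ind !adj_gcompl adj_ind !inE.
by case: (x \in A); case: (y \in A); rewrite ?andbF ?andbT //=;
  case: (x \in vset G); case: (y \in vset G); rewrite ?andbF ?andbT.
Qed.

Lemma gunionC G H : gunion G H = gunion H G.
Proof. by rewrite /gunion setUC [in X in (_, X)]setUC. Qed.

Lemma gunion0 G : gunion G gempty = G.
Proof. by case: G => V E; rewrite /gunion /= !setU0. Qed.

Lemma gjoinC G H : gjoin G H = gjoin H G.
Proof.
rewrite /gjoin setUC [eset H :|: _]setUC; congr (_, _ :|: _).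
by apply/setP => e; apply/imset2P/imset2P => [[x y xG yH ->]|[x y xG yH ->]];
  exists y x; rewrite // setUC.
Qed.

Lemma gjoin0 G : gjoin G gempty = G.
Proof.
case: G => V E; rewrite /gjoin /= !setU0; congr (_, _).
apply/setUidPl/subsetP => e /imset2P[x y _]; by rewrite inE.
Qed.

Lemma ind_gunion G H A : simple G -> simple H ->
  ind (gunion G H) A = gunion (ind G A) (ind H A).
Proof.
move=> sG sH; apply: simple_eq => [|||x y].
- by apply/simple_ind/simple_gunion.
- by apply: simple_gunion; apply: simple_ind.
- by rewrite /vset /= setIUl.
by rewrite adj_ind !adj_gunion ?simple_ind // !adj_ind -andb_orl.
Qed.

Lemma ind_disjoint G H A : [disjoint vset G & vset H] ->
  [disjoint vset (ind G A) & vset (ind H A)].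
Proof.
move=> dGH; apply: disjointWl (subsetIl _ _) _.
exact: disjointWr (subsetIl _ _) dGH.
Qed.

Lemma ind_gjoin G H A : [disjoint vset G & vset H] -> simple G -> simple H ->
  ind (gjoin G H) A = gjoin (ind G A) (ind H A).
Proof.
move=> dGH sG sH; apply: simple_eq => [|||x y].
- by apply/simple_ind/simple_gjoin.
- by apply: simple_gjoin; rewrite ?ind_disjoint ?simple_ind.
- by rewrite /vset /= setIUl.
rewrite adj_ind !adj_gjoin ?ind_disjoint ?simple_ind // !adj_ind !inE.
by case: (x \in A); case: (y \in A); rewrite ?andbF ?andbT.
Qed.

Lemma ind_full G A : simple G -> vset G \subset A -> ind G A = G.
Proof.
move=> sG VA; apply: simple_eq => [||| x y]; rewrite ?simple_ind //.
  by rewrite /vset /=; apply/setIidPl.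
rewrite adj_ind; case xy: (adj G x y) => //=.
by have /andP[/(subsetP VA)-> /(subsetP VA)->] := adj_vset xy.
Qed.

Lemma ind_disj G A : simple G -> [disjoint vset G & A] -> ind G A = gempty.
Proof.
move=> sG dGA; apply: simple_eq => [||| x y]; rewrite ?simple_ind ?simple_gempty //.
  by rewrite /vset /=; apply/eqP; rewrite setI_eq0.
rewrite adj_ind /adj /= !inE; apply/negP => /and3P[/and3P[xG _ _] xA _].
by rewrite (disjointFr dGA xG) in xA.
Qed.

Lemma ind_ind G A B : ind (ind G A) B = ind G (A :&: B).
Proof.
rewrite /ind /= setIA; congr (_, _).
by apply/setP => e; rewrite !inE subsetI andbA.
Qed.

(* Admitting the empty graph makes the constant terms of [1 + M] and [1 + V] counts. *)
Definition cog0 G : bool := (G == gempty) || `[< cograph G >].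

Lemma cog0P G : reflect (G = gempty \/ cograph G) (cog0 G).
Proof.
apply: (iffP orP) => [[/eqP|/asboolP]|[/eqP|/asboolP]]; by [left|right].
Qed.

Lemma cog0_simple G : cog0 G -> simple G.
Proof. by case/cog0P=> [->|/cograph_simple//]; apply: simple_gempty. Qed.

Lemma cog0_vset G : cog0 G -> (vset G == set0) = (G == gempty).
Proof.
case/cog0P => [->|cG]; first by rewrite !eqxx.
rewrite (negbTE (cograph_vset_neq0 cG)); apply/esym/negP => /eqP G0.
by have := cograph_vset_neq0 cG; rewrite G0 eqxx.
Qed.

Lemma cog0_cograph G : vset G != set0 -> cog0 G = `[< cograph G >].
Proof.
by rewrite /cog0; have [->|//] := eqVneq G gempty; rewrite eqxx.
Qed.

Lemma cog0_gunion G H : [disjoint vset G & vset H] -> cog0 G -> cog0 H ->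
  cog0 (gunion G H).
Proof.
move=> dGH /cog0P[->|cG]; first by rewrite gunionC gunion0.
case/cog0P=> [->|cH]; first by rewrite gunion0; apply/cog0P; right.
by apply/cog0P; right; apply: CographU.
Qed.

Lemma cog0_gjoin G H : [disjoint vset G & vset H] -> cog0 G -> cog0 H ->
  cog0 (gjoin G H).
Proof.
move=> dGH /cog0P[->|cG]; first by rewrite gjoinC gjoin0.
case/cog0P=> [->|cH]; first by rewrite gjoin0; apply/cog0P; right.
by apply/cog0P; right; apply: CographJ.
Qed.

Lemma cog0_ind G A : cog0 G -> cog0 (ind G A).
Proof.
case/cog0P=> [->|].
  by rewrite ind_disj ?simple_gempty //= /cog0 ?eqxx // disjoints_subset sub0set.
elim=> {G} [x|G H dGH cG iG cH iH|G H dGH cG iG cH iH].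
- have [xA|xA] := boolP (x \in A).
    rewrite ind_full ?sub1set //; last by apply: cograph_simple; constructor.
    by apply/cog0P; right; constructor.
  rewrite ind_disj ?disjoints1 ?xA // /cog0 ?eqxx //.
  by apply: cograph_simple; constructor.
- by rewrite ind_gunion ?cograph_simple // cog0_gunion ?ind_disjoint.
- by rewrite ind_gjoin ?cograph_simple // cog0_gjoin ?ind_disjoint.
Qed.

Lemma cog0_gcompl G : cog0 G -> cog0 (gcompl G).
Proof.
case/cog0P=> [->|].
  rewrite /cog0; apply/orP; left; apply/eqP; congr (_, _); apply/setP => e.
  rewrite !inE subset0; apply/negP => /and3P[/eqP + /eqP e0].
  by rewrite e0 cards0.
elim=> {G} [x|G H dGH cG iG cH iH|G H dGH cG iG cH iH].
- suff -> : gcompl (graph1 x) = graph1 x by apply/cog0P; right; constructor.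
  congr (_, _); apply/setP => e; rewrite !inE andbT; apply/negP => /andP[/eqP c2].
  by move/subset_leq_card; rewrite c2 cards1.
- by rewrite gcompl_gunion ?cograph_simple // cog0_gjoin.
- by rewrite gcompl_gjoin ?cograph_simple // cog0_gunion.
Qed.

End GraphOperations.

(** * Relabeling and isomorphism classes *)

Section Gmap.
Variables T U : finType.
Implicit Types (G H : graph T) (f g : T -> U).

(** [relabel] along an arbitrary map, possibly into another vertex type; injectivity on the vertex
    set is required only where it is used. It carries graphs on a vertex subset to graphs on an
    ordinal type and back. *)
Definition gmap f G : graph U := (f @: vset G, [set f @: e | e : {set T} in eset G]).

Lemma gmap_eq_in f g G : simple G -> {in vset G, f =1 g} -> gmap f G = gmap g G.
Proof.
move=> sG fg; congr (_, _); first exact: eq_in_imset.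
apply: eq_in_imset => e eG; apply: eq_in_imset => x xe; apply: fg.
by have /andP[_ /subsetP] := forall_inP sG _ eG; apply.
Qed.

Lemma gmap_gunion f G H : gmap f (gunion G H) = gunion (gmap f G) (gmap f H).
Proof. by rewrite /gmap /gunion /= !imsetU. Qed.

Lemma gmap_gjoin f G H : gmap f (gjoin G H) = gjoin (gmap f G) (gmap f H).
Proof.
rewrite /gmap /gjoin /= !imsetU; congr (_, _ :|: _); apply/setP => e.
apply/imsetP/imset2P => [[_ /imset2P[x y xG yH ->] ->]|].
  by exists (f x) (f y); rewrite ?imset_f // imsetU1 imset_set1.
case=> _ _ /imsetP[x xG ->] /imsetP[y yH ->] ->.
exists [set x; y]; last by rewrite imsetU1 imset_set1.
by apply/imset2P; exists x y.
Qed.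

Lemma disjoint_imset_in f (A B : {set T}) : {in A :|: B &, injective f} ->
  [disjoint A & B] -> [disjoint f @: A & f @: B].
Proof.
move=> fI dAB; rewrite -setI_eq0; apply/eqP/setP => y; rewrite !inE.
apply/negP => /andP[/imsetP[a aA ->] /imsetP[b bB /fI eab]].
have ab : a = b by apply: eab; rewrite inE ?aA ?bB ?orbT.
by move: bB; rewrite -ab (disjointFr dAB aA).
Qed.

Lemma cog0_gmap f G : {in vset G &, injective f} -> cog0 G -> cog0 (gmap f G).
Proof.
move=> + /cog0P[->|cG]; first by rewrite /gmap !imset0 /cog0 eqxx.
elim: cG => {G} [x|G H dGH _ iG _ iH|G H dGH _ iG _ iH] fI.
- rewrite /gmap imset_set1 imset0; apply/cog0P; right; exact: Cograph1.
- rewrite gmap_gunion; apply: cog0_gunion; first exact: disjoint_imset_in.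
    by apply: iG => x y xG yG; apply: fI; rewrite inE ?xG ?yG.
  by apply: iH => x y xG yG; apply: fI; rewrite inE ?xG ?yG orbT.
- rewrite gmap_gjoin; apply: cog0_gjoin; first exact: disjoint_imset_in.
    by apply: iG => x y xG yG; apply: fI; rewrite inE ?xG ?yG.
  by apply: iH => x y xG yG; apply: fI; rewrite inE ?xG ?yG orbT.
Qed.

Lemma simple_gmap f G : {in vset G &, injective f} -> simple G -> simple (gmap f G).
Proof.
move=> fI /forall_inP sG; apply/forall_inP => _ /imsetP[e eG ->].
have /andP[c2 eV] := sG _ eG; rewrite imsetS // andbT card_in_imset //.
by move=> x y /(subsetP eV) xG /(subsetP eV); apply: fI.
Qed.

End Gmap.

Lemma gmap_comp (T U W : finType) (f : T -> U) (g : U -> W) (G : graph T) :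
  gmap g (gmap f G) = gmap (g \o f) G.
Proof.
rewrite /gmap /vset /eset /= -imset_comp; congr (_, _).
by rewrite -imset_comp; apply: eq_imset => e; rewrite /= -imset_comp.
Qed.

Lemma gmap_id (T : finType) (f : T -> T) (G : graph T) :
  simple G -> {in vset G, f =1 id} -> gmap f G = G.
Proof.
move=> sG fid; rewrite (gmap_eq_in sG fid) /gmap imset_id.
case: G {sG fid} => V E /=; congr (_, _).
by rewrite (eq_imset (g := id)) ?imset_id // => e; rewrite imset_id.
Qed.

Section Extension.
Variable T : finType.
Implicit Types (A B : {set T}) (f : T -> T) (G H : graph T).

Lemma set_injection A B : #|A| <= #|B| ->
  exists f, {in A &, injective f} /\ f @: A \subset B.
Proof.
move=> leAB; exists (fun x => nth x (enum B) (index x (enum A))).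
have ltB x : x \in A -> index x (enum A) < size (enum B).
  by move=> xA; rewrite -cardE (leq_trans _ leAB) // [leqRHS]cardE index_mem mem_enum.
split=> [x y xA yA|].
  rewrite (set_nth_default y) ?ltB // => /eqP; rewrite nth_uniq ?ltB ?enum_uniq //.
  by move=> /eqP /index_inj-> //; rewrite mem_enum.
apply/subsetP => _ /imsetP[x xA ->].
by rewrite -mem_enum mem_nth ?ltB.
Qed.

(** Isomorphisms are built as injections on a vertex set, while [isomorphic] asks for a permutation
    of the whole type. The complements of [A] and [f @: A] have equal size, so the injection
    extends. *)
Lemma perm_extension A f : {in A &, injective f} ->
  exists s : {perm T}, {in A, s =1 f}.
Proof.
move=> fI.
have [|h [hI /subsetP hS]] := @set_injection (~: A) (~: (f @: A)).
  by rewrite -(leq_add2l #|A|) cardsC -(cardsC (f @: A)) card_in_imset.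
pose g x := if x \in A then f x else h x.
have hF x y : x \in A -> y \notin A -> f x <> h y.
  move=> xA yA e; have := hS (h y) (imset_f _ _).
  by rewrite !inE -e imset_f // yA => /(_ isT).
have gI : injective g.
  move=> x y; rewrite /g; have [xA|xA] := boolP (x \in A); have [yA|yA] := boolP (y \in A).
  - exact: fI.
  - by move/hF => /(_ xA yA).
  - by move/esym/hF => /(_ yA xA).
  - by apply: hI; rewrite inE.
by exists (perm gI) => x xA; rewrite permE /g xA.
Qed.

Lemma isoP G H : reflect (exists s : {perm T}, H = relabel s G) (isomorphic G H).
Proof. by apply: (iffP existsP) => -[s /eqP]; exists s => //; apply/eqP. Qed.

Lemma iso_refl G : isomorphic G G.
Proof.
apply/isoP; exists 1%g; rewrite /relabel; case: G => V E; congr (_, _).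
  by rewrite (eq_imset (g := id)) ?imset_id // => x; rewrite perm1.
rewrite (eq_imset (g := id)) ?imset_id // => e.
by rewrite (eq_imset (g := id)) ?imset_id // => x; rewrite perm1.
Qed.

Lemma iso_sym G H : isomorphic G H = isomorphic H G.
Proof.
by apply/isoP/isoP => -[s ->]; exists s^-1%g; rewrite relabelK.
Qed.

Lemma iso_trans G H K : isomorphic G H -> isomorphic H K -> isomorphic G K.
Proof.
move=> /isoP[s ->] /isoP[t ->]; apply/isoP; exists (s * t)%g.
rewrite -[relabel t _]/(gmap t (gmap s G)) gmap_comp.
rewrite /relabel /gmap; congr (_, _); first by apply: eq_imset => x; rewrite permM.
by apply: eq_imset => e; apply: eq_imset => x; rewrite permM.
Qed.

Lemma iso_class_eq G H : (iso_class G == iso_class H) = isomorphic G H.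
Proof.
apply/eqP/idP => [e|iGH].
  have: H \in iso_class H by rewrite inE iso_refl.
  by rewrite -e inE.
apply/setP => K; rewrite !inE; apply/idP/idP; last exact: iso_trans.
by apply: iso_trans; rewrite iso_sym.
Qed.

Lemma iso_class_rep G H : G \in iso_class H -> iso_class H = iso_class G.
Proof. by rewrite inE => ?; apply/eqP; rewrite iso_class_eq. Qed.

Lemma iso_card G H : isomorphic G H -> #|vset G| = #|vset H|.
Proof. by move=> /isoP[s ->]; rewrite card_imset //; apply: perm_inj. Qed.

Lemma iso_gmap f G : simple G -> {in vset G &, injective f} -> isomorphic G (gmap f G).
Proof.
move=> sG /perm_extension[s sf]; apply/isoP; exists s.
by apply: gmap_eq_in => // x xG; rewrite sf.
Qed.

(** The map equal to [s] on [vset G] and to [t] elsewhere is injective on the union, since the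
    images lie in the disjoint sets [vset G'] and [vset H']. It need not be a permutation;
    [iso_gmap] supplies one. *)
Lemma iso_gunion G H G' H' : simple G -> simple H ->
  [disjoint vset G & vset H] -> [disjoint vset G' & vset H'] ->
  isomorphic G G' -> isomorphic H H' ->
  isomorphic (gunion G H) (gunion G' H').
Proof.
move=> sG sH dGH dGH' /isoP[s eG] /isoP[t eH].
pose f x := if x \in vset G then s x else t x.
have fG : {in vset G, f =1 s} by move=> x xG; rewrite /f xG.
have fH : {in vset H, f =1 t} by move=> x xH; rewrite /f (disjointFl dGH xH).
have -> : gunion G' H' = gmap f (gunion G H).
  by rewrite gmap_gunion (gmap_eq_in sG fG) (gmap_eq_in sH fH) eG eH.
apply: iso_gmap; first exact: simple_gunion.
have nst x y : x \in vset G -> y \in vset H -> s x <> t y.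
  move=> xG yH e; have: s x \in vset G' by rewrite eG imset_f.
  by move/(disjointFr dGH'); rewrite e eH imset_f.
move=> x y; rewrite !inE => /orP[xG|xH] /orP[yG|yH].
- by rewrite !fG // => /perm_inj.
- by rewrite fG // fH // => /nst; case.
- by rewrite fH // fG // => /esym/nst; case.
- by rewrite !fH // => /perm_inj.
Qed.

(** Classes are added through disjoint representatives; the cardinality bound says that the ambient
    type has room for one. *)
Lemma iso_disjoint_rep G A : simple G -> #|vset G| + #|A| <= #|T| ->
  exists2 H, isomorphic G H & [disjoint vset H & A].
Proof.
move=> sG leT; have [|f [fI /subsetP fS]] := @set_injection (vset G) (~: A).
  by rewrite -(leq_add2r #|A|) [#|~: A| + _]addnC cardsC.
exists (gmap f G); first exact: iso_gmap.
by rewrite disjoints_subset; apply/subsetP.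
Qed.

End Extension.

Lemma iso_gmap2 (T U : finType) (f g : T -> U) (G : graph T) : simple G ->
  {in vset G &, injective f} -> {in vset G &, injective g} ->
  isomorphic (gmap f G) (gmap g G).
Proof.
move=> sG fI gI; pose h y := if [pick x in vset G | f x == y] is Some x then g x else y.
have hf : {in vset G, h \o f =1 g}.
  move=> x xG /=; rewrite /h; case: pickP => [z /andP[zG /eqP/fI->]|/(_ x)] //.
  by rewrite [x \in _]xG eqxx.
have -> : gmap g G = gmap h (gmap f G).
  by rewrite gmap_comp (gmap_eq_in sG hf).
apply: iso_gmap; first exact: simple_gmap.
move=> _ _ /imsetP[x xG ->] /imsetP[y yG ->].
by rewrite -![h (f _)]/((h \o f) _) !hf // => /gI->.
Qed.

Lemma iso_gmap_iso (T U : finType) (f g : T -> U) (G H : graph T) : simple G ->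
  {in vset G &, injective f} -> {in vset H &, injective g} ->
  isomorphic G H -> isomorphic (gmap f G) (gmap g H).
Proof.
move=> sG fI gI /isoP[s eH]; rewrite eH in gI *.
rewrite -[relabel s G]/(gmap s G) gmap_comp; apply: iso_gmap2 => //.
by move=> x y xG yG /= /gI /perm_inj-> //; apply: imset_f.
Qed.

Lemma leq_card_imset_kernel (U V W : finType) (A : {set U}) (f : U -> V) (g : U -> W) :
  {in A &, forall x y, g x = g y -> f x = f y} -> #|f @: A| <= #|g @: A|.
Proof.
move=> gf; case: (set_0Vmem A) => [->|[a aA]]; first by rewrite !imset0 cards0.
pose h w := if [pick x in A | g x == w] is Some x then f x else f a.
apply: leq_trans (leq_imset_card h _); apply/subset_leq_card/subsetP.
move=> _ /imsetP[x xA ->]; apply/imsetP; exists (g x); first exact: imset_f.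
rewrite /h; case: pickP => [y /andP[yA /eqP e]|/(_ x)]; first exact: gf.
by rewrite [x \in _]xA eqxx.
Qed.

(** The number of values of a map depends only on which arguments it identifies. This compares
    numbers of isomorphism classes over two vertex types without a map between the classes. *)
Lemma card_imset_kernel (U V W : finType) (A : {set U}) (f : U -> V) (g : U -> W) :
  {in A &, forall x y, (g x == g y) = (f x == f y)} -> #|f @: A| = #|g @: A|.
Proof.
move=> gf; apply/eqP; rewrite eqn_leq !leq_card_imset_kernel // => x y xA yA /eqP.
  by rewrite -gf // => /eqP.
by rewrite gf // => /eqP.
Qed.

(** * Counts that do not depend on the ambient vertex type *)

Section Counts.
Variable T : finType.
Implicit Types (A : {set T}) (G : graph T).

Definition cgs A : {set graph T} := [set G | (vset G == A) && cog0 G].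

(** Graphs on [k] vertices of [T], not on all of [T], so that a union and its parts live in the same
    type. By [card_ucs] the number of classes does not depend on [T] once [T] has at least [k]
    elements. *)
Definition ucs k : {set {set graph T}} :=
  [set iso_class G | G in [set G : graph T | cog0 G && (#|vset G| == k)]].

Definition lab (n : nat) : nat := if n == 0 then 1 else labeled_count n.
Definition ulab (n : nat) : nat := if n == 0 then 1 else unlabeled_count n.

Lemma cographs_cog0 n : 0 < n -> cographs n = [set G | (vset G == setT) && cog0 G].
Proof.
move=> n0; apply/setP => G; rewrite !inE; case: eqP => //= eV.
rewrite cog0_cograph // eV; apply/set0Pn; exists (Ordinal n0); exact: in_setT.
Qed.

Lemma card_set_ord_full n (G : graph 'I_n) : (#|vset G| == n) = (vset G == setT).
Proof.
apply/eqP/eqP => [e|->]; last by rewrite cardsT card_ord.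
by apply/eqP; rewrite eqEcard subsetT cardsT card_ord e leqnn.
Qed.

Lemma set_coordinates A : A != set0 -> exists (f : 'I_#|A| -> T) (g : T -> 'I_#|A|),
  [/\ cancel f g, {in A, cancel g f}, f @: setT = A & {in A &, injective g}].
Proof.
case/set0Pn=> x xA; exists enum_val, (enum_rank_in xA).
have gK : {in A, cancel (enum_rank_in xA) enum_val} by exact: enum_rankK_in.
split=> //; first exact: enum_valK_in.
  apply/setP => y; apply/imsetP/idP => [[i _ ->]|yA]; first exact: enum_valP.
  by exists (enum_rank_in xA y); rewrite ?gK.
exact: can_in_inj gK.
Qed.

Lemma card_cgs A : #|cgs A| = lab #|A|.
Proof.
rewrite /lab cards_eq0; have [->|A0] := eqVneq A set0.
  rewrite (_ : cgs _ = [set gempty T]) ?cards1 //; apply/setP => G; rewrite !inE.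
  apply/andP/eqP => [[V0 cG]|->]; last by rewrite eqxx /cog0 eqxx.
  by apply/eqP; rewrite -cog0_vset.
have [f [g [fK gK fT gI]]] := set_coordinates A0.
have fI : injective f := can_inj fK.
rewrite /labeled_count cographs_cog0 ?card_gt0 //.
suff -> : cgs A = gmap f @: [set G | (vset G == setT) && cog0 G].
  rewrite card_in_imset // => G H; rewrite !inE => /andP[_ cG] /andP[_ cH] e.
  have mK K : cog0 K -> gmap g (gmap f K) = K.
    by move=> cK; rewrite gmap_comp gmap_id ?cog0_simple // => x _ /=.
  by rewrite -(mK G) // e mK.
apply/setP => G; rewrite inE; apply/andP/imsetP => [[/eqP vG cG]|[H]].
  have gA : g @: A = setT.
    apply/setP => i; rewrite inE; apply/imsetP; exists (f i); rewrite ?fK //.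
    by rewrite -fT imset_f.
  exists (gmap g G); first by rewrite inE cog0_gmap ?vG // /vset /= -/(vset G) vG gA eqxx.
  rewrite gmap_comp gmap_id ?cog0_simple // => x; rewrite vG => /gK; exact.
rewrite inE => /andP[/eqP vH cH ->]; split; last by apply: cog0_gmap => // x y _ _ /fI.
by rewrite /vset /= -/(vset H) vH fT.
Qed.

Lemma card_ucs k : k <= #|T| -> #|ucs k| = ulab k.
Proof.
move=> kT; rewrite /ulab; have [->|k0] := posnP k.
  rewrite (_ : ucs 0 = [set iso_class (gempty T)]) ?cards1 //; apply/setP => C.
  rewrite inE; apply/imsetP/eqP => [[G]|->]; last first.
    by exists (gempty T); rewrite // !inE cards0 /cog0 !eqxx.
  rewrite inE cards_eq0 => /andP[cG]; rewrite cog0_vset // => /eqP-> //.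
have [|h [hI _]] := @set_injection _ [set: 'I_k] [set: 'I_k]; first by [].
have [A cA] : exists A : {set T}, #|A| = k.
  exists [set x in take k (enum T)]; rewrite cardsE.
  have /card_uniqP-> : uniq (take k (enum T)) by rewrite take_uniq ?enum_uniq.
  by rewrite size_take -cardE; case: ltngtP kT => // ->.
have A0 : A != set0 by rewrite -card_gt0 cA.
have [f [g [fK gK fT gI]]] := set_coordinates A0.
have fI : injective f := can_inj fK.
have fIn (S : {set 'I_#|A|}) : {in S &, injective f} by move=> x y _ _ /fI.
rewrite /unlabeled_count /ucographs cographs_cog0 // -cA {h hI}.
rewrite -(@card_imset_kernel _ _ _ _ (fun G : graph 'I_#|A| => iso_class (gmap f G))).
  apply: eq_card => C; apply/imsetP/imsetP => [[G]|[G]]; rewrite inE => /andP[].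
    move=> cG /eqP kG ->; pose B := vset G.
    have [|h [hI hA]] := @set_injection _ B A; first by rewrite kG.
    have hBA : h @: B = A.
      by apply/eqP; rewrite eqEcard hA card_in_imset // kG leqnn.
    have ghI : {in B &, injective (g \o h)}.
      by move=> x y xB yB /= /gI; rewrite -hBA !imset_f // => /(_ isT isT)/hI->.
    have ghT : (g \o h) @: B = setT.
      by apply/eqP; rewrite eqEcard subsetT cardsT card_ord card_in_imset // kG leqnn.
    exists (gmap (g \o h) G).
      by rewrite inE cog0_gmap // /vset /= -/(vset G) ghT eqxx.
    apply/eqP; rewrite iso_class_eq gmap_comp; apply: iso_gmap.
      exact: cog0_simple.
    move=> x y xB yB /= /fI; exact: ghI.
  move=> /eqP vG cG ->; exists (gmap f G) => //.
  by rewrite inE cog0_gmap //= /vset /= -/(vset G) vG fT.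
move=> G H; rewrite !inE => /andP[_ cG] /andP[_ cH]; rewrite !iso_class_eq.
have sG := cog0_simple cG; have sH := cog0_simple cH.
apply/idP/idP; first exact: iso_gmap_iso.
have mK K : simple K -> gmap g (gmap f K) = K.
  by move=> sK; rewrite gmap_comp gmap_id // => x _ /=.
rewrite -[in X in _ -> X](mK G) // -[in X in _ -> X](mK H) //; apply: iso_gmap_iso.
- exact: simple_gmap.
- by move=> x y /imsetP[i _ ->] /imsetP[j _ ->]; rewrite !fK => ->.
- by move=> x y /imsetP[i _ ->] /imsetP[j _ ->]; rewrite !fK => ->.
Qed.

End Counts.

(** * Components, vertex connectivity and labeled counts *)

Section Components.
Variable T : finType.
Implicit Types (G H K : graph T) (A B X : {set T}).

Definition gcomp G x : {set T} := [set y | connect (adj G) x y].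

Definition comps G : {set {set T}} := [set gcomp G x | x in vset G].

Lemma connect_adjC G : connect_sym (adj G).
Proof. by apply: sym_connect_sym => x y; apply: adjC. Qed.

Lemma adj_closed_vset G : closed (adj G) (vset G).
Proof. by move=> x y /adj_vset/andP[-> ->]. Qed.

Lemma gcomp_sub G x : x \in vset G -> gcomp G x \subset vset G.
Proof.
move=> xG; apply/subsetP => y; rewrite inE => xy.
by rewrite -(closed_connect (@adj_closed_vset G) xy).
Qed.

Lemma mem_comp G x : x \in gcomp G x.
Proof. by rewrite inE connect0. Qed.

Lemma comp_closed G x : closed (adj G) (gcomp G x).
Proof.
by move=> y z yz; rewrite !inE; apply: (same_connect_r (@connect_adjC G)); apply: connect1.
Qed.

Lemma gcomp_eq G x y : y \in gcomp G x -> gcomp G y = gcomp G x.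
Proof.
rewrite inE => xy; apply/setP => z; rewrite !inE.
by rewrite (same_connect (@connect_adjC G) xy).
Qed.

Lemma connect_ind G A x y : closed (adj G) A -> x \in A ->
  connect (adj (ind G A)) x y = connect (adj G) x y.
Proof.
move=> cA xA; apply/idP/idP.
  by apply: connect_sub => a b; rewrite adj_ind => /andP[/connect1].
case/connectP => p pP ->; apply/connectP; exists p => //.
elim: p x xA pP => //= z p IHp x xA /andP[xz zp].
have zA : z \in A by rewrite -(cA _ _ xz).
by rewrite adj_ind xz xA zA IHp.
Qed.

Lemma connect_ind_sub G A B x y : A \subset B ->
  connect (adj (ind G A)) x y -> connect (adj (ind G B)) x y.
Proof.
move=> /subsetP AB; apply: connect_sub => a b; rewrite adj_ind => /and3P[ab aA bA].
by apply: connect1; rewrite adj_ind ab !AB.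
Qed.

Lemma comp_ind G A x : closed (adj G) A -> x \in A -> gcomp (ind G A) x = gcomp G x.
Proof. by move=> cA xA; apply/setP => y; rewrite !inE connect_ind. Qed.

Lemma gunion_split G A : simple G -> closed (adj G) A ->
  G = gunion (ind G A) (ind G (~: A)).
Proof.
move=> sG cA; apply: simple_eq => // [||x y].
- by apply: simple_gunion; apply: simple_ind.
- by rewrite /vset /= -setIUr setUCr setIT.
rewrite adj_gunion ?simple_ind // !adj_ind; case xy: (adj G x y) => //=.
by rewrite !inE (cA _ _ xy) !andbb orbN.
Qed.

Lemma ind_setC_disjoint G A : [disjoint vset (ind G A) & vset (ind G (~: A))].
Proof.
apply: disjointWl (subsetIr _ _) _; apply: disjointWr (subsetIr _ _) _.
by rewrite disjoints_subset setCK.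
Qed.

Lemma card_gunion G H : [disjoint vset G & vset H] ->
  #|vset (gunion G H)| = #|vset G| + #|vset H|.
Proof. by move=> d; rewrite cardsU disjoint_setI0 // cards0 subn0. Qed.

Lemma card_ind_setC G B : B \subset vset G ->
  #|vset (ind G (~: B))| = #|vset G| - #|B|.
Proof. by move=> sB; rewrite -cardsDS // setDE. Qed.

Lemma gconnected_comp G x : x \in vset G -> gconnected G = (gcomp G x == vset G).
Proof.
move=> xG; apply/andP/eqP => [[_ /forall_inP cG]|e].
  apply/eqP; rewrite eqEsubset gcomp_sub //; apply/subsetP => y yG; rewrite inE.
  exact: (forall_inP (cG x xG)).
split; first by apply/set0Pn; exists x.
apply/forall_inP => y; rewrite -e => yC; apply/forall_inP => z zC.
by rewrite -[connect _ _ _]/(z \in [pred z | connect (adj G) y z]);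
   move: zC; rewrite -(gcomp_eq yC) inE.
Qed.

Lemma comp_connected G x : x \in vset G -> gconnected (ind G (gcomp G x)).
Proof.
move=> xG; have sC := gcomp_sub xG.
rewrite (@gconnected_comp _ x) ?vset_ind ?mem_comp //.
by rewrite comp_ind ?mem_comp //; apply: comp_closed.
Qed.

Lemma compsP G B : B \in comps G <->
  [/\ B \subset vset G, closed (adj G) B & gconnected (ind G B)].
Proof.
split=> [/imsetP[x xG ->]|[sB cB gB]].
  by split; [apply: gcomp_sub | apply: comp_closed | apply: comp_connected].
have /set0Pn[x] : B != set0 by case/andP: gB => + _; rewrite vset_ind.
move=> xB; apply/imsetP; exists x; first exact: (subsetP sB).
move: gB; rewrite (@gconnected_comp _ x) vset_ind // comp_ind //.
by move/eqP.
Qed.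

Lemma comps_partition G : partition (comps G) (vset G).
Proof.
have -> : comps G = equivalence_partition (connect (adj G)) (vset G).
  apply: eq_in_imset => x xG; apply/setP => y; rewrite !inE.
  case xy: (connect _ _ _); rewrite ?andbF // andbT.
  by apply/esym/(subsetP (gcomp_sub xG)); rewrite inE.
apply: equivalence_partitionP => x y z _ _ _; split; first exact: connect0.
by move=> xy; rewrite (same_connect (@connect_adjC G) xy).
Qed.

Lemma closed_gunion G H : simple G -> simple H -> [disjoint vset G & vset H] ->
  closed (adj (gunion G H)) (vset G).
Proof.
move=> sG sH dGH x y; rewrite adj_gunion // => /orP[] /adj_vset/andP[xV yV].
  by rewrite xV yV.
by rewrite (disjointFl dGH xV) (disjointFl dGH yV).
Qed.

Lemma ind_gunionl G H A : simple G -> simple H ->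
  vset G \subset A -> [disjoint vset H & A] -> ind (gunion G H) A = G.
Proof. by move=> sG sH GA HA; rewrite ind_gunion // ind_full // ind_disj // gunion0. Qed.

Lemma gunion_comps G H : simple G -> simple H -> [disjoint vset G & vset H] ->
  gconnected G -> vset G \in comps (gunion G H).
Proof.
move=> sG sH dGH cG; apply/compsP; split; first exact: subsetUl.
  exact: closed_gunion.
by rewrite ind_gunionl // disjoint_sym.
Qed.

Lemma gunion_disconnected G H : simple G -> simple H -> [disjoint vset G & vset H] ->
  vset G != set0 -> vset H != set0 -> ~~ gconnected (gunion G H).
Proof.
move=> sG sH dGH /set0Pn[x xG] /set0Pn[y yH].
have xU : x \in vset (gunion G H) by rewrite inE xG.
rewrite (gconnected_comp xU); apply/eqP => e.
have: y \in gcomp (gunion G H) x by rewrite e inE yH orbT.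
rewrite inE => /(closed_connect (closed_gunion sG sH dGH)).
by rewrite xG (disjointFl dGH yH).
Qed.

Lemma gjoin_connected G H : simple G -> simple H -> [disjoint vset G & vset H] ->
  vset G != set0 -> vset H != set0 -> gconnected (gjoin G H).
Proof.
move=> sG sH dGH /set0Pn[x xG] /set0Pn[y yH].
have xU : x \in vset (gjoin G H) by rewrite inE xG.
have aU u v : u \in vset G -> v \in vset H -> connect (adj (gjoin G H)) u v.
  by move=> uG vH; apply: connect1; rewrite adj_gjoin // uG vH !orbT.
rewrite (gconnected_comp xU) eqEsubset gcomp_sub //; apply/subsetP => z.
rewrite !inE => /orP[zG|]; last exact: aU.
by apply: connect_trans (aU x y xG yH) _; rewrite connect_adjC aU.
Qed.

(** With at least two vertices the last construction step is a union or a join of nonempty graphs;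
    unions are disconnected, joins are connected, and complementation exchanges the two. *)
Lemma gconnected_gcompl G : cog0 G -> 1 < #|vset G| ->
  gconnected (gcompl G) = ~~ gconnected G.
Proof.
case/cog0P => [->|]; first by rewrite cards0.
case=> {G} [x|G H dGH cG cH _|G H dGH cG cH _]; first by rewrite cards1.
  have [sG sH] := (cograph_simple cG, cograph_simple cH).
  have [nG nH] := (cograph_vset_neq0 cG, cograph_vset_neq0 cH).
  rewrite (negbTE (gunion_disconnected _ _ _ _ _)) // gcompl_gunion //.
  by rewrite gjoin_connected ?simple_gcompl.
have [sG sH] := (cograph_simple cG, cograph_simple cH).
have [nG nH] := (cograph_vset_neq0 cG, cograph_vset_neq0 cH).
rewrite gjoin_connected // gcompl_gjoin //.
by rewrite (negbTE (gunion_disconnected _ _ _ _ _)) ?simple_gcompl.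
Qed.

Lemma comp_max G A x : A \subset vset G -> x \in A -> gconnected (ind G A) ->
  A \subset gcomp G x.
Proof.
move=> sA xA; rewrite (@gconnected_comp _ x) vset_ind // => /eqP e.
apply/subsetP => y; rewrite -{1}e !inE => xy.
apply: connect_sub xy => a b; rewrite adj_ind => /andP[/connect1 //].
Qed.

(** Distinct components are disjoint. In particular a component with more than half of the vertices
    is unique, which is what [j.*2 < n] provides below. *)
Lemma comp_other G B C : B \in comps G -> C \in comps G -> B != C ->
  #|B| + #|C| <= #|vset G|.
Proof.
have /and3P[_ /trivIsetP tI _] := comps_partition G.
move=> BG CG /(tI _ _ BG CG); rewrite -leq_card_setU => /eqP <-.
apply: subset_leq_card; rewrite subUset.
by move/compsP: BG => [-> _ _]; move/compsP: CG => [-> _ _].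
Qed.

Lemma set_between A B k : A \subset B -> #|A| <= k <= #|B| ->
  exists C : {set T}, [/\ A \subset C, C \subset B & #|C| = k].
Proof.
move=> AB /andP[Ak kB]; elim: k Ak kB => [|k IHk].
  rewrite leqn0 cards_eq0 => /eqP-> _; exists set0.
  by rewrite !sub0set cards0.
rewrite leq_eqVlt => /orP[/eqP e kB|Ak kB]; first by exists A; rewrite e.
have [C [AC CB cC]] := IHk Ak (ltnW kB).
have /properP[_ [x xB xC]] : C \proper B by rewrite properEcard CB cC.
exists (x |: C); rewrite cardsU1 xC cC subUset sub1set xB CB; split=> //.
exact: subset_trans AC (subsetUr _ _).
Qed.

(** * Vertex connectivity and co-components *)

Section Kappa.
Variable G : graph T.
Hypotheses (cG : cog0 G) (gG : gconnected G) (G1 : 1 < #|vset G|).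
Let n := #|vset G|.
Let m := \max_(B in comps (gcompl G)) #|B|.

Lemma cocomp_card B : B \in comps (gcompl G) -> 0 < #|B| < n.
Proof.
move=> /compsP[sB cB gB]; rewrite card_gt0.
have -> /= : B != set0 by case/andP: gB => + _; rewrite vset_ind.
apply: proper_card; rewrite properEneq -[vset G]/(vset (gcompl G)) sB andbT.
apply: contraL gG => /eqP e; rewrite -gconnected_gcompl //.
by move: gB; rewrite e ind_full // simple_gcompl.
Qed.

Lemma comps_gcompl_neq0 : 0 < #|comps (gcompl G)|.
Proof.
have /set0Pn[x xG] : vset G != set0 by rewrite -card_gt0 ltnW.
by rewrite card_gt0; apply/set0Pn; exists (gcomp (gcompl G) x); apply: imset_f.
Qed.

(** If [ind G X] were disconnected, its complement, induced by [X] in [gcompl G], would be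
    connected, so [X] would lie in one co-component. *)
Lemma large_ind_connected X : X \subset vset G -> 1 < #|X| -> m < #|X| ->
  gconnected (ind G X).
Proof.
move=> sX X1 mX; apply: contraLR mX; rewrite -gconnected_gcompl ?cog0_ind ?vset_ind //.
rewrite gcompl_ind ?cog0_simple // => gX.
have /set0Pn[x xX] : X != set0 by rewrite -card_gt0 ltnW.
rewrite -leqNgt; apply: leq_trans (subset_leq_card (comp_max _ xX gX)) _ => //.
by apply: leq_bigmax_cond; apply: imset_f; apply: (subsetP sX).
Qed.

(** The largest co-component [B] induces a disconnected subgraph of [G]; two vertices of [B] not
    linked in it stay separated in every subset of [B] that contains them. *)
Lemma small_ind_disconnected k : 1 < k <= m ->
  exists X : {set T}, [/\ X \subset vset G, #|X| = k & ~~ gconnected (ind G X)].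
Proof.
case/andP=> k1 km; have [B BG mB] := eq_bigmax_cond (fun B : {set T} => #|B|) comps_gcompl_neq0.
rewrite /m mB in km; have /compsP[sB _ gB] := BG.
have B1 : 1 < #|B| by apply: leq_trans km.
rewrite -[vset _]/(vset G) in sB.
have: ~~ gconnected (ind G B).
  by rewrite -gconnected_gcompl ?cog0_ind ?vset_ind // gcompl_ind ?cog0_simple.
rewrite negb_and vset_ind // -card_gt0 (ltnW B1) /= => /forall_inPn[x xB].
case/forall_inPn => y yB xy.
have [||X [sX XB cX]] := @set_between [set x; y] B k.
- by rewrite subUset !sub1set xB.
- rewrite km andbT (leq_trans _ k1) //; by rewrite cards2; case: (_ != _).
have XG : X \subset vset G by apply: subset_trans XB sB.
exists X; split=> //; rewrite negb_and vset_ind // orbC; apply/orP; left.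
move: sX; rewrite subUset !sub1set => /andP[xX yX].
apply/forall_inPn; exists x => //; apply/forall_inPn; exists y => //.
by apply: contra xy; apply: connect_ind_sub.
Qed.

Lemma kappaE : kappa G = n - m.
Proof.
have [mn m0] : m < n /\ 0 < m.
  have [B BG mB] := eq_bigmax_cond (fun B : {set T} => #|B|) comps_gcompl_neq0.
  by have /andP[? ?] := cocomp_card BG; rewrite /m mB.
have IX (X : {set T}) : ind G (~: X) = ind G (vset G :\: X).
  by rewrite setDE -ind_ind (ind_full (A := vset G)) ?cog0_simple.
apply/eqP; rewrite eqn_leq; apply/andP; split.
  apply/bigmax_leqP => k /and4P[k0 kn _ /existsPn nX].
  rewrite leqNgt; apply/negP => mk.
  (* Deleting [k.-1] of the [n] vertices leaves [(n - k).+1]; the deleted set is the complement of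
     [X]. *)
  have [|X [sX cX dX]] := @small_ind_disconnected (n - k).+1.
    have lem a b c : a - b < c -> c < a -> 1 < (a - c).+1 <= b by lia.
    exact: lem mk kn.
  have := nX (vset G :\: X); rewrite subsetDl gremove_ind IX.
  rewrite setDDr setDv set0U (setIidPr sX) dX andbT cardsDS // cX -/n.
  have lem a c : c < a -> 0 < c -> a - (a - c).+1 = c.-1 by lia.
  by rewrite (lem n k kn k0) eqxx.
have nm : n - m < #|vset G| by rewrite -/n; lia.
apply: (@leq_bigmax_cond _ (fun k : 'I_#|vset G| => kconnected k G)
          (fun k : 'I_#|vset G| => k : nat) (Ordinal nm)).
rewrite /kconnected /= nm gG subn_gt0 mn /=; apply/existsPn => X.
apply/negP => /and3P[sX /eqP cX]; rewrite gremove_ind IX => /negP; apply.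
have cD : #|vset G :\: X| = m.+1 by rewrite cardsDS // cX -/n; lia.
by apply: large_ind_connected; rewrite ?subsetDl ?cD //; lia.
Qed.

(** A co-component with [n - j > n / 2] vertices is the largest one, by [comp_other]. *)
Lemma kappa_eq j : j.*2 < n ->
  (kappa G == j) = [exists B in comps (gcompl G), #|B| == n - j].
Proof.
move=> jn; rewrite kappaE.
have [B BG mB] := eq_bigmax_cond (fun B : {set T} => #|B|) comps_gcompl_neq0.
have /andP[B0 Bn] := cocomp_card BG.
apply/eqP/exists_inP => [e|[C CG /eqP cC]].
  by exists B; rewrite // -mB -/m -e; apply/eqP; rewrite /m mB; lia.
have [e|BC] := eqVneq B C; first by rewrite /m mB e cC; lia.
have := comp_other BG CG BC; rewrite -[vset _]/(vset G) -/n cC => le.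
have: #|C| <= m by apply: leq_bigmax_cond.
by rewrite /m mB cC; lia.
Qed.

End Kappa.

(** * Labeled counts by components *)

Definition ccgs A : {set graph T} := [set G in cgs A | gconnected G].

Lemma cgsP A G : reflect (vset G = A /\ cog0 G) (G \in cgs A).
Proof. by rewrite inE; apply: (iffP andP) => -[/eqP]. Qed.

Lemma cgs_ind A B G : G \in cgs A -> ind G B \in cgs (A :&: B).
Proof. by move=> /cgsP[<- cG]; apply/cgsP; rewrite cog0_ind. Qed.

Lemma cgs_gcompl A G : G \in cgs A -> gcompl G \in cgs A.
Proof. by move=> /cgsP[vG cG]; apply/cgsP; rewrite cog0_gcompl. Qed.

(** A graph having [B] as a component is the union of a connected graph on [B] and an arbitrary one
    on the rest, and both are recovered as induced subgraphs. *)
Lemma card_cgs_comps A B : B \subset A ->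
  #|[set G in cgs A | B \in comps G]| = #|ccgs B| * #|cgs (A :\: B)|.
Proof.
move=> BA; rewrite -cardsX.
have dBA : [disjoint B & A :\: B] by rewrite disjoints_subset setCD subsetUr.
have key G H : G \in cgs B -> H \in cgs (A :\: B) ->
  [/\ simple G, simple H, [disjoint vset G & vset H] &
      ind (gunion G H) B = G /\ ind (gunion G H) (~: B) = H].
  move=> /cgsP[vG cG] /cgsP[vH cH]; have [sG sH] := (cog0_simple cG, cog0_simple cH).
  rewrite ind_gunionl ?vG ?vH ?[gunion G H]gunionC ?ind_gunionl ?vG ?vH //.
  - by rewrite setDE subsetIr.
  - by rewrite disjoints_subset setCK.
  - by rewrite disjoint_sym.
rewrite -(card_in_imset (f := fun p => gunion p.1 p.2)) => [|[G H] [G' H']]; last first.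
  rewrite !inE /= => /andP[/andP[/= GB _] HB] /andP[/andP[/= GB' _] HB'] e.
  have [||_ _ _ [eG eH]] := key G H; rewrite ?inE //.
  have [||_ _ _ [eG' eH']] := key G' H'; rewrite ?inE //.
  by congr (_, _); [rewrite -eG -eG' e | rewrite -eH -eH' e].
apply: eq_card => G; rewrite inE; apply/andP/imsetP.
  move=> [GA /compsP[sB cB gB]]; exists (ind G B, ind G (~: B)).
    rewrite in_setX inE /= gB andbT setDE cgs_ind // andbT.
    by rewrite -{2}(setIidPr BA) cgs_ind.
  by move/cgsP: GA => [_ cG]; rewrite /= -gunion_split // cog0_simple.
case=> -[K H]; rewrite inE /= inE => /andP[/andP[KB gK] HB] ->.
have [sK sH dKH _] := key K H KB HB.
move/cgsP: KB => [vK cK]; move/cgsP: HB => [vH cH]; split.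
  by apply/cgsP; rewrite cog0_gunion // /vset /= -!/(vset _) vK vH -{1}(setIidPr BA) setID.
by rewrite -vK gunion_comps.
Qed.

Lemma card_ccgs A : 1 < #|A| -> 2 * #|ccgs A| = lab #|A|.
Proof.
move=> A1; rewrite -card_cgs -[#|cgs A|](cardsID [set G | gconnected G]).
have -> : cgs A :&: [set G | gconnected G] = ccgs A.
  by apply/setP => G; rewrite !inE.
have cK : {in cgs A, cancel (@gcompl T) (@gcompl T)}.
  by move=> G /cgsP[_ cG]; rewrite gcomplK ?cog0_simple.
rewrite mul2n -addnn; congr (_ + _); rewrite -[LHS](card_in_imset (f := @gcompl T)).
  apply: eq_card => G; apply/imsetP/idP => [[H]|].
    rewrite inE => /andP[HA gH] ->; rewrite in_setD cgs_gcompl // inE andbT.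
    by move/cgsP: HA => [vH cH]; rewrite gconnected_gcompl ?vH // gH.
  rewrite in_setD inE => /andP[gG GA]; exists (gcompl G); last by rewrite cK.
  rewrite inE cgs_gcompl //=.
  by move/cgsP: GA => [vG cG]; rewrite gconnected_gcompl ?vG.
by apply: (can_in_inj (g := @gcompl T)) => G; rewrite inE => /andP[/cK].
Qed.

Lemma cog0_card1 G x : cog0 G -> vset G = [set x] -> G = graph1 x.
Proof.
move=> cG vG; have sG := cog0_simple cG.
apply: simple_eq => // [|a b]; first by apply: cograph_simple; constructor.
apply/idP/idP => [/[dup]/adj_vset|]; last by rewrite /adj /= [_ \in set0]inE !andbF.
by rewrite vG !inE => /andP[/eqP-> /eqP->]; rewrite adj_irr.
Qed.

Lemma graph1_connected (x : T) : gconnected (graph1 x).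
Proof.
rewrite (@gconnected_comp _ x) ?inE // eqEsubset gcomp_sub ?inE //.
by rewrite sub1set mem_comp.
Qed.

Lemma card_cgs1 A : #|A| = 1 -> #|ccgs A| = 1 /\ lab #|A| = 1.
Proof.
move=> /eqP/cards1P[x ->]; rewrite -card_cgs.
have -> : cgs [set x] = [set graph1 x].
  apply/setP => G; apply/cgsP/set1P => [[vG cG]|->]; first exact: cog0_card1.
  by split=> //; apply/cog0P; right; constructor.
have -> : ccgs [set x] = [set graph1 x].
  apply/setP => G; rewrite inE; apply/andP/set1P => [[/cgsP[vG cG] _]|->].
    exact: cog0_card1.
  rewrite graph1_connected; split=> //; apply/cgsP; split=> //.
  by apply/cog0P; right; constructor.
by rewrite !cards1.
Qed.

End Components.

(** Halving is correct from size 2 on; the graph on one vertex is connected and its own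
    complement. *)
Definition clab (n : nat) : nat := if n == 1 then 1 else (lab n)./2.

Lemma card_ccgsE (T : finType) (A : {set T}) : A != set0 -> #|ccgs A| = clab #|A|.
Proof.
rewrite -card_gt0 /clab; case: eqP => [A1 _|]; first by have [] := card_cgs1 A1.
by case: (#|A|) (@card_ccgs _ A) => [|[|k]] //= <- //; rewrite mul2n doubleK.
Qed.

Lemma labE n : 1 < n -> 2 * clab n = lab n.
Proof.
move=> n1; rewrite -[n in RHS]card_ord -cardsT -card_ccgs ?cardsT ?card_ord //.
by rewrite card_ccgsE ?cardsT ?card_ord // -card_gt0 cardsT card_ord ltnW.
Qed.

Lemma lab1 : lab 1 = 1.
Proof.
have := @card_cgs1 _ [set: 'I_1]; rewrite cardsT card_ord => /(_ erefl)[_ //].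
Qed.

(* Split off the connected component of a fixed vertex. *)
Lemma lab_rec n : lab n.+1 = \sum_(k < n.+1) 'C(n, k) * (clab k.+1 * lab (n - k)).
Proof.
pose A := [set: 'I_n.+1]; pose x0 : 'I_n.+1 := ord0.
have cA : #|A| = n.+1 by rewrite cardsT card_ord.
rewrite -{1}cA -card_cgs -sum1_card.
rewrite (partition_big (fun G => gcomp G x0)
  (fun B : {set 'I_n.+1} => x0 \in B)) => [|G _]; last by rewrite mem_comp.
transitivity (\sum_(B : {set 'I_n.+1} | x0 \in B) clab #|B| * lab (n.+1 - #|B|)).
  apply: eq_bigr => B xB; have B0 : B != set0 by apply/set0Pn; exists x0.
  have -> : lab (n.+1 - #|B|) = #|cgs (A :\: B)| by rewrite card_cgs cardsDS ?subsetT // cA.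
  rewrite -card_ccgsE // -card_cgs_comps ?subsetT //.
  rewrite sum1dep_card; apply: eq_card => G; rewrite [LHS]inE [RHS]inE.
  apply: andb_id2l => /cgsP[vG cG].
  apply/eqP/imsetP => [<-|[y yG e]]; first by exists x0; rewrite // vG inE.
  by rewrite e; apply: gcomp_eq; rewrite -e.
have szB (B : {set 'I_n.+1}) : #|B| <= n.+1.
  by rewrite (leq_trans (max_card _)) ?card_ord.
(* Sets containing [x0] are sorted by the number [k] of their other elements, whence the predecessor
   here and the factor ['C(n, k)]. *)
pose F (B : {set 'I_n.+1}) := inord (#|B|.-1) : 'I_n.+1.
rewrite (partition_big F predT) //=; apply: eq_bigr => k _.
rewrite (eq_bigr (fun=> clab k.+1 * lab (n - k))); last first.
  move=> B /andP[xB /eqP <-]; have B0 : 0 < #|B| by apply/card_gt0P; exists x0.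
  have Bn : #|B| <= n.+1 := szB B.
  by rewrite /F inordK ?prednK //; case: (#|B|) B0 Bn.
rewrite sum_nat_const; congr (_ * _).
have -> : 'C(n, k) = 'C(#|A :\ x0|, k) by rewrite cardsDS ?sub1set ?inE // cards1 cA subn1.
rewrite -cards_draws; pose h (B : {set 'I_n.+1}) := x0 |: B.
have hI : {in [set B : {set 'I_n.+1} | B \subset A :\ x0 & #|B| == k] &, injective h}.
  move=> B C; rewrite !inE !subsetD1 => /andP[/andP[_ xB] _] /andP[/andP[_ xC] _] e.
  by rewrite -(setU1K xB) -(setU1K xC) -/(h B) e.
rewrite -(card_in_imset hI); apply: eq_card => B; apply/andP/imsetP.
  move=> [xB /eqP Fk]; exists (B :\ x0); last by rewrite /h setD1K.
  have Bn : #|B| <= n.+1 := szB B.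
  have := cardsD1 x0 B; rewrite xB add1n => e; rewrite e in Bn.
  rewrite inE setSD ?subsetT //; apply/eqP; rewrite -Fk /F inordK e //=.
case=> C; rewrite inE subsetD1 => /andP[/andP[_ xC] /eqP cC] ->.
split; first exact: setU11.
by rewrite /F /h cardsU1 xC cC add1n /= inord_val.
Qed.

Lemma card_kappa n j : 0 < j -> j.*2 < n ->
  #|[set G in cographs n | (kappa G == j) && gconnected G]| =
  'C(n, j) * (lab j * clab (n - j)).
Proof.
move=> j0 jn; have n1 : 1 < n by lia.
pose A := [set: 'I_n]; have cA : #|A| = n by rewrite cardsT card_ord.
have -> : cographs n = cgs A by rewrite cographs_cog0 ?(ltnW n1).
have cK : {in cgs A, cancel (@gcompl 'I_n) (@gcompl 'I_n)}.
  by move=> G /cgsP[_ cG]; rewrite gcomplK ?cog0_simple.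
transitivity #|[set G in cgs A | [exists B in comps G, #|B| == n - j]]|.
  rewrite -(card_in_imset (f := @gcompl 'I_n)); last first.
    by apply: (can_in_inj (g := @gcompl 'I_n)) => G; rewrite inE => /andP[/cK].
  apply: eq_card => G; rewrite [RHS]inE; apply/imsetP/andP => [[H]|[GA eG]].
    rewrite inE => /and3P[HA kH gH] ->; split; first exact: cgs_gcompl.
    move/cgsP: HA => [vH cH]; move: kH.
    by rewrite kappa_eq ?vH ?cA.
  exists (gcompl G); last by rewrite cK.
  have [vG cG] := cgsP _ _ GA; have sG := cog0_simple cG.
  have gG : gconnected (gcompl G).
    rewrite gconnected_gcompl ?vG ?cA //; apply/negP => gG.
    have /exists_inP[B BG /eqP cB] := eG.
    have /imsetP[x xG eB] := BG; move: gG; rewrite (gconnected_comp xG) -eB => /eqP e.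
    by move: cB; rewrite e vG cA; lia.
  have kE := @kappa_eq _ _ (cog0_gcompl cG) gG.
  rewrite -[vset (gcompl G)]/(vset G) vG cA gcomplK // in kE.
  by rewrite inE cgs_gcompl // gG andbT kE.
rewrite -sum1_card.
(* Pairs of a graph and a component of size [n - j] are counted: for each graph the inner sum is 0
   or 1, as such a component is unique. *)
transitivity (\sum_(G in cgs A) \sum_(B : {set 'I_n} | #|B| == n - j) (B \in comps G)).
  rewrite [in RHS](bigID (fun G => [exists B in comps G, #|B| == n - j])) /=.
  rewrite [X in _ = _ + X]big1 ?addn0; last first.
    move=> G /andP[_ /exists_inPn nB]; apply: big1 => B cB.
    by case BG: (B \in comps G) => //; move: (nB B BG); rewrite cB.
  apply: eq_big => [G|G]; first by rewrite inE.
  rewrite inE => /andP[/cgsP[vG cG] /exists_inP[B BG cB]].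
  rewrite (bigD1 B) //= BG big1 // => C /andP[/eqP cC CB].
  case CG: (C \in comps G) => //.
  by have := comp_other CG BG CB; rewrite cC (eqP cB) vG cA; lia.
rewrite exchange_big /=.
rewrite (eq_bigr (fun=> lab j * clab (n - j))); last first.
  move=> B /eqP cB; rewrite -big_mkcondr /= sum1dep_card card_cgs_comps ?subsetT //.
  rewrite card_cgs cardsDS ?subsetT // cA cB subKn; last by lia.
  by rewrite card_ccgsE ?cB 1?mulnC // -card_gt0 cB; lia.
rewrite sum_nat_const -bin_sub; last by lia.
rewrite -[n in 'C(n, _)]cA -cards_draws; congr (_ * _).
by apply: eq_card => B; rewrite !inE subsetT.
Qed.

Lemma card_connected n : 1 < n -> #|[set G in cographs n | gconnected G]| = clab n.
Proof.
move=> n1; rewrite -[n in RHS]card_ord -cardsT -card_ccgsE; last first.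
  by rewrite -card_gt0 cardsT card_ord ltnW.
by apply: eq_card => G; rewrite cographs_cog0 ?(ltnW n1) // !inE.
Qed.

(** * Unlabeled counts *)

Section Classes.
Variable T : finType.
Implicit Types (G H K : graph T) (A B X : {set T}) (C D t : {set graph T}).

Lemma adj_relabelE s G x y : adj (relabel s G) (s x) (s y) = adj G x y.
Proof.
apply/idP/idP; last exact: adj_relabel.
by move/(adj_relabel s^-1%g); rewrite relabelK !permK.
Qed.

Lemma simple_relabel s G : simple G -> simple (relabel s G).
Proof. by apply: simple_gmap => x y _ _ /perm_inj. Qed.

Lemma cog0_relabel s G : cog0 G -> cog0 (relabel s G).
Proof. by apply: cog0_gmap => x y _ _ /perm_inj. Qed.

Lemma mem_imset_perm (s : {perm T}) A x : (s x \in s @: A) = (x \in A).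
Proof. by rewrite mem_imset //; apply: perm_inj. Qed.

Lemma gcompl_relabel s G : simple G -> gcompl (relabel s G) = relabel s (gcompl G).
Proof.
move=> sG; apply: simple_eq => [|||x y]; rewrite ?simple_relabel ?simple_gcompl //.
rewrite -(permKV s x) -(permKV s y) adj_relabelE !adj_gcompl adj_relabelE.
by rewrite !mem_imset_perm (inj_eq (@perm_inj _ s)).
Qed.

Lemma ind_relabel s G A : simple G -> ind (relabel s G) (s @: A) = relabel s (ind G A).
Proof.
move=> sG; apply: simple_eq => [|||x y]; rewrite ?simple_ind ?simple_relabel ?simple_ind //.
  by rewrite /vset /= -!/(vset _) imsetI // => a b _ _ /perm_inj.
rewrite -(permKV s x) -(permKV s y) adj_relabelE !adj_ind adj_relabelE.
by rewrite !mem_imset_perm.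
Qed.

Lemma comps_relabel (s : {perm T}) G B : simple G ->
  (s @: B \in comps (relabel s G)) = (B \in comps G).
Proof.
have imp (u : {perm T}) H A : simple H -> A \in comps H -> u @: A \in comps (relabel u H).
  move=> sH /compsP[sA cA gA]; apply/compsP; split; first exact: imsetS.
    move=> x y; rewrite -(permKV u x) -(permKV u y) adj_relabelE => /cA.
    by rewrite !mem_imset_perm.
  by rewrite ind_relabel // gconnected_relabel.
move=> sG; apply/idP/idP; last exact: imp.
move/(imp s^-1%g); rewrite relabelK -imset_comp.
rewrite (eq_imset (g := id) _ (permK s)) imset_id; apply; exact: simple_relabel.
Qed.

(** All disjoint representatives are used, so no choice enters. For disjoint simple graphs [G] and
    [H] the sum of their classes is the class of their union ([usumE]). *)
Definition usum C D : {set graph T} :=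
  [set G | [exists H in C, exists K in D, [disjoint vset H & vset K] && (G == gunion H K)]].

Definition umult t G := #|[set B in comps G | ind G B \in t]|.

Lemma iso_gunion_class G H K : simple G -> simple H -> [disjoint vset G & vset H] ->
  isomorphic (gunion G H) K -> exists G' H', [/\ isomorphic G G', isomorphic H H',
    [disjoint vset G' & vset H'] & K = gunion G' H'].
Proof.
move=> sG sH dGH /isoP[s ->]; exists (relabel s G), (relabel s H); split.
- by apply/isoP; exists s.
- by apply/isoP; exists s.
- exact: (@disjoint_imset_in T T (fun x => s x) _ _ (in2W (@perm_inj T s)) dGH).
- exact: gmap_gunion.
Qed.

Lemma usumE G H : simple G -> simple H -> [disjoint vset G & vset H] ->
  usum (iso_class G) (iso_class H) = iso_class (gunion G H).
Proof.
move=> sG sH dGH; apply/setP => K; rewrite !inE.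
apply/exists_inP/idP => [[G']|/(iso_gunion_class sG sH dGH)[G' [H' [iG iH d e]]]].
  rewrite inE => iG /exists_inP[H']; rewrite inE => iH /andP[d /eqP ->].
  exact: iso_gunion.
by exists G'; rewrite ?inE //; apply/exists_inP; exists H'; rewrite ?inE // d e eqxx.
Qed.

Lemma iso_simple G H : isomorphic G H -> simple G -> simple H.
Proof. by move=> /isoP[s ->]; apply: simple_relabel. Qed.

Lemma iso_cog0 G H : isomorphic G H -> cog0 G -> cog0 H.
Proof. by move=> /isoP[s ->]; apply: cog0_relabel. Qed.

Lemma iso_gconnected G H : isomorphic G H -> gconnected H = gconnected G.
Proof. by move=> /isoP[s ->]; apply: gconnected_relabel. Qed.

Lemma ind_gunionr G H : simple G -> simple H -> [disjoint vset G & vset H] ->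
  ind (gunion G H) (~: vset G) = H.
Proof.
move=> sG sH dGH; rewrite gunionC ind_gunionl //.
  by rewrite -disjoints_subset disjoint_sym.
by rewrite disjoints_subset setCK.
Qed.

Lemma gunion_cancel_eq G H G' H' : simple G -> simple H -> simple G' -> simple H' ->
  [disjoint vset G & vset H] -> [disjoint vset G' & vset H'] ->
  vset G = vset G' -> gunion G H = gunion G' H' -> G = G' /\ H = H'.
Proof.
move=> sG sH sG' sH' d d' eV e; split.
  rewrite -(@ind_gunionl _ G H (vset G)) 1?disjoint_sym // e eV.
  by rewrite ind_gunionl // disjoint_sym.
by rewrite -(ind_gunionr sG sH) // e eV ind_gunionr.
Qed.

(* When the images of [G] and [G'] are different components of the common union, they
   are exchanged, using the isomorphism between them. *)
Lemma iso_cancel G H G' H' : simple G -> simple H -> simple G' -> simple H' ->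
  [disjoint vset G & vset H] -> [disjoint vset G' & vset H'] -> gconnected G ->
  isomorphic G G' -> isomorphic (gunion G H) (gunion G' H') -> isomorphic H H'.
Proof.
move=> sG0 sH0 sG' sH' d0 d' gG0 iG0.
case/(iso_gunion_class sG0 sH0 d0) => G1 [H1 [iG1 iH d e]].
apply: iso_trans (iH) _.
have iG : isomorphic G1 G' by apply: iso_trans iG0; rewrite iso_sym.
have [sG sH] := (iso_simple iG1 sG0, iso_simple iH sH0).
have gG : gconnected G1 by rewrite (iso_gconnected iG1).
have gG' : gconnected G' by rewrite (iso_gconnected iG).
have [eV|neV] := eqVneq (vset G1) (vset G').
  by have [_ <-] := gunion_cancel_eq sG' sH' sG sH d' d (esym eV) e; apply: iso_refl.
pose U := gunion G1 H1; have sU : simple U by apply: simple_gunion.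
have B1U : vset G1 \in comps U by apply: gunion_comps.
have B2U : vset G' \in comps U by rewrite /U -e; apply: gunion_comps.
have /and3P[_ /trivIsetP tI _] := comps_partition U.
have dB := tI _ _ B1U B2U neV.
pose R := ind U (~: (vset G1 :|: vset G')).
have sR : simple R by apply: simple_ind.
have EH (P Q W : graph T) : simple P -> simple Q -> simple W -> [disjoint vset P & vset W] ->
    U = gunion P W -> ind U (vset Q) = Q -> closed (adj U) (vset Q) ->
    [disjoint vset P & vset Q] ->
    W = gunion Q (ind U (~: (vset P :|: vset Q))).
  move=> sP sQ sW dPW eU iQ cQ dPQ.
  have -> : W = ind U (~: vset P) by rewrite eU ind_gunionr.
  rewrite [LHS](@gunion_split _ _ (vset Q)) ?simple_ind //; last first.
    by move=> x y; rewrite adj_ind => /andP[/cQ].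
  rewrite !ind_ind setCU; congr gunion; rewrite -[RHS]iQ; congr ind.
  by apply/setIidPr; rewrite -disjoints_subset disjoint_sym.
have e1 : H1 = gunion G' R.
  apply: EH => //; last by move/compsP: B2U => [].
  by rewrite /U -e ind_gunionl // disjoint_sym.
have e2 : H' = gunion G1 R.
  rewrite /R setUC; apply: EH => //; last by rewrite disjoint_sym.
    by rewrite ind_gunionl // disjoint_sym.
  by move/compsP: B1U => [].
have dR P : vset P \subset vset G1 :|: vset G' -> [disjoint vset P & vset R].
  move=> sP; apply: disjointWr (subsetIr _ _) _.
  by rewrite disjoints_subset setCK.
rewrite e1 e2; apply: iso_gunion => //; rewrite ?dR ?subsetUl ?subsetUr //.
- by rewrite iso_sym.
- exact: iso_refl.
Qed.

Lemma comps_eq G B x : B \in comps G -> x \in B -> B = gcomp G x.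
Proof. by move=> /imsetP[y yG ->] /gcomp_eq ->. Qed.

Lemma comps_gunion G H : simple G -> simple H -> [disjoint vset G & vset H] ->
  gconnected G -> comps (gunion G H) = vset G |: comps H.
Proof.
move=> sG sH dGH gG; have GU := gunion_comps sG sH dGH gG.
have cH : closed (adj (gunion G H)) (vset H).
  by rewrite gunionC; apply: closed_gunion; rewrite // disjoint_sym.
have iH : ind (gunion G H) (vset H) = H by rewrite gunionC ind_gunionl.
apply/setP => B; rewrite !inE; apply/imsetP/orP.
  case=> x; rewrite inE => /orP[xG|xH] ->.
    by left; rewrite (comps_eq GU xG).
  by right; rewrite -(comp_ind cH xH) iH; apply: imset_f.
case=> [/eqP->|/imsetP[x xH ->]]; first by case/imsetP: GU => x; exists x.
by exists x; rewrite ?inE ?xH ?orbT // -(comp_ind cH xH) iH.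
Qed.

Lemma umult_gunion t G H : simple G -> simple H -> [disjoint vset G & vset H] ->
  gconnected G -> umult t (gunion G H) = (G \in t) + umult t H.
Proof.
move=> sG sH dGH gG; rewrite /umult comps_gunion //.
have iG : ind (gunion G H) (vset G) = G by rewrite ind_gunionl // disjoint_sym.
have nG : vset G \notin comps H.
  apply/negP => /compsP[sV _ _]; have /andP[/set0Pn[x xG] _] := gG.
  by have := subsetP sV x xG; rewrite (disjointFr dGH xG).
rewrite (cardsD1 (vset G)) inE setU11 iG; congr (_ + _); apply: eq_card => B.
rewrite in_setD1 in_set in_setU1 in_set.
have [->|nB] /= := eqVneq B (vset G); first by rewrite (negbTE nG).
apply: andb_id2l => /compsP[sB _ _].
have dB : [disjoint vset G & B] by apply: disjointWr sB dGH.
by rewrite (ind_gunion _ sG sH) (ind_disj sG dB) gunionC gunion0.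
Qed.

Lemma umult_relabel K s G : simple G ->
  umult (iso_class K) (relabel s G) = umult (iso_class K) G.
Proof.
have imp u H : simple H -> umult (iso_class K) H <= umult (iso_class K) (relabel u H).
  move=> sH; rewrite /umult -(card_imset _ (imset_inj (@perm_inj _ u))).
  apply/subset_leq_card/subsetP => _ /imsetP[B + ->].
  rewrite !in_set => /andP[BH iB]; rewrite comps_relabel // BH ind_relabel //=.
  by apply: iso_trans iB _; apply/isoP; exists u.
move=> sG; apply/eqP; rewrite eqn_leq imp // andbT.
by rewrite -{2}(relabelK s G) imp // simple_relabel.
Qed.

Lemma umult_gt0 t G : 0 < umult t G -> exists2 B, B \in comps G & ind G B \in t.
Proof. by case/card_gt0P => B; rewrite in_set => /andP[BG ?]; exists B. Qed.

Lemma ucsP k C : reflect (exists G, [/\ cog0 G, #|vset G| = k & C = iso_class G])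
  (C \in ucs T k).
Proof.
apply: (iffP imsetP) => [[G]|[G [cG kG ->]]]; last by exists G; rewrite // inE cG kG eqxx.
by rewrite inE => /andP[cG /eqP kG ->]; exists G.
Qed.

(** Invariance is asked on the class of [G] only, because for multiplicities and component sizes it
    is established on simple graphs. *)
Lemma on_class_mono (P : pred (graph T)) G :
  (forall H, isomorphic G H -> P H = P G) -> on_class P (iso_class G) = P G.
Proof.
move=> PG; apply/exists_inP/idP => [[H]|PG1]; first by rewrite inE => /PG->.
by exists G; rewrite ?inE ?iso_refl.
Qed.

Lemma on_gconnected G : on_class (@gconnected T) (iso_class G) = gconnected G.
Proof. by apply: on_class_iso => s H; apply: gconnected_relabel. Qed.

Lemma on_umult K i G : simple G ->
  on_class (fun H => i <= umult (iso_class K) H) (iso_class G) =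
  (i <= umult (iso_class K) G).
Proof. by move=> sG; apply: on_class_mono => H /isoP[s ->]; rewrite umult_relabel. Qed.

Definition cucs k : {set {set graph T}} := [set C in ucs T k | on_class (@gconnected T) C].

Lemma usum_rep k l C D : k + l <= #|T| -> C \in ucs T k -> D \in ucs T l ->
  exists G H, [/\ cog0 G, cog0 H, [disjoint vset G & vset H], C = iso_class G &
     D = iso_class H] /\ [/\ #|vset G| = k, #|vset H| = l & usum C D = iso_class (gunion G H)].
Proof.
move=> kl /ucsP[G0 [cG0 kG ->]] /ucsP[H [cH kH ->]].
have [||G iG d] := @iso_disjoint_rep _ G0 (vset H); rewrite ?kG ?kH ?cog0_simple //.
have cG := iso_cog0 iG cG0.
have -> : iso_class G0 = iso_class G by apply/eqP; rewrite iso_class_eq.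
exists G, H; split; split=> //; first by rewrite -(iso_card iG).
by rewrite usumE ?cog0_simple.
Qed.

Lemma usum_ucs k l C D : k + l <= #|T| -> C \in ucs T k -> D \in ucs T l ->
  usum C D \in ucs T (k + l).
Proof.
move=> kl Ck Dl; have [G [H [[cG cH d _ _] [kG kH ->]]]] := usum_rep kl Ck Dl.
apply/ucsP; exists (gunion G H); split=> //; first exact: cog0_gunion.
by rewrite card_gunion // kG kH.
Qed.

Lemma cucsP k C : reflect (exists G, [/\ cog0 G, #|vset G| = k, gconnected G &
  C = iso_class G]) (C \in cucs k).
Proof.
rewrite inE; apply: (iffP andP) => [[/ucsP[G [cG kG ->]]]|[G [cG kG gG ->]]].
  by rewrite on_gconnected => gG; exists G.
by rewrite on_gconnected gG; split=> //; apply/ucsP; exists G.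
Qed.

Definition nmult n K i :=
  #|[set C in ucs T n | on_class (fun G => i <= umult (iso_class K) G) C]|.

Lemma nmult0 n K : nmult n K 0 = #|ucs T n|.
Proof.
apply: eq_card => C; rewrite in_set; case Cn: (C \in ucs T n) => //=.
by have /ucsP[G [cG _ ->]] := Cn; rewrite on_umult ?cog0_simple.
Qed.

(** Adding one copy of [K] is a bijection from the classes counted on the right to those on the
    left: it is injective by [iso_cancel], and a class on the left has a component of type [K] to
    remove. *)
Lemma nmultS n K i : cog0 K -> gconnected K -> #|vset K| + n <= #|T| ->
  nmult (#|vset K| + n) K i.+1 = nmult n K i.
Proof.
move=> cK gK; set d := #|vset K| => dn.
pose t := iso_class K; have tu : t \in ucs T d by apply/ucsP; exists K.
have gt G : t = iso_class G -> gconnected G.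
  by move/eqP; rewrite iso_class_eq => /iso_gconnected->.
rewrite /nmult -[RHS](card_in_imset (f := usum t)); last first.
  move=> C D; rewrite !in_set => /andP[Cn _] /andP[Dn _] e.
  have [G [H [[cG cH dGH et eC] [_ _ e1]]]] := usum_rep dn tu Cn.
  have [G' [H' [[cG' cH' dGH' et' eD] [_ _ e2]]]] := usum_rep dn tu Dn.
  have iG : isomorphic G G' by rewrite -iso_class_eq -et -et'.
  rewrite eC eD; apply/eqP; rewrite iso_class_eq.
  have iU : isomorphic (gunion G H) (gunion G' H') by rewrite -iso_class_eq -e1 -e2 e.
  by apply: iso_cancel iG iU; rewrite ?cog0_simple // gt.
apply: eq_card => C; apply/idP/imsetP.
  rewrite in_set => /andP[/ucsP[G [cG kG ->]]]; have sG := cog0_simple cG.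
  rewrite on_umult // => iG; have [B BG eB] := umult_gt0 (leq_trans (ltn0Sn i) iG).
  have [sB cB gB] := (compsP _ _).1 BG.
  have eG := gunion_split sG cB; have dG := ind_setC_disjoint G B.
  have [s1 s2] := (simple_ind B sG, simple_ind (~: B) sG).
  have et := iso_class_rep eB.
  exists (iso_class (ind G (~: B))); last by rewrite /t et usumE // -eG.
  have kB : #|B| = d.
    by rewrite -(@vset_ind _ G B) // -(@iso_card _ K) //; rewrite in_set in eB.
  rewrite in_set on_umult //; apply/andP; split.
    apply/ucsP; exists (ind G (~: B)); split=> //; first exact: cog0_ind.
    by rewrite card_ind_setC // kG kB addKn.
  by move: iG; rewrite {1}eG umult_gunion // eB.
case=> D /setIdP[Dn iD] ->; apply/setIdP; split; first exact: usum_ucs.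
have [G [H [[cG cH dGH et eD] [kG kH ->]]]] := usum_rep dn tu Dn.
have [sG sH] := (cog0_simple cG, cog0_simple cH).
rewrite on_umult ?simple_gunion // umult_gunion ?gt // -/t et in_set iso_refl.
by move: iD; rewrite eD (on_umult _ _ sH) -/t et.
Qed.

Lemma nmult_small n K i : n < #|vset K| -> nmult n K i.+1 = 0.
Proof.
move=> nd; apply/eqP; rewrite cards_eq0; apply/eqP/setP => C.
rewrite in_set0 in_set; apply/negP => /andP[/ucsP[G [cG kG ->]]].
rewrite on_umult ?cog0_simple // => iG.
have [B BG] := umult_gt0 (leq_trans (ltn0Sn i) iG).
have [sB _ _] := (compsP _ _).1 BG.
rewrite in_set => /iso_card; rewrite vset_ind // => kB.
by have := subset_leq_card sB; rewrite -kB kG leqNgt nd.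
Qed.

Lemma nmultE n K i : cog0 K -> gconnected K -> n <= #|T| ->
  nmult n K i = if i * #|vset K| <= n then ulab (n - i * #|vset K|) else 0.
Proof.
move=> cK gK; elim: i n => [|i IHi] n nT.
  by rewrite mul0n subn0 nmult0 card_ucs.
have [dn|nd] := leqP #|vset K| n; last first.
  rewrite (nmult_small i nd) ifF //; apply/negbTE; rewrite -ltnNge.
  by apply: leq_trans nd _; rewrite mulSn leq_addr.
rewrite -{1}(subnKC dn) nmultS ?subnKC // IHi; last by rewrite (leq_trans (leq_subr _ _)).
by rewrite mulSn leq_subRL // subnDA.
Qed.

Lemma sum_comps_umult n G : cog0 G -> #|vset G| = n ->
  n = \sum_(d < n.+1) \sum_(t in cucs d) d * umult t G.
Proof.
move=> cG kG; rewrite -{1}kG (card_partition (comps_partition G)).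
have sz B : B \in comps G -> #|B| < n.+1.
  by move=> /compsP[sB _ _]; rewrite ltnS -kG subset_leq_card.
rewrite (partition_big (fun B : {set T} => inord #|B| : 'I_n.+1) predT) //=.
apply: eq_bigr => d _.
rewrite (partition_big (fun B => iso_class (ind G B)) (mem (cucs d))) => [|B]; last first.
  move=> /andP[BG /eqP <-]; rewrite inordK ?sz //; apply/cucsP.
  move/compsP: BG => [sB _ gB]; exists (ind G B); split=> //; first exact: cog0_ind.
  by rewrite vset_ind.
apply: eq_bigr => t td.
rewrite (eq_bigr (fun=> d : nat)); last first.
  by move=> B /andP[/andP[BG /eqP <-] _]; rewrite inordK ?sz.
move/cucsP: td => [K [_ kK _ et]].
rewrite sum_nat_const mulnC; congr (_ * _); apply: eq_card => B.
rewrite in_set unfold_in -andbA; apply: andb_id2l => BG.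
rewrite et iso_class_eq in_set iso_sym; case iK: (isomorphic _ _); rewrite ?andbF // andbT.
have [sB _ _] := (compsP _ _).1 BG.
by move/iso_card: iK; rewrite vset_ind // kK => <-; apply/eqP/val_inj; rewrite /= inordK.
Qed.

(* Write [n] as the sum of the sizes of the components; a class with at least [i] components
   isomorphic to [K] is the sum of [i] copies of [K] and an arbitrary class. *)
Lemma ucs_rec n : n <= #|T| -> n * ulab n =
  \sum_(d < n.+1) d * (#|cucs d| *
     \sum_(i < n) if i.+1 * d <= n then ulab (n - i.+1 * d) else 0).
Proof.
move=> nT; pose rp C : graph T := odflt (gempty T) [pick G in C].
have rpP C : C \in ucs T n -> [/\ cog0 (rp C), #|vset (rp C)| = n & C = iso_class (rp C)].
  move=> /ucsP[G [cG kG ->]]; rewrite /rp; case: pickP => [H|/(_ G)]; last first.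
    by rewrite inE iso_refl.
  rewrite inE /= => iH; split; first exact: iso_cog0 cG.
    by rewrite -(iso_card iH).
  by apply/eqP; rewrite iso_class_eq.
rewrite -(card_ucs nT) mulnC -sum_nat_const.
rewrite (eq_bigr (fun C => \sum_(d < n.+1) \sum_(t in cucs d) d * umult t (rp C))); last first.
  by move=> C /rpP[cG kG _]; apply: sum_comps_umult.
rewrite exchange_big; apply: eq_bigr => d _ /=.
rewrite exchange_big /=.
rewrite (eq_bigr (fun=> d * \sum_(i < n) if i.+1 * d <= n then ulab (n - i.+1 * d) else 0)).
  by rewrite sum_nat_const mulnCA.
  move=> t /cucsP[K [cK kK gK ->]]; rewrite -big_distrr /=; congr (_ * _).
  (* A multiplicity is the number of indices [i] below it, and it is at most [n]; exchanging the
     sums leaves the classes with at least [i.+1] copies of [K]. *)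
  transitivity (\sum_(C in ucs T n) \sum_(i < n) (i < umult (iso_class K) (rp C))).
    apply: eq_bigr => C /rpP[cG kG _]; set m := umult _ _.
    have mn : m <= n.
      apply: leq_trans (_ : #|comps (rp C)| <= n).
        by apply/subset_leq_card/subsetP => B; rewrite inE => /andP[].
      rewrite -[leqRHS]kG; exact: leq_imset_card.
    by rewrite -big_mkcond -(big_ord_widen n (fun=> 1) mn) sum1_card card_ord.
rewrite exchange_big; apply: eq_bigr => i _ /=.
rewrite -kK -nmultE // -big_mkcondr sum1dep_card; apply: eq_card => C; rewrite !in_set.
apply: andb_id2l => Cn; have [cG kG eC] := rpP _ Cn.
by rewrite {2}eC on_umult ?cog0_simple.
Qed.

Definition ucompl C : {set graph T} := [set gcompl G | G in C].

Lemma ucomplE G : simple G -> ucompl (iso_class G) = iso_class (gcompl G).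
Proof.
move=> sG; apply/setP => H; rewrite inE; apply/imsetP/isoP.
  by case=> K; rewrite inE => /isoP[s ->] ->; exists s; rewrite gcompl_relabel.
case=> s ->; exists (relabel s G); last by rewrite gcompl_relabel.
by rewrite inE; apply/isoP; exists s.
Qed.

Lemma ucomplK k : {in ucs T k, cancel ucompl ucompl}.
Proof.
move=> C /ucsP[G [/cog0_simple sG _ ->]].
by rewrite !ucomplE ?simple_gcompl // gcomplK.
Qed.

Lemma ucompl_ucs k C : C \in ucs T k -> ucompl C \in ucs T k.
Proof.
move=> /ucsP[G [cG kG ->]]; rewrite ucomplE ?cog0_simple //; apply/ucsP.
by exists (gcompl G); rewrite cog0_gcompl.
Qed.

Lemma ucompl_conn k C : 1 < k -> C \in ucs T k ->
  on_class (@gconnected T) (ucompl C) = ~~ on_class (@gconnected T) C.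
Proof.
move=> k1 /ucsP[G [cG kG ->]]; rewrite ucomplE ?cog0_simple // !on_gconnected.
by rewrite gconnected_gcompl ?kG.
Qed.

Lemma card_cucs k : 1 < k <= #|T| -> 2 * #|cucs k| = ulab k.
Proof.
case/andP=> k1 kT; rewrite -(card_ucs kT).
rewrite -[#|ucs T k|](cardsID [set C | on_class (@gconnected T) C]).
have -> : ucs T k :&: [set C | on_class (@gconnected T) C] = cucs k.
  by apply/setP => C; rewrite !inE.
rewrite mul2n -addnn; congr (_ + _); rewrite -[LHS](card_in_imset (f := ucompl)).
  apply: eq_card => C; apply/imsetP/idP => [[D]|].
    rewrite inE => /andP[Dk gD] ->.
    by rewrite in_setD inE ucompl_ucs // (ucompl_conn k1 Dk) gD.
  rewrite in_setD inE => /andP[gC Ck]; exists (ucompl C); last by rewrite (ucomplK Ck).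
  by rewrite inE ucompl_ucs // (ucompl_conn k1 Ck).
by apply: (can_in_inj (g := ucompl)) => C; rewrite inE => /andP[/ucomplK].
Qed.

Lemma card_cucs1 : 0 < #|T| -> #|cucs 1| = 1.
Proof.
case/card_gt0P => x _; rewrite (_ : cucs 1 = [set iso_class (graph1 x)]) ?cards1 //.
have cx y : cog0 (graph1 y) by apply/cog0P; right; constructor.
apply/setP => C; apply/cucsP/set1P => [[G [cG /eqP/cards1P[y vG] gG ->]]|->].
  rewrite (cog0_card1 cG vG); apply/eqP; rewrite iso_class_eq.
  have -> : graph1 x = gmap (fun=> x) (graph1 y) by rewrite /gmap imset_set1 imset0.
  apply: iso_gmap; first exact: cog0_simple.
  by move=> a b; rewrite !inE => /eqP-> /eqP->.
by exists (graph1 x); rewrite cards1 graph1_connected.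
Qed.

Lemma on_comp_card k G : simple G ->
  on_class (fun H => [exists B in comps H, #|B| == k]) (iso_class G) =
  [exists B in comps G, #|B| == k].
Proof.
have imp s H : simple H -> [exists B in comps H, #|B| == k] ->
    [exists B in comps (relabel s H), #|B| == k].
  move=> sH /exists_inP[B BH cB]; apply/exists_inP; exists (s @: B).
    by rewrite comps_relabel.
  by rewrite card_imset //; apply: perm_inj.
move=> sG; apply: on_class_mono => H /isoP[s ->]; apply/idP/idP; last exact: imp.
by move/(imp s^-1%g); rewrite relabelK; apply; apply: simple_relabel.
Qed.

(** A class splits into its component with [n - j] vertices and the rest; [j.*2 < n] makes that
    component unique, so the splitting is well defined. *)
Lemma card_big_comp n j : j.*2 < n <= #|T| ->
  #|[set C in ucs T n | on_class (fun G => [exists B in comps G, #|B| == n - j]) C]| =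
  #|cucs (n - j)| * ulab j.
Proof.
case/andP=> jn nT; have jT : j <= #|T| by lia.
have nj : n - j + j = n by lia.
have njT : n - j + j <= #|T| by rewrite nj.
rewrite -(card_ucs jT) -cardsX.
rewrite -[RHS](card_in_imset (f := fun p => usum p.1 p.2)); last first.
  move=> [C D] [C' D']; rewrite !in_setX /= => /andP[Cc Du] /andP[Cc' Du'] e.
  have Cu : C \in ucs T (n - j) by move: Cc; rewrite inE => /andP[].
  have Cu' : C' \in ucs T (n - j) by move: Cc'; rewrite inE => /andP[].
  have [G [H [[cG cH d eC eD] [kG kH e1]]]] := usum_rep njT Cu Du.
  have [G' [H' [[cG' cH' d' eC' eD'] [kG' kH' e2]]]] := usum_rep njT Cu' Du'.
  have gG : gconnected G by move: Cc; rewrite inE eC on_gconnected => /andP[].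
  have gG' : gconnected G' by move: Cc'; rewrite inE eC' on_gconnected => /andP[].
  have [sG sH] := (cog0_simple cG, cog0_simple cH).
  have [sG' sH'] := (cog0_simple cG', cog0_simple cH').
  have /(iso_gunion_class sG sH d) [G1 [H1 [iG iH d1 eU]]] :
    isomorphic (gunion G H) (gunion G' H') by rewrite -iso_class_eq -e1 -e2 e.
  have [s1 s2] := (iso_simple iG sG, iso_simple iH sH).
  (* Otherwise two distinct components of one graph on [n] vertices would have [n - j] vertices
     each. *)
  have eV : vset G1 = vset G'.
    apply/eqP/negPn/negP => neV.
    have g1 := gunion_comps s1 s2 d1 (etrans (iso_gconnected iG) gG).
    have g2 := gunion_comps sG' sH' d' gG'; rewrite eU in g2.
    have := comp_other g1 g2 neV; rewrite kG' -(iso_card iG) kG.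
    by rewrite card_gunion // -(iso_card iG) -(iso_card iH) kG kH; move: jn; clear; lia.
  have [eG eH] := gunion_cancel_eq s1 s2 sG' sH' d1 d' eV (esym eU).
  by rewrite eC eD eC' eD'; congr (_, _); apply/eqP; rewrite iso_class_eq -?eG -?eH.
apply: eq_card => C; rewrite inE; apply/andP/imsetP.
  case=> /ucsP[G [cG kG ->]]; have sG := cog0_simple cG.
  rewrite on_comp_card // => /exists_inP[B /compsP[sB cB gB] /eqP cardB].
  have [s1 s2] := (simple_ind B sG, simple_ind (~: B) sG).
  exists (iso_class (ind G B), iso_class (ind G (~: B))); last first.
    by rewrite /= usumE ?ind_setC_disjoint // -gunion_split.
  rewrite in_setX /=; apply/andP; split.
    by apply/cucsP; exists (ind G B); rewrite cog0_ind // vset_ind.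
  apply/ucsP; exists (ind G (~: B)); rewrite cog0_ind //; split=> //.
  by rewrite card_ind_setC // kG cardB subKn //; lia.
case=> -[D E]; rewrite in_setX /= => /andP[Dc Eu] ->.
have Du : D \in ucs T (n - j) by move: Dc; rewrite inE => /andP[].
split; first by have := usum_ucs njT Du Eu; rewrite nj.
have [G [H [[cG cH d eD eE] [kG kH ->]]]] := usum_rep njT Du Eu.
have gG : gconnected G by move: Dc; rewrite inE eD on_gconnected => /andP[].
rewrite on_comp_card ?simple_gunion ?cog0_simple //; apply/exists_inP; exists (vset G).
  by apply: gunion_comps; rewrite ?cog0_simple.
by rewrite kG.
Qed.

End Classes.

Definition uclab (n : nat) : nat := if n == 1 then 1 else (ulab n)./2.

Lemma card_cucsE (T : finType) k : 0 < k <= #|T| -> #|cucs T k| = uclab k.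
Proof.
rewrite /uclab => /andP[k0 kT]; case: eqP => [->|k1].
  by rewrite card_cucs1 // (leq_trans k0).
rewrite -(@card_cucs T) ?mul2n ?doubleK // kT andbT; lia.
Qed.

Lemma ulabE n : 1 < n -> 2 * uclab n = ulab n.
Proof.
move=> n1; rewrite -(@card_cucs 'I_n) ?card_ord ?n1 ?leqnn //.
by rewrite card_cucsE // card_ord leqnn ltnW.
Qed.

Lemma ulab_rec n : n * ulab n =
  \sum_(d < n) d.+1 * (uclab d.+1 *
     \sum_(i < n) if i.+1 * d.+1 <= n then ulab (n - i.+1 * d.+1) else 0).
Proof.
rewrite (@ucs_rec 'I_n) ?card_ord // big_ord_recl mul0n add0n.
apply: eq_bigr => d _; rewrite !lift0 card_cucsE // card_ord.
exact: ltn_ord.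
Qed.

Lemma ucographsE n : 0 < n -> ucographs n = ucs 'I_n n.
Proof.
move=> n0; rewrite /ucographs /ucs cographs_cog0 //.
suff -> : [set G : graph 'I_n | (vset G == setT) && cog0 G] =
  [set G | cog0 G && (#|vset G| == n)] by [].
by apply/setP => G; rewrite !in_set card_set_ord_full andbC.
Qed.

Lemma ulab1 : ulab 1 = 1.
Proof.
by have := ulab_rec 1; rewrite !big_ord_recl !big_ord0 !mul1n !addn0 /=.
Qed.

Lemma card_uconnected n : 0 < n ->
  #|[set C in ucographs n | on_class (@gconnected _) C]| = uclab n.
Proof.
by move=> n0; rewrite ucographsE // -(@card_cucsE 'I_n) ?card_ord ?n0 ?leqnn.
Qed.

Lemma card_ukappa n j : 0 < j -> j.*2 < n ->
  #|[set C in ucographs n | on_class (fun G => kappa G == j) C &&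
       on_class (@gconnected _) C]| = ulab j * uclab (n - j).
Proof.
move=> j0 jn; have n1 : 1 < n by lia.
rewrite ucographsE ?(ltnW n1) //.
rewrite -(@card_cucsE 'I_n) ?card_ord; last by lia.
rewrite mulnC -card_big_comp ?card_ord ?jn ?leqnn //.
rewrite -[LHS](card_in_imset (f := @ucompl 'I_n)); last first.
  by apply: (can_in_inj (g := @ucompl 'I_n)) => C; rewrite inE => /andP[/ucomplK].
have onK G : on_class (fun G : graph 'I_n => kappa G == j) (iso_class G) = (kappa G == j).
  by apply: on_class_iso => s H; rewrite kappa_relabel.
apply: eq_card => C; rewrite [RHS]inE; apply/imsetP/andP.
  case=> D; rewrite inE => /andP[/ucsP[G [cG kG ->]]]; rewrite onK on_gconnected.
  case/andP=> kj gG ->; have sG := cog0_simple cG.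
  split; first by apply: ucompl_ucs; apply/ucsP; exists G.
  rewrite ucomplE // on_comp_card ?simple_gcompl //.
  by move: kj; rewrite kappa_eq ?kG.
case=> /ucsP[G [cG kG ->]]; have sG := cog0_simple cG; rewrite on_comp_card // => eG.
exists (iso_class (gcompl G)); last by rewrite ucomplE ?simple_gcompl // gcomplK.
have gG : gconnected (gcompl G).
  rewrite gconnected_gcompl ?kG //; apply/negP => gG.
  have /exists_inP[B BG /eqP cB] := eG.
  have /imsetP[x xG eB] := BG; move: gG; rewrite (gconnected_comp xG) -eB => /eqP e.
  by move: cB; rewrite e kG; lia.
have kE := @kappa_eq _ _ (cog0_gcompl cG) gG.
rewrite -[vset (gcompl G)]/(vset G) kG gcomplK // in kE.
rewrite inE onK on_gconnected gG andbT kE // eG andbT; apply/ucsP.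
by exists (gcompl G); rewrite cog0_gcompl.
Qed.

(** * Formal power series as coefficient sequences *)

Local Open Scope R_scope.

HB.instance Definition _ := Monoid.isComLaw.Build R 0 Rplus
  (fun x y z => esym (Rplus_assoc x y z)) Rplus_comm Rplus_0_l.
HB.instance Definition _ := Monoid.isComLaw.Build R 1 Rmult
  (fun x y z => esym (Rmult_assoc x y z)) Rmult_comm Rmult_1_l.
HB.instance Definition _ := Monoid.isMulLaw.Build R 0 Rmult Rmult_0_l Rmult_0_r.
HB.instance Definition _ := Monoid.isAddLaw.Build R Rmult Rplus
  (fun x y z => Rmult_plus_distr_r x y z) (fun x y z => Rmult_plus_distr_l x y z).

Local Notation "\sum_ ( i < n ) F" := (\big[Rplus/0]_(i < n) F) : R_scope.

#[local] Arguments INR : simpl never.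

Lemma INRD m n : INR (m + n)%N = INR m + INR n.
Proof. by rewrite -plus_INR. Qed.

Lemma INRM m n : INR (m * n)%N = INR m * INR n.
Proof. by rewrite -mult_INR. Qed.

Lemma INRS n : INR n.+1 = INR n + 1.
Proof. exact: S_INR. Qed.

Lemma INR2 : INR 2 = 2.
Proof. by rewrite !INRS INR_0; lra. Qed.

Lemma INR_le m n : (m <= n)%N -> INR m <= INR n.
Proof. by move=> /leP; apply: le_INR. Qed.

Lemma INR_gt0 n : 0 < INR n.+1.
Proof. by apply: lt_0_INR; apply/ltP. Qed.

Lemma INR_ge0 n : 0 <= INR n.
Proof. exact: pos_INR. Qed.

Lemma INR_sum n (F : 'I_n -> nat) : INR (\sum_(i < n) F i)%N = \sum_(i < n) INR (F i).
Proof. by apply: (big_morph INR INRD). Qed.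

Lemma pow_add x m n : x ^ (m + n)%N = x ^ m * x ^ n.
Proof. by rewrite -Rdef_pow_add. Qed.

Lemma rsum_ge0 n (F : 'I_n -> R) : (forall i, 0 <= F i) -> 0 <= \sum_(i < n) F i.
Proof. by move=> F0; apply: big_ind => [|x y|//]; lra. Qed.

Lemma rsum_le n (F G : 'I_n -> R) :
  (forall i, F i <= G i) -> \sum_(i < n) F i <= \sum_(i < n) G i.
Proof. by move=> FG; apply: (big_ind2 Rle) => //; [lra | move=> *; lra]. Qed.

Lemma rsum_distrr n (F : 'I_n -> R) x : x * \sum_(i < n) F i = \sum_(i < n) x * F i.
Proof. exact: big_distrr. Qed.

Lemma rsum_distrl n (F : 'I_n -> R) x : (\sum_(i < n) F i) * x = \sum_(i < n) F i * x.
Proof. exact: big_distrl. Qed.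

Lemma rsum_add n (F G : 'I_n -> R) :
  \sum_(i < n) (F i + G i) = \sum_(i < n) F i + \sum_(i < n) G i.
Proof. exact: big_split. Qed.

Lemma rsum_exchange m n (F : 'I_m -> 'I_n -> R) :
  \sum_(i < m) \sum_(j < n) F i j = \sum_(j < n) \sum_(i < m) F i j.
Proof. exact: exchange_big. Qed.

Lemma rsum_widen (F : nat -> R) m n : (m <= n)%N -> (forall i, (m <= i < n)%N -> F i = 0) ->
  \sum_(i < n) F i = \sum_(i < m) F i.
Proof.
move=> mn F0; rewrite -(subnKC mn) big_split_ord /= [X in _ + X]big1 ?Rplus_0_r //.
by move=> i _; apply: F0; rewrite leq_addr -ltn_subRL ltn_ord.
Qed.

Lemma rsum_mono (F : nat -> R) m n : (m <= n)%N -> (forall i, 0 <= F i) ->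
  \sum_(i < m) F i <= \sum_(i < n) F i.
Proof.
move=> mn F0; rewrite -(subnKC mn) big_split_ord /=.
rewrite -[X in X <= _]Rplus_0_r; apply: Rplus_le_compat_l.
by apply: rsum_ge0 => i; apply: F0.
Qed.

Lemma rsum_ge_term (F : nat -> R) n i : (i < n)%N -> (forall i, 0 <= F i) ->
  F i <= \sum_(i < n) F i.
Proof.
move=> lt F0; apply: Rle_trans (rsum_mono lt F0); rewrite big_ord_recr /=.
rewrite -[X in X <= _]Rplus_0_l; apply: Rplus_le_compat_r.
by apply: rsum_ge0 => k; apply: F0.
Qed.

Lemma sum_n_big (F : nat -> R) n : sum_n F n = \sum_(i < n.+1) F i.
Proof.
elim: n => [|n IHn]; first by rewrite sum_O big_ord_recl big_ord0 Rplus_0_r.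
by rewrite sum_Sn IHn [RHS]big_ord_recr.
Qed.

(** Summation over the triangle [k + l < n], by diagonals or by rows; it underlies the associativity
    of [conv] and the comparison of products of partial sums. *)
Lemma rsum_diag (G : nat -> nat -> R) n :
  \sum_(m < n) \sum_(k < m.+1) G k (m - k)%N = \sum_(k < n) \sum_(l < (n - k)%N) G k l.
Proof.
elim: n => [|n IHn]; first by rewrite !big_ord0.
rewrite big_ord_recr /= IHn [RHS]big_ord_recr /= [X in _ = _ + X](_ : _ = G n 0%N); last first.
  by rewrite subSnn big_ord_recl big_ord0 Rplus_0_r.
rewrite [X in _ + X = _]big_ord_recr /= subnn -Rplus_assoc; congr Rplus.
rewrite -rsum_add; apply: eq_bigr => k _.
by rewrite subSn ?[RHS]big_ord_recr // ltnW.
Qed.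

Definition conv (f g : nat -> R) n := \sum_(i < n.+1) f i * g (n - i)%N.

Definition delta0 (n : nat) : R := if n == 0%N then 1 else 0.

Lemma convC f g n : conv f g n = conv g f n.
Proof.
rewrite /conv (reindex_inj rev_ord_inj) /=; apply: eq_bigr => i _.
by rewrite subSS subKn 1?Rmult_comm // -ltnS.
Qed.

Lemma eq_conv f f' g g' n : (forall i, (i <= n)%N -> f i = f' i) ->
  (forall i, (i <= n)%N -> g i = g' i) -> conv f g n = conv f' g' n.
Proof.
move=> ff gg; apply: eq_bigr => i _; rewrite ff ?gg ?leq_subr //.
by rewrite -ltnS.
Qed.

Lemma convA f g h n : conv f (conv g h) n = conv (conv f g) h n.
Proof.
pose G k l := f k * g l * h (n - (k + l))%N.
transitivity (\sum_(k < n.+1) \sum_(l < (n.+1 - k)%N) G k l).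
  apply: eq_bigr => i _; rewrite subSn; last by rewrite -ltnS.
  rewrite rsum_distrr; apply: eq_bigr => j _; rewrite /G subnDA; ring.
rewrite -rsum_diag; apply: eq_bigr => m _; rewrite rsum_distrl.
by apply: eq_bigr => k _; rewrite /G subnKC // -ltnS.
Qed.

Lemma conv_delta f n : conv delta0 f n = f n.
Proof.
rewrite /conv big_ord_recl /= subn0 big1 /delta0 /= => [|i _]; first ring.
by rewrite /= Rmult_0_l.
Qed.

Lemma convDr f g h n : conv f (fun i => g i + h i) n = conv f g n + conv f h n.
Proof. by rewrite -rsum_add; apply: eq_bigr => i _; ring. Qed.

Lemma convDl f g h n : conv (fun i => g i + h i) f n = conv g f n + conv h f n.
Proof. by rewrite -rsum_add; apply: eq_bigr => i _; ring. Qed.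

Lemma convZr c f g n : conv f (fun i => c * g i) n = c * conv f g n.
Proof. by rewrite rsum_distrr; apply: eq_bigr => i _; ring. Qed.

Lemma conv_ge0 f g n : (forall i, 0 <= f i) -> (forall i, 0 <= g i) -> 0 <= conv f g n.
Proof. by move=> f0 g0; apply: rsum_ge0 => i; apply: Rmult_le_pos. Qed.

(* The operator z d/dz on coefficient sequences. *)
Definition zD (f : nat -> R) n := INR n * f n.

Lemma zD_conv f g n : zD (conv f g) n = conv (zD f) g n + conv f (zD g) n.
Proof.
rewrite /zD /conv rsum_distrr -rsum_add; apply: eq_bigr => i _.
have {1}-> : n = (i + (n - i))%N by rewrite subnKC // -ltnS.
rewrite INRD; ring.
Qed.

(** Only degrees below [n] enter. For nonnegative coefficients, inequalities between partial sums
    replace identities between series whose convergence is still to be shown. *)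
Definition psum (f : nat -> R) z n := \sum_(i < n) f i * z ^ i.

Lemma psum_ge0 f z n : (forall i, 0 <= f i) -> 0 <= z -> 0 <= psum f z n.
Proof.
by move=> f0 z0; apply: rsum_ge0 => i; apply: Rmult_le_pos => //; apply: pow_le.
Qed.

Lemma psum_mono f z m n : (forall i, 0 <= f i) -> 0 <= z -> (m <= n)%N ->
  psum f z m <= psum f z n.
Proof.
move=> f0 z0 mn; apply: (@rsum_mono (fun i => f i * z ^ i)) => // i.
by apply: Rmult_le_pos => //; apply: pow_le.
Qed.

Lemma psum_le_var f z w n : (forall i, 0 <= f i) -> 0 <= z <= w -> psum f z n <= psum f w n.
Proof.
move=> f0 zw; apply: rsum_le => i; apply: Rmult_le_compat_l => //.
exact: pow_incr.
Qed.

Lemma psum_conv_diag f g z n :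
  psum (conv f g) z n = \sum_(k < n) \sum_(l < (n - k)%N) (f k * z ^ k) * (g l * z ^ l).
Proof.
rewrite -(rsum_diag (fun k l => (f k * z ^ k) * (g l * z ^ l))).
apply: eq_bigr => m _; rewrite rsum_distrl; apply: eq_bigr => k _.
have -> : z ^ m = z ^ k * z ^ (m - k)%N by rewrite -pow_add subnKC // -ltnS.
ring.
Qed.

Lemma psum_conv_le f g z n : (forall i, 0 <= f i) -> (forall i, 0 <= g i) -> 0 <= z ->
  psum (conv f g) z n <= psum f z n * psum g z n.
Proof.
move=> f0 g0 z0; rewrite psum_conv_diag rsum_distrl; apply: rsum_le => k.
rewrite rsum_distrr.
apply: (@rsum_mono (fun l => f k * z ^ k * (g l * z ^ l))); first exact: leq_subr.
by move=> l; repeat apply: Rmult_le_pos => //; apply: pow_le.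
Qed.

(** A product of a term of [f] and a term of [g], both of degree below [n], has degree below
    [n + n]. *)
Lemma psum_conv_ge f g z n : (forall i, 0 <= f i) -> (forall i, 0 <= g i) -> 0 <= z ->
  psum f z n * psum g z n <= psum (conv f g) z (n + n).
Proof.
move=> f0 g0 z0; rewrite psum_conv_diag rsum_distrl.
have p0 k l : 0 <= f k * z ^ k * (g l * z ^ l).
  by repeat apply: Rmult_le_pos => //; apply: pow_le.
apply: Rle_trans (_ : \sum_(k < n) \sum_(l < (n + n - k)%N) (f k * z ^ k) * (g l * z ^ l) <= _).
  apply: rsum_le => k; rewrite rsum_distrr.
  apply: (@rsum_mono (fun l => f k * z ^ k * (g l * z ^ l))) => //.
  by rewrite -addnBA ?leq_addr // ltnW.
apply: (@rsum_mono (fun k => \sum_(l < (n + n - k)%N) f k * z ^ k * (g l * z ^ l))).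
  exact: leq_addr.
by move=> k; apply: rsum_ge0.
Qed.

(** * Composition of power series *)

Section Composition.
Variable y : nat -> R.
Hypothesis y0 : y 0%N = 0.

Fixpoint fpow k : nat -> R := if k is k'.+1 then conv y (fpow k') else delta0.

Lemma fpow_add k l n : fpow (k + l) n = conv (fpow k) (fpow l) n.
Proof.
elim: k n => [|k IHk] n; first by rewrite conv_delta.
by rewrite addSn /= -convA; apply: eq_conv => // i _; apply: IHk.
Qed.

Lemma fpow_small k n : (n < k)%N -> fpow k n = 0.
Proof.
elim: k n => [//|k IHk] n nk; rewrite /= /conv; apply: big1 => i _.
case: (posnP i) => [->|i0]; first by rewrite y0 Rmult_0_l.
by rewrite IHk ?Rmult_0_r //; have := ltn_ord i; lia.
Qed.

Lemma zD_fpow k n : zD (fpow k.+1) n = INR k.+1 * conv (zD y) (fpow k) n.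
Proof.
elim: k n => [|k IHk] n.
  rewrite /= Rmult_1_l zD_conv [X in _ + X]big1 ?Rplus_0_r // => i _.
  by rewrite /zD /delta0; case: eqP => [->|_]; rewrite ?INR_0; ring.
have -> : fpow k.+2 = conv y (fpow k.+1) by [].
rewrite zD_conv.
have -> : conv y (zD (fpow k.+1)) n = INR k.+1 * conv (zD y) (fpow k.+1) n.
  rewrite (@eq_conv _ y _ (fun i => INR k.+1 * conv (zD y) (fpow k) i)) //.
  rewrite convZr convA; congr Rmult; rewrite [RHS]convA.
  by apply: eq_conv => // i _; apply: convC.
rewrite [INR k.+2]INRS; ring.
Qed.

Definition fcomp (a : nat -> R) n := \sum_(k < n.+1) a k * fpow k n.

Lemma fcompE a n N : (n < N)%N -> fcomp a n = \sum_(k < N) a k * fpow k n.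
Proof.
move=> nN; apply/esym; apply: (@rsum_widen (fun k => a k * fpow k n)) => // i /andP[ni _].
by rewrite fpow_small ?Rmult_0_r.
Qed.

Lemma fcomp_conv a b n : conv (fcomp a) (fcomp b) n = fcomp (conv a b) n.
Proof.
pose G k l := a k * b l * fpow (k + l) n.
transitivity (\sum_(k < n.+1) \sum_(l < n.+1) G k l).
  transitivity (\sum_(i < n.+1) \sum_(k < n.+1) \sum_(l < n.+1)
      a k * b l * (fpow k i * fpow l (n - i)%N)).
    apply: eq_bigr => i _; rewrite (@fcompE _ _ n.+1) // (@fcompE _ _ n.+1) ?ltnS ?leq_subr //.
    rewrite rsum_distrl; apply: eq_bigr => k _; rewrite rsum_distrr.
    by apply: eq_bigr => l _; ring.
  rewrite rsum_exchange; apply: eq_bigr => k _; rewrite rsum_exchange.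
  by apply: eq_bigr => l _; rewrite /G fpow_add rsum_distrr.
transitivity (\sum_(k < n.+1) \sum_(l < (n.+1 - k)%N) G k l).
  apply: eq_bigr => k _; apply: (@rsum_widen (G k)) => [|l /andP[kl _]]; first exact: leq_subr.
  by rewrite /G fpow_small ?Rmult_0_r //; lia.
rewrite -rsum_diag; apply: eq_bigr => m _; rewrite rsum_distrl; apply: eq_bigr => k _.
by rewrite /G subnKC // -ltnS.
Qed.

(** Chain rule; [INR k.+1 * a k.+1] are the coefficients of the derivative of [a]. *)
Lemma zD_fcomp a n :
  zD (fcomp a) n = conv (zD y) (fcomp (fun k => INR k.+1 * a k.+1)) n.
Proof.
rewrite {1}/zD {1}/fcomp rsum_distrr big_ord_recl /= /delta0.
have -> : INR n * (a 0%N * (if n == 0%N then 1 else 0)) = 0.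
  by case: eqP => [->|_]; rewrite ?INR_0; ring.
rewrite Rplus_0_l; transitivity (\sum_(k < n) INR k.+1 * a k.+1 * conv (zD y) (fpow k) n).
  apply: eq_bigr => k _; rewrite /bump /= add1n -[conv y (fpow k)]/(fpow k.+1).
  have := zD_fpow k n; rewrite /zD => h.
  by rewrite -Rmult_assoc [INR n * _]Rmult_comm Rmult_assoc h /zD; ring.
(* The added term [k = n] is zero: [zD y] has no constant term, and [fpow n] vanishes below degree
   [n]. *)
transitivity (\sum_(k < n.+1) INR k.+1 * a k.+1 * conv (zD y) (fpow k) n).
  rewrite big_ord_recr /= [X in _ = _ + _ * X]big1 ?Rmult_0_r ?Rplus_0_r // => i _.
  case: (posnP i) => [->|i0]; first by rewrite /zD /= !Rmult_0_l.
  by rewrite fpow_small ?Rmult_0_r //; have := ltn_ord i; lia.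
rewrite /conv; under eq_bigr do rewrite rsum_distrr; rewrite rsum_exchange.
apply: eq_bigr => i _; rewrite (@fcompE _ _ n.+1) ?ltnS ?leq_subr // rsum_distrr.
by apply: eq_bigr => k _; ring.
Qed.

Hypothesis y_ge0 : forall n, 0 <= y n.

Lemma fpow_ge0 k n : 0 <= fpow k n.
Proof.
elim: k n => [|k IHk] n /=; last by apply: conv_ge0.
by rewrite /delta0; case: eqP => _; lra.
Qed.

Lemma psum_fpow_le k z n : 0 <= z -> psum (fpow k) z n <= psum y z n ^ k.
Proof.
move=> z0; elim: k => [|k IHk] /=.
  rewrite /psum; case: n => [|n]; first by rewrite big_ord0; lra.
  by rewrite big_ord_recl /= big1 /delta0 /= => [|i _]; ring_simplify; lra.
apply: Rle_trans (psum_conv_le _ y_ge0 (@fpow_ge0 k) z0) _.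
by apply: Rmult_le_compat_l => //; apply: psum_ge0.
Qed.

Lemma psum_fpow_ge k z n : 0 <= z -> exists N, psum y z n ^ k <= psum (fpow k) z N.
Proof.
move=> z0; elim: k => [|k [N IHk]] /=.
  by exists 1%N; rewrite /psum big_ord_recl big_ord0 /delta0 /=; lra.
pose m := maxn n N; exists (m + m)%N; apply: Rle_trans (psum_conv_ge _ y_ge0 (@fpow_ge0 k) z0).
apply: Rmult_le_compat; first exact: psum_ge0.
- by apply: pow_le; apply: psum_ge0.
- by apply: psum_mono; rewrite // leq_maxl.
apply: Rle_trans IHk _; apply: psum_mono; rewrite ?leq_maxr //; exact: fpow_ge0.
Qed.

Lemma psum_fcomp a z n : psum (fcomp a) z n = \sum_(k < n) a k * psum (fpow k) z n.
Proof.
rewrite /psum; transitivity (\sum_(i < n) \sum_(k < n) a k * (fpow k i * z ^ i)).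
  apply: eq_bigr => i _; rewrite (@fcompE _ _ n) // rsum_distrl.
  by apply: eq_bigr => k _; ring.
by rewrite rsum_exchange; apply: eq_bigr => k _; rewrite rsum_distrr.
Qed.

Lemma psum_fcomp_le a z n : (forall k, 0 <= a k) -> 0 <= z ->
  psum (fcomp a) z n <= psum a (psum y z n) n.
Proof.
move=> a0 z0; rewrite psum_fcomp; apply: rsum_le => k.
by apply: Rmult_le_compat_l => //; apply: psum_fpow_le.
Qed.

(** A lower bound that presupposes no convergence: each of the finitely many powers [k < K] is
    captured by a long enough truncation. *)
Lemma psum_fcomp_ge a z n K : (forall k, 0 <= a k) -> 0 <= z ->
  exists N, psum a (psum y z n) K <= psum (fcomp a) z N.
Proof.
move=> a0 z0.
have [N hN] : exists N, forall k, (k < K)%N -> psum y z n ^ k <= psum (fpow k) z N.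
  elim: K => [|K [N hN]]; first by exists 0%N.
  have [N' hN'] := psum_fpow_ge K n z0; exists (maxn N N') => k.
  have mono N1 : (N1 <= maxn N N')%N -> psum (fpow k) z N1 <= psum (fpow k) z (maxn N N').
    by move=> le; apply: psum_mono => //; apply: fpow_ge0.
  rewrite ltnS leq_eqVlt => /orP[/eqP ek|kK].
    by subst k; apply: Rle_trans hN' _; apply: mono; rewrite leq_maxr.
  by apply: Rle_trans (hN k kK) _; apply: mono; rewrite leq_maxl.
exists (maxn K N); rewrite psum_fcomp.
apply: Rle_trans (_ : \sum_(k < K) a k * psum (fpow k) z (maxn K N) <= _).
  apply: rsum_le => k; apply: Rmult_le_compat_l => //.
  apply: Rle_trans (hN k (ltn_ord k)) _; apply: psum_mono; rewrite ?leq_maxr //.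
  exact: fpow_ge0.
apply: (@rsum_mono (fun k => a k * psum (fpow k) z (maxn K N))); first exact: leq_maxl.
by move=> k; apply: Rmult_le_pos => //; apply: psum_ge0 => //; apply: fpow_ge0.
Qed.

End Composition.

(** * The labeled generating function *)

Lemma nondecreasing_steps (f : nat -> R) N : (forall k, (k < N)%N -> f k <= f k.+1) ->
  forall i j, (i <= j <= N)%N -> f i <= f j.
Proof.
move=> fS i; elim=> [|j IHj] /andP[ij jN].
  by move: ij; rewrite leqn0 => /eqP->; lra.
move: ij; rewrite leq_eqVlt => /orP[/eqP->|ij]; first lra.
by apply: Rle_trans (fS j jN); apply: IHj; lia.
Qed.

(* De Bruijn and Erdos: a renewal sequence inherits the log-convexity of its increments.
   With [r = u N.+1 / u N], the numbers [x j = u j - r * u j.-1] are nonpositive for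
   [0 < j <= N], and both [x N.+1 = 0] and [x N.+2] are convolutions of [x] with [p]. *)
Lemma renewal_ratio_step (p u : nat -> R) N : (forall k, 0 < p k) -> (forall k, 0 < u k) ->
  (forall n, u n.+1 = conv p u n) ->
  (forall k, (k <= N)%N -> p k.+1 / p k <= p N.+1 / p N) ->
  (forall k, (k <= N)%N -> u k.+1 / u k <= u N.+1 / u N) ->
  u N.+1 / u N <= u N.+2 / u N.+1.
Proof.
move=> p0 u0 uE Hp Hu; set r := u N.+1 / u N.
pose x j := if j is i.+1 then u j - r * u i else u 0%N.
have rE : r * u N = u N.+1 by rewrite /r; field; have := u0 N; lra.
have xE n : conv p x n.+1 = u n.+2 - r * u n.+1.
  have -> : conv p x n.+1 = \sum_(i < n.+1) p i * x (n.+1 - i)%N + p n.+1 * u 0%N.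
    by rewrite /conv big_ord_recr /= subnn.
  have -> : u n.+2 = \sum_(i < n.+1) p i * u (n.+1 - i)%N + p n.+1 * u 0%N.
    by rewrite uE /conv big_ord_recr /= subnn.
  rewrite [u n.+1]uE /conv rsum_distrr.
  set S1 := (X in X + _ = _); set S2 := (X in _ = X + _ - _); set S3 := (X in _ = _ - X).
  have -> : S1 = S2 - S3.
    have: S1 + S3 = S2; last by move=> <-; ring.
    rewrite -rsum_add; apply: eq_bigr => i _.
    have -> : (n.+1 - i)%N = (n - i).+1 by rewrite subSn // -ltnS.
    rewrite /x; ring.
  ring.
have xN : x N.+1 = 0 by rewrite /x rE; ring.
have xneg j : (j < N)%N -> x j.+1 <= 0.
  move=> jN; have := Hu j (ltnW jN); rewrite -/r => h.
  have := Rmult_le_compat_r _ _ _ (Rlt_le _ _ (u0 j)) h.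
  have -> : u j.+1 / u j * u j = u j.+1 by field; have := u0 j; lra.
  rewrite /x; lra.
have x00 : x 0%N = u 0%N by [].
clearbody x; suff : 0 <= conv p x N.+1.
  rewrite xE => c1; have uN := u0 N.+1; apply: (Rmult_le_reg_r (u N.+1)) => //.
  have -> : u N.+2 / u N.+1 * u N.+1 = u N.+2 by field; lra.
  lra.
have [N0|N0] := posnP N.
  rewrite N0 in xN *; have -> : conv p x 1 = p 0%N * x 1%N + p 1%N * u 0%N.
    by rewrite -x00 /conv !big_ord_recl big_ord0 Rplus_0_r.
  rewrite xN.
  have := Rmult_lt_0_compat _ _ (p0 1%N) (u0 0%N); lra.
have c0 : conv p x N = 0.
  by rewrite -(prednK N0) xE (prednK N0) rE; ring.
(* Replacing [p k.+1] by the larger [p N.+1 / p N * p k] lowers the term, because [x (N - k)] is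
   nonpositive for [k < N]; at [k = N], where [x 0] is positive, both sides agree. *)
have c1 : p N.+1 / p N * conv p x N <= conv p x N.+1.
  have -> : conv p x N.+1 = \sum_(k < N.+1) p k.+1 * x (N - k)%N.
    rewrite /conv big_ord_recl /= subn0 xN Rmult_0_r Rplus_0_l.
    by apply: eq_bigr => k _; rewrite /bump /= add1n subSS.
  rewrite /conv rsum_distrr; apply: rsum_le => k.
  have kN : (k <= N)%N by rewrite -ltnS.
  have pk : p k.+1 = p k.+1 / p k * p k by field; have := p0 k; lra.
  rewrite -Rmult_assoc [X in _ <= X * _]pk.
  have [e|kl] : (N - k = 0)%N \/ (0 < N - k)%N by lia.
    have ek : nat_of_ord k = N by lia.
    by rewrite ek; lra.
  have {}kl : (N - k)%N = (N - k).-1.+1 by lia.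
  have xk : x (N - k)%N <= 0 by rewrite kl; apply: xneg; have := ltn_ord k; lia.
  move: (Hp k kN) (p0 k) xk; set A := p k.+1 / _; set C := p N.+1 / _ => h1 h2 h3.
  have h4 : 0 <= p k * - x (N - k)%N by apply: Rmult_le_pos; lra.
  have : 0 <= (C - A) * (p k * - x (N - k)%N) by apply: Rmult_le_pos; lra.
  lra.
by rewrite c0 Rmult_0_r in c1.
Qed.

(** The inverse function of [M]: inside the radius of convergence [phi (M z) = z]
    ([PSeries_phi]). *)
Definition phi x := 2 * ln (1 + x) - x.

Lemma ln_le_sub1 t : 0 < t -> ln t <= t - 1.
Proof.
move=> t0; rewrite -[in X in _ <= X](exp_ln t t0).
by have := exp_ineq1_le (ln t); lra.
Qed.

Lemma ln_lt_sub1 t : 0 < t -> t <> 1 -> ln t < t - 1.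
Proof.
move=> t0 t1; rewrite -[in X in _ < X](exp_ln t t0).
have := @exp_ineq1 (ln t); have: ln t <> 0.
  by move=> e; apply: t1; rewrite -(exp_ln t t0) e exp_0.
move=> h /(_ h); lra.
Qed.

Lemma phi_shift x : 0 <= x -> phi x = phi 1 + 2 * ln ((1 + x) / 2) + (1 - x).
Proof.
move=> x0; rewrite /phi /Rdiv ln_mult; [|lra|lra].
rewrite ln_Rinv; last lra.
have -> : 1 + 1 = 2 by lra.
ring.
Qed.

Lemma phi_max x : 0 <= x -> phi x <= phi 1.
Proof.
move=> x0; rewrite phi_shift //.
have := @ln_le_sub1 ((1 + x) / 2); have: 0 < (1 + x) / 2 by lra.
move=> h /(_ h); lra.
Qed.

Lemma phi_lt x : 0 <= x < 1 -> phi x < phi 1.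
Proof.
move=> x0; rewrite phi_shift; last lra.
have := @ln_lt_sub1 ((1 + x) / 2); have: 0 < (1 + x) / 2 by lra.
move=> h /(_ h) h1; have := h1 _; lra.
Qed.

Lemma phi_incr x y : 0 <= x <= y -> y <= 1 -> phi x <= phi y.
Proof.
move=> [x0 xy] y1; have q0 : 0 < (1 + x) / (1 + y) by apply: Rdiv_lt_0_compat; lra.
have := ln_le_sub1 q0; rewrite ln_div; [|lra|lra].
have -> : (1 + x) / (1 + y) - 1 = (x - y) / (1 + y) by field; lra.
rewrite /phi => h.
have : (x - y) / (1 + y) <= (x - y) / 2.
  apply: (Rmult_le_reg_r (2 * (1 + y))); first lra.
  have -> : (x - y) / (1 + y) * (2 * (1 + y)) = 2 * (x - y) by field; lra.
  have -> : (x - y) / 2 * (2 * (1 + y)) = (x - y) * (1 + y) by field.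
  nra.
lra.
Qed.

Lemma derive_le0_decr (f df : R -> R) a b : a <= b ->
  (forall x, a <= x <= b -> is_derive f x (df x) /\ df x <= 0) -> f b <= f a.
Proof.
move=> ab fd.
have [||c [[ac cb] e]] := @MVT_gen f a b df.
- by move=> x; rewrite Rmin_left // Rmax_right // => hx; apply: (proj1 (fd x _)); lra.
- move=> x; rewrite Rmin_left // Rmax_right // => hx; apply/continuity_pt_filterlim.
  apply: (@ex_derive_continuous _ _ f x); exists (df x); apply: (proj1 (fd x _)); lra.
rewrite Rmin_left // in ac; rewrite Rmax_right // in cb.
have := proj2 (fd c (conj ac cb)) => h.
nra.
Qed.

Lemma is_derive_psum a z n :
  is_derive (fun z => psum a z n.+1) z (psum (fun k => INR k.+1 * a k.+1) z n).
Proof.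
elim: n => [|n IHn].
  rewrite /psum big_ord0; apply: (is_derive_ext (fun=> a 0%N)); last exact: is_derive_const.
  by move=> t; rewrite big_ord_recl big_ord0 /=; ring.
apply: (is_derive_ext (fun z => psum a z n.+1 + a n.+1 * z ^ n.+1)).
  by move=> t; rewrite [RHS]/psum big_ord_recr.
rewrite [psum _ z n.+1]/psum big_ord_recr /=; apply: (is_derive_plus (V := R_NormedModule)) => //.
auto_derive => //; rewrite -/(INR n.+1) INRS; case: n {IHn} => [|n] /=.
  by rewrite INR_0; ring.
rewrite ?INRS; ring.
Qed.

(** * The equation [M' = 1 + M + M M']: radius, critical value and coefficient ratios *)

Section LabeledSeries.
Variable a : nat -> R.
Hypotheses (a0 : a 0%N = 0) (a_ge0 : forall n, 0 <= a n).
Let b k := INR k.+1 * a k.+1.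
Hypothesis bE : forall n, b n = delta0 n + a n + conv b a n.

Lemma b_ge0 n : 0 <= b n.
Proof. by apply: Rmult_le_pos => //; apply: INR_ge0. Qed.

Lemma conv_ba n : conv b a n.+1 = \sum_(k < n.+1) b k * a (n.+1 - k)%N.
Proof. by rewrite /conv big_ord_recr /= subnn a0 Rmult_0_r Rplus_0_r. Qed.

Lemma a_gt0 n : 0 < a n.+1.
Proof.
elim: n => [|n IHn].
  have := bE 0; rewrite /conv big_ord_recl big_ord0 /delta0 /= a0 /b INR_1; lra.
have: 0 < b n.+1.
  rewrite bE; have := conv_ge0 (n.+1) b_ge0 a_ge0; rewrite /delta0 /=; lra.
rewrite /b => h; apply: (Rmult_lt_reg_l (INR n.+2)); first exact: INR_gt0.
by rewrite Rmult_0_r.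
Qed.

Lemma a_init : [/\ a 1%N = 1, a 2%N = 1 & a 3%N = 4 / 3].
Proof.
have e1 : a 1%N = 1.
  have := bE 0; rewrite /conv big_ord_recl big_ord0 /delta0 /= a0 /b INR_1; lra.
have e2 : a 2%N = 1.
  have := bE 1; rewrite /conv !big_ord_recl big_ord0 /delta0 /= /bump /= subnn a0 /b e1.
  by rewrite !INRS INR_0; lra.
split=> //.
have := bE 2; rewrite /conv !big_ord_recl big_ord0 /delta0 /= /bump /= a0 /b.
rewrite -[(1 + (1 + 0)).+1]/3%N -[(1 + 0).+1]/2%N -[(2 - (1 + 0))%N]/1%N -[(2 - 0)%N]/2%N.
rewrite e1 e2 !INRS INR_0.
lra.
Qed.

(** Coefficients of [(M' + 1) / 2 = 1 / (1 - M)], the renewal sequence with increments [a k.+1]. *)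
Let u n := (b n + delta0 n) / 2.

Lemma u_rec n : u n.+1 = conv (fun k => a k.+1) u n.
Proof.
rewrite convC /u bE {1 2}/delta0 /= conv_ba.
have -> : conv (fun n => (b n + delta0 n) / 2) (fun k => a k.+1) n =
   (conv b (fun k => a k.+1) n + conv delta0 (fun k => a k.+1) n) / 2.
  by rewrite -convDl /Rdiv rsum_distrl; apply: eq_bigr => i _; field.
rewrite conv_delta.
have -> : conv b (fun k => a k.+1) n = \sum_(k < n.+1) b k * a (n.+1 - k)%N.
  by apply: eq_bigr => k _; rewrite subSn // -ltnS.
field.
Qed.

Lemma u_gt0 n : 0 < u n.
Proof.
have : 0 < b n by apply: Rmult_lt_0_compat; [apply: INR_gt0 | apply: a_gt0].
rewrite /u /delta0; case: eqP => _; lra.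
Qed.

Lemma a_u n : a n.+2 = 2 * u n.+1 / INR n.+2.
Proof.
rewrite /u /b /delta0 /=; field; have := INR_gt0 n.+1; lra.
Qed.

Lemma ratio_u_a k : a k.+3 / a k.+2 = u k.+2 / u k.+1 * (INR k.+2 / INR k.+3).
Proof.
rewrite !a_u; field.
by have := INR_gt0 k.+1; have := INR_gt0 k.+2; have := u_gt0 k.+1; lra.
Qed.

Lemma ratio_nondecreasing : forall k, u k.+1 / u k <= u k.+2 / u k.+1 /\
  a k.+2 / a k.+1 <= a k.+3 / a k.+2.
Proof.
(* The ratios of [a] are those of [u] times [INR k.+2 / INR k.+3], which also increases, so
   monotonicity passes from [u] to [a] over the same range. That range is what [renewal_ratio_step]
   needs for the next ratio of [u], which closes the induction. At [k = 0] the two ratios of [a] are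
   1 and [4 / 3]. *)
have aux N : (forall k, (k < N)%N -> u k.+1 / u k <= u k.+2 / u k.+1) ->
    forall k, (k < N)%N -> a k.+2 / a k.+1 <= a k.+3 / a k.+2.
  move=> uN [|k] kN; first by have [-> -> ->] := a_init; lra.
  rewrite !ratio_u_a; have u1 := uN _ kN.
  apply: Rmult_le_compat => //.
  - by apply/Rlt_le/Rdiv_lt_0_compat; apply: u_gt0.
  - by apply/Rlt_le/Rdiv_lt_0_compat; apply: INR_gt0.
  have h : forall m, INR m.+1 / INR m.+2 = 1 - / INR m.+2.
    by move=> m; rewrite [INR m.+2]INRS; field; have := INR_gt0 m; lra.
  rewrite !h; have := Rinv_le_contravar _ _ (INR_gt0 k.+2) (INR_le (leqnSn k.+3)); lra.
suff key N : forall k, (k < N)%N -> u k.+1 / u k <= u k.+2 / u k.+1.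
  by move=> k; split; [apply: (key k.+1) | apply: (aux k.+1) => //; apply: key].
elim: N => [//|N IHN] k; rewrite ltnS leq_eqVlt => /orP[/eqP->|]; last exact: IHN.
apply: (@renewal_ratio_step (fun k => a k.+1)) => //.
- exact: a_gt0.
- exact: u_gt0.
- exact: u_rec.
- move=> i iN; apply: (@nondecreasing_steps (fun k => a k.+2 / a k.+1) N); last by rewrite iN /=.
  exact: aux.
- by move=> i iN; apply: (@nondecreasing_steps (fun k => u k.+1 / u k) N IHN); rewrite iN /=.
Qed.

Definition rho1 := phi 1.

Lemma psum_delta z n : psum delta0 z n.+1 = 1.
Proof.
rewrite /psum big_ord_recl big1 => [|i _]; rewrite /delta0 /=; ring.
Qed.

Lemma psum_add f g z n : psum (fun i => f i + g i) z n = psum f z n + psum g z n.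
Proof. by rewrite -rsum_add; apply: eq_bigr => i _; ring. Qed.

(** For truncations the differential equation becomes an inequality, because the product of two
    truncations contains every term of the truncated product. *)
Lemma psum_ode_le x n : 0 <= x ->
  psum b x n <= 1 + psum a x n.+1 + psum b x n * psum a x n.+1.
Proof.
move=> x0; case: n => [|m].
  have -> : psum b x 0 = 0 by rewrite /psum big_ord0.
  by have := psum_ge0 1 a_ge0 x0; lra.
have {1}-> : psum b x m.+1 = 1 + psum a x m.+1 + psum (conv b a) x m.+1.
  rewrite -(psum_delta x m) -!psum_add; apply: eq_bigr => i _; by rewrite bE.
have h1 := psum_mono a_ge0 x0 (leqnSn m.+1).
have h2 := psum_conv_le m.+1 b_ge0 a_ge0 x0.
have h3 := Rmult_le_compat_l _ _ _ (psum_ge0 m.+1 b_ge0 x0) h1.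
lra.
Qed.

(** [phi (s x) - x] vanishes at 0 and is nonincreasing: its derivative is [2 s' / (1 + s) - s' - 1],
    and [psum_ode_le] amounts to [s' (1 - s) <= 1 + s]. *)
Lemma phi_psum z n : 0 <= z -> phi (psum a z n.+1) <= z.
Proof.
move=> z0; pose s z := psum a z n.+1; pose s' z := psum b z n.
have sd x : is_derive s x (s' x) := is_derive_psum a x n.
have s0 x : 0 <= x -> 0 <= s x by apply: psum_ge0.
have ineq x : 0 <= x -> s' x <= 1 + s x + s' x * s x by apply: psum_ode_le.
have := @derive_le0_decr (fun x => phi (s x) - x)
  (fun x => 2 * (s' x / (1 + s x)) - s' x - 1) 0 z z0 _.
have -> : s 0 = 0.
  by rewrite /s /psum big_ord_recl big1 => [|i _] /=; rewrite ?a0; ring.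
have -> : phi 0 = 0 by rewrite /phi Rplus_0_r ln_1; ring.
move=> h; rewrite -/(s z); suff: phi (s z) - z <= 0 - 0 by lra.
apply: h => x [x0 xz]; split.
  rewrite /phi; have sx := s0 x x0; auto_derive; last first.
    rewrite (is_derive_unique s x (s' x)) //; field; lra.
  by split; [exists (s' x) | split; [lra | split; [exists (s' x) | ]]].
have sx := s0 x x0; have := ineq x x0 => h1.
suff: s' x / (1 + s x) * 2 <= s' x + 1 by lra.
apply: (Rmult_le_reg_r (1 + s x)); first lra.
have -> : s' x / (1 + s x) * 2 * (1 + s x) = 2 * s' x by field; lra.
nra.
Qed.

(** A truncation exceeding 1 at [z] would equal 1 at some [x < z]; then [rho1 = phi 1 <= x] by
    [phi_psum], although [z <= rho1]. *)
Lemma psum_le1 z n : 0 <= z <= rho1 -> psum a z n <= 1.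
Proof.
move=> [z0 zr]; apply: Rnot_lt_le => h.
have {}h : 1 < psum a z n.+1.
  by apply: Rlt_le_trans h _; apply: psum_mono.
pose s z := psum a z n.+1.
have s0 : s 0 = 0.
  by rewrite /s /psum big_ord_recl big1 => [|i _] /=; rewrite ?a0; ring.
have cs : continuity s.
  move=> x; apply/continuity_pt_filterlim.
  by apply: (@ex_derive_continuous _ _ s x); eexists; apply: is_derive_psum.
have [|x [[x0 xz] sx]] := @IVT_gen s 0 z 1 cs.
  by rewrite s0 Rmin_left ?Rmax_right; rewrite /s; lra.
rewrite Rmin_left // in x0; rewrite Rmax_right // in xz.
have := phi_psum n x0; rewrite -/(s x) sx -/rho1 => h1.
have e : x = z by lra.
by move: sx; rewrite e /s; lra.
Qed.

Lemma rho1_gt0 : 0 < rho1.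
Proof.
rewrite /rho1; have: phi 0 < phi 1 by apply: phi_lt; lra.
by rewrite {1}/phi Rplus_0_r ln_1; lra.
Qed.

Lemma coef_le z n : 0 <= z <= rho1 -> a n * z ^ n <= 1.
Proof.
move=> hz; apply: Rle_trans (psum_le1 n.+1 hz).
apply: (@rsum_ge_term (fun i => a i * z ^ i)) => // i.
by apply: Rmult_le_pos => //; apply: pow_le; lra.
Qed.

Lemma cv_ge : Rbar_le (Rbar.Finite rho1) (CV_radius a).
Proof.
have r0 := rho1_gt0; have [ub _] := CV_radius_bounded a; apply: ub; exists 1 => n.
rewrite Rabs_pos_eq; first by apply: coef_le; lra.
by apply: Rmult_le_pos => //; apply: pow_le; lra.
Qed.

Lemma lim_psum (f : nat -> R) z l : is_pseries f z l <-> is_lim_seq (psum f z) (Rbar.Finite l).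
Proof.
rewrite is_pseries_R (is_lim_seq_incr_1 (psum f z)) /is_series.
by split; apply: filterlim_ext => n; rewrite sum_n_big.
Qed.

Lemma lim_PSeries (f : nat -> R) z : 0 <= z -> Rbar_lt (Rbar.Finite z) (CV_radius f) ->
  is_lim_seq (psum f z) (Rbar.Finite (PSeries f z)).
Proof.
move=> z0 zR; apply/lim_psum/PSeries_correct/CV_radius_inside.
by rewrite Rabs_pos_eq.
Qed.

Lemma PSeries_ge0 (f : nat -> R) z : (forall n, 0 <= f n) -> 0 <= z ->
  Rbar_lt (Rbar.Finite z) (CV_radius f) -> 0 <= PSeries f z.
Proof.
move=> f0 z0 zR; have := is_lim_seq_le (fun=> 0) (psum f z) (Rbar.Finite 0) _ _
  (is_lim_seq_const 0) (lim_PSeries z0 zR).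
by apply=> n; apply: psum_ge0.
Qed.

Lemma PSeries_ode z : 0 <= z -> Rbar_lt (Rbar.Finite z) (CV_radius a) ->
  PSeries b z = 1 + PSeries a z + PSeries b z * PSeries a z.
Proof.
move=> z0 zR.
have zRb : Rbar_lt (Rbar.Finite z) (CV_radius b) by rewrite -[b]/(PS_derive a) CV_radius_derive.
have lb := lim_PSeries z0 zRb; have la := lim_PSeries z0 zR.
have lm : is_lim_seq (psum (conv b a) z) (Rbar.Finite (PSeries b z * PSeries a z)).
  rewrite -PSeries_mult ?Rabs_pos_eq //; apply/lim_psum.
  apply: (is_pseries_ext (PS_mult b a)) => [n|]; last first.
    by apply/PSeries_correct/ex_pseries_mult; rewrite Rabs_pos_eq.
  by rewrite /PS_mult -sum_n_Reals sum_n_big.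
have : is_lim_seq (psum b z) (Rbar.Finite (1 + PSeries a z + PSeries b z * PSeries a z)).
  apply/is_lim_seq_incr_1; apply: (is_lim_seq_ext
    (fun n => 1 + psum a z n.+1 + psum (conv b a) z n.+1)).
    move=> n; rewrite -{1}(psum_delta z n) -!psum_add; apply: eq_bigr => i _.
    by rewrite -bE.
  apply: is_lim_seq_plus'; last exact: (proj1 (is_lim_seq_incr_1 _ _) lm).
  apply: is_lim_seq_plus'; first exact: is_lim_seq_const.
  exact: (proj1 (is_lim_seq_incr_1 _ _) la).
by move/is_lim_seq_unique; rewrite (is_lim_seq_unique _ _ lb) => -[].
Qed.

Lemma PSeries_phi z : 0 <= z -> Rbar_lt (Rbar.Finite z) (CV_radius a) -> phi (PSeries a z) = z.
Proof.
move=> z0 zR.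
have inR x : 0 <= x <= z -> Rbar_lt (Rbar.Finite x) (CV_radius a).
  by move=> [x0 xz]; apply: Rbar_le_lt_trans zR; exact: xz.
have M0 x : 0 <= x <= z -> 0 <= PSeries a x.
  by move=> hx; apply: PSeries_ge0; [|lra|apply: inR].
pose df x := 2 * (PSeries b x / (1 + PSeries a x)) - PSeries b x - 1.
have d x : 0 <= x <= z -> is_derive (fun x => phi (PSeries a x) - x) x (df x) /\ df x = 0.
  move=> hx; have Mx := M0 x hx; have x0 : 0 <= x by lra.
  have dx : is_derive (PSeries a) x (PSeries b x).
    by apply: is_derive_PSeries; rewrite Rabs_pos_eq //; apply: inR.
  split; last first.
    have e : PSeries b x = (1 + PSeries a x) / (1 - PSeries a x).
      have := PSeries_ode x0 (inR x hx) => h.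
      have n0 : 1 - PSeries a x <> 0 by move=> h1; nra.
      by apply: (Rmult_eq_reg_r (1 - PSeries a x)) => //; field_simplify; [nra|].
    (* With [M(x) = 1] the equation would read [M' = 2 + M']. *)
    have n0 : 1 - PSeries a x <> 0.
      by move=> h1; have := PSeries_ode x0 (inR x hx); nra.
    rewrite /df e; field; lra.
  rewrite /phi /df; auto_derive; last first.
    rewrite (is_derive_unique _ _ _ dx); field; lra.
  by repeat split; try (exists (PSeries b x); exact: dx); lra.
have e0 : phi (PSeries a 0) - 0 = 0.
  rewrite PSeries_0 a0 /phi Rplus_0_r ln_1; ring.
have h1 : phi (PSeries a z) - z <= phi (PSeries a 0) - 0.
  apply: (@derive_le0_decr (fun x => phi (PSeries a x) - x) df) => // x hx.
  by have [h e] := d x hx; split=> //; rewrite e; lra.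
have h2 : - (phi (PSeries a z) - z) <= - (phi (PSeries a 0) - 0).
  apply: (@derive_le0_decr (fun x => - (phi (PSeries a x) - x)) (fun x => - df x)) => // x hx.
  have [h e] := d x hx; split; last by rewrite e; lra.
  exact: (@is_derive_opp _ R_NormedModule _ _ _ h).
lra.
Qed.

(** For nonnegative [z] inside the radius of convergence, [z = phi (M z) <= phi 1 = rho1]. *)
Lemma cv_radius : CV_radius a = Rbar.Finite rho1.
Proof.
apply: Rbar_le_antisym; last exact: cv_ge.
apply: Rbar_not_lt_le => lt.
have r0 := rho1_gt0.
have [z [z1 z2]] : exists z, rho1 < z /\ Rbar_lt (Rbar.Finite z) (CV_radius a).
  case: (CV_radius a) lt => [r| |] //= lt.
    by exists ((rho1 + r) / 2); split; lra.
  by exists (rho1 + 1); split; lra.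
have z0 : 0 <= z by lra.
have := PSeries_phi z0 z2; have := phi_max (PSeries_ge0 a_ge0 z0 z2); rewrite -/rho1; lra.
Qed.

(** The truncations increase to a limit [S <= 1]. If [S < 1], then [phi S < rho1], and a nonnegative
    [z] between the two has [M(z) <= S], so [z = phi (M z) <= phi S], a contradiction. *)
Lemma psum_lim_rho : is_lim_seq (psum a rho1) (Rbar.Finite 1).
Proof.
have r0 := rho1_gt0.
have [|n|S lS] := @ex_finite_lim_seq_incr (psum a rho1) 1.
- by move=> n; apply: psum_mono => //; lra.
- by apply: psum_le1; lra.
have leS n : psum a rho1 n <= S.
  apply: (@is_lim_seq_incr_compare (psum a rho1) S lS) => k.
  by apply: psum_mono => //; lra.
have S1 : S <= 1.
  have := is_lim_seq_le (psum a rho1) (fun=> 1) (Rbar.Finite S) (Rbar.Finite 1) _ lS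
    (is_lim_seq_const 1).
  by apply=> n; apply: psum_le1; lra.
have S0 : 0 <= S by apply: Rle_trans (leS 0%N); rewrite /psum big_ord0; lra.
suff h : rho1 <= phi S.
  suff -> : 1 = S by [].
  apply: Rle_antisym => //; apply: Rnot_lt_le => lt.
  by have := phi_lt (conj S0 lt); rewrite -/rho1; lra.
apply: Rnot_lt_le => lt.
pose z := Rmax 0 ((phi S + rho1) / 2).
have [z0 zr zS] : [/\ 0 <= z, z < rho1 & phi S < z].
  split; rewrite /z; first exact: Rmax_l.
    by apply: Rmax_lub_lt; lra.
  by apply: Rlt_le_trans (Rmax_r _ _); lra.
have zR : Rbar_lt (Rbar.Finite z) (CV_radius a) by rewrite cv_radius.
have MS : PSeries a z <= S.
  have := is_lim_seq_le (psum a z) (fun=> S) _ _ _ (lim_PSeries z0 zR) (is_lim_seq_const S).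
  by apply=> n; apply: Rle_trans (leS n); apply: psum_le_var => //; lra.
have := PSeries_phi z0 zR; have := phi_incr (conj (PSeries_ge0 a_ge0 z0 zR) MS) S1; lra.
Qed.

(** A nondecreasing ratio that once exceeds [/ rho1] makes the terms [a n * rho1 ^ n] grow
    geometrically, against [coef_le]. *)
Lemma ratio_le k : a k.+2 / a k.+1 <= / rho1.
Proof.
have r0 := rho1_gt0; apply: Rnot_lt_le => lt; set q := a k.+2 / a k.+1 in lt.
have q0 : 0 < q by apply: Rlt_trans lt; apply: Rinv_0_lt_compat.
have grow i : a k.+1 * q ^ i <= a (k + i).+1.
  elim: i => [|i IHi]; first by rewrite addn0 /=; lra.
  have h : q <= a (k + i).+2 / a (k + i).+1.
    apply: (@nondecreasing_steps (fun k => a k.+2 / a k.+1) (k + i)); last first.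
      by rewrite leq_addr leqnn.
    by move=> j _; have [] := ratio_nondecreasing j.
  have a1 := a_gt0 (k + i).
  have : q * a (k + i).+1 <= a (k + i).+2.
    have := Rmult_le_compat_r _ _ _ (Rlt_le _ _ a1) h.
    by have -> : a (k + i).+2 / a (k + i).+1 * a (k + i).+1 = a (k + i).+2 by field; lra.
  rewrite addnS /=; have := Rmult_le_compat_l _ _ _ (Rlt_le _ _ q0) IHi; lra.
have qr : 1 < q * rho1.
  have := Rmult_lt_compat_r _ _ _ r0 lt; rewrite Rinv_l; lra.
have c0 : 0 < a k.+1 * rho1 ^ k.+1 by apply: Rmult_lt_0_compat; [apply: a_gt0 | apply: pow_lt].
have [N hN] := Pow_x_infinity (q * rho1) (Rlt_le_trans _ _ _ qr (Rle_abs _))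
  (2 / (a k.+1 * rho1 ^ k.+1)).
have := hN N (Nat.le_refl N); rewrite Rabs_pos_eq; last by apply: pow_le; lra.
move=> h; have: 2 <= (q * rho1) ^ N * (a k.+1 * rho1 ^ k.+1).
  have := Rmult_ge_compat_r (a k.+1 * rho1 ^ k.+1) _ _ (Rle_ge _ _ (Rlt_le _ _ c0)) h.
  have -> : 2 / (a k.+1 * rho1 ^ k.+1) * (a k.+1 * rho1 ^ k.+1) = 2.
    by rewrite /Rdiv Rmult_assoc Rinv_l; lra.
  lra.
have := @coef_le rho1 (k + N).+1; rewrite -addSn pow_add => h2.
have := h2 _ => h3; have {h2 h3} := h3 (conj (Rlt_le _ _ r0) (Rle_refl _)).
rewrite addSn Rpow_mult_distr => h2 h4.
have p1 : 0 <= rho1 ^ k.+1 * rho1 ^ N by apply: Rmult_le_pos; apply: pow_le; lra.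
have := Rmult_le_compat_r _ _ _ p1 (grow N); lra.
Qed.

Lemma ratio_lim : is_lim_seq (fun k => a k.+2 / a k.+1) (Rbar.Finite (/ rho1)).
Proof.
have r0 := rho1_gt0.
have [|n|l ll] := @ex_finite_lim_seq_incr (fun k => a k.+2 / a k.+1) (/ rho1).
- by move=> n; have [] := ratio_nondecreasing n.
- exact: ratio_le.
have l1 : 1 <= l.
  have := is_lim_seq_le (fun=> 1) _ _ _ _ (is_lim_seq_const 1) ll; apply=> n.
  have := @nondecreasing_steps (fun k => a k.+2 / a k.+1) n _ 0%N n; rewrite leqnn.
  have [-> -> _] := a_init; rewrite Rdiv_1_r; apply => //.
  by move=> j _; have [] := ratio_nondecreasing j.
(* The sequence is shifted because the d'Alembert test asks for nonzero terms and [a 0 = 0]. *)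
have := @CV_radius_finite_DAlembert (PS_decr_1 a) l.
rewrite CV_radius_decr_1 cv_radius => h.
have e : rho1 = / l.
  suff [//] : Rbar.Finite rho1 = Rbar.Finite (/ l); apply: h.
  - by move=> n; have := a_gt0 n; rewrite /PS_decr_1; lra.
  - lra.
  apply: is_lim_seq_ext ll => n; rewrite Rabs_pos_eq //.
  by apply/Rlt_le/Rdiv_lt_0_compat; apply: a_gt0.
by rewrite e Rinv_inv.
Qed.

Lemma psum_unbounded x B : rho1 < x -> exists K, B < psum a x K.
Proof.
move=> rx; have r0 := rho1_gt0; apply: Classical_Prop.NNPP => nK.
have bd n : psum a x n <= B by apply: Rnot_lt_le => h; apply: nK; exists n.
have: Rbar_le (Rbar.Finite x) (CV_radius a).
  have [ub _] := CV_radius_bounded a; apply: ub; exists B => n.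
  have p0 i : 0 <= a i * x ^ i by apply: Rmult_le_pos => //; apply: pow_le; lra.
  rewrite Rabs_pos_eq //; apply: Rle_trans (bd n.+1).
  exact: (@rsum_ge_term (fun i => a i * x ^ i)).
by rewrite cv_radius /=; lra.
Qed.

(** Convergence of the ratios upgrades the radius, which concerns an upper limit, to a lower bound
    for every coefficient; [c] absorbs the finitely many early ones. *)
Lemma coef_lower x : rho1 < x -> exists2 c, 0 < c & forall k, c * (/ x) ^ k <= a k.+1.
Proof.
move=> rx; have r0 := rho1_gt0; have x0 : 0 < x by lra.
have ix : 0 < / x by apply: Rinv_0_lt_compat.
have lt : / x < / rho1 by apply: Rinv_lt_contravar => //; apply: Rmult_lt_0_compat.
have [N hN] : exists N, forall n, (N <= n)%N -> / x <= a n.+2 / a n.+1.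
  have eps0 : 0 < / rho1 - / x by lra.
  have /is_lim_seq_spec /(_ (mkposreal _ eps0)) [N hN] := ratio_lim.
  exists N => n Nn; have /= := hN n (elimT leP Nn); move/Rabs_def2 => -[_]; lra.
have [c c0 hc] : exists2 c, 0 < c & forall k, (k <= N)%N -> c * (/ x) ^ k <= a k.+1.
  elim: N {hN} => [|N [c c0 hc]].
    exists (a 1%N) => [|k]; first exact: a_gt0.
    by rewrite leqn0 => /eqP->; rewrite Rmult_1_r; lra.
  have p0 : 0 < (/ x) ^ N.+1 by apply: pow_lt.
  have q0 : 0 < a N.+2 / (/ x) ^ N.+1 by apply: Rdiv_lt_0_compat => //; apply: a_gt0.
  exists (Rmin c (a N.+2 / (/ x) ^ N.+1)); first exact: Rmin_pos.
  move=> k; rewrite leq_eqVlt => /orP[/eqP->|kN].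
    apply: Rle_trans (_ : a N.+2 / (/ x) ^ N.+1 * (/ x) ^ N.+1 <= _).
      by apply: Rmult_le_compat_r; [lra | apply: Rmin_r].
    by rewrite /Rdiv Rmult_assoc Rinv_l; lra.
  apply: Rle_trans (hc k kN); apply: Rmult_le_compat_r; last exact: Rmin_l.
  by apply: pow_le; lra.
exists c => // k; elim: k => [|k IHk]; first exact: hc.
have [kN|Nk] := leqP k.+1 N; first exact: hc.
have := hN k Nk => h; have a1 := a_gt0 k.
have : / x * a k.+1 <= a k.+2.
  have := Rmult_le_compat_r _ _ _ (Rlt_le _ _ a1) h.
  by have -> : a k.+2 / a k.+1 * a k.+1 = a k.+2 by field; lra.
have := Rmult_le_compat_l _ _ _ (Rlt_le _ _ ix) IHk; rewrite /=; lra.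
Qed.

End LabeledSeries.

(** * The unlabeled generating function *)

Lemma psum_le_PSeries (f : nat -> R) z n : (forall i, 0 <= f i) -> 0 <= z ->
  Rbar_lt (Rbar.Finite z) (CV_radius f) -> psum f z n <= PSeries f z.
Proof.
move=> f0 z0 zR; apply: (is_lim_seq_incr_compare (psum f z)); first exact: lim_PSeries.
by move=> k; apply: psum_mono.
Qed.

(** * Exponential tilting of one coefficient *)

Section Tangent.
Variables (y : nat -> R) (j : nat) (L : R).
Hypothesis y_ge0 : forall n, 0 <= y n.

Definition tilt i := y i * (if i == j then exp L else 1).
Definition mark i := if i == j then y j else 0.

(** The product rule for the derivative in [L], at [L = 0], of [fpow tilt k n]. *)
Fixpoint marked k : nat -> R :=
  if k is k'.+1 then fun n => conv y (marked k') n + conv mark (fpow y k') n else fun=> 0.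

Lemma markedE k n : marked k.+1 n = INR k.+1 * conv mark (fpow y k) n.
Proof.
elim: k n => [|k IHk] n.
  rewrite /= INR_1 Rmult_1_l [X in X + _]big1 ?Rplus_0_l // => i _; ring.
rewrite [LHS]/= -/(marked k.+1).
have -> : conv y (marked k.+1) n = INR k.+1 * conv mark (fpow y k.+1) n.
  rewrite (@eq_conv _ y _ (fun i => INR k.+1 * conv mark (fpow y k) i)) //.
  rewrite convZr convA; congr Rmult; rewrite [RHS]convA.
  by apply: eq_conv => // i _; apply: convC.
by rewrite -[conv y (fpow y k)]/(fpow y k.+1) [INR k.+2]INRS; ring.
Qed.

Lemma tilt_ge0 i : 0 <= tilt i.
Proof.
apply: Rmult_le_pos => //; case: eqP => _; [have := exp_pos L | ]; lra.
Qed.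

(* [exp t >= 1 + t], applied to [exp (L * (i - m))] on the monomials of [fpow tilt k n] in
   which [y j] occurs [i] times; [marked] counts these occurrences. *)
Lemma fpow_tilt_ge k n m :
  exp (m * L) * (fpow y k n * (1 - m * L) + L * marked k n) <= fpow tilt k n.
Proof.
elim: k n m => [|k IHk] n m /=.
  rewrite /delta0; case: eqP => _; last lra.
  rewrite Rmult_0_r Rplus_0_r Rmult_1_l.
  have h := exp_ineq1_le (- (m * L)); have e := exp_pos (m * L).
  have := Rmult_le_compat_l _ _ _ (Rlt_le _ _ e) h; rewrite -exp_plus Rplus_opp_r exp_0; lra.
set E := exp (m * L).
have -> : E * (conv y (fpow y k) n * (1 - m * L) +
    L * (conv y (marked k) n + conv mark (fpow y k) n)) =
  \sum_(i < n.+1) E * (y i * fpow y k (n - i)%N * (1 - m * L) +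
    L * (y i * marked k (n - i)%N + mark i * fpow y k (n - i)%N)).
  by rewrite -rsum_distrr rsum_add -rsum_distrl -rsum_distrr rsum_add.
apply: rsum_le => i; rewrite {1}/tilt /mark; case: eqP => [->|_].
  have h := IHk (n - j)%N (m - 1); have e := exp_pos L.
  have h1 : 0 <= y j * exp L by apply: Rmult_le_pos => //; lra.
  have := Rmult_le_compat_l _ _ _ h1 h.
  have -> : exp ((m - 1) * L) = E * / exp L.
    by rewrite /E -exp_Ropp -exp_plus; congr exp; ring.
  set F := fpow y k _; set G := marked k _; set H := fpow tilt k _.
  have -> : y j * exp L * (E * / exp L * (F * (1 - (m - 1) * L) + L * G)) =
     y j * (E * (F * (1 - (m - 1) * L) + L * G)) by field; lra.
  lra.
have := Rmult_le_compat_l _ _ _ (y_ge0 i) (IHk (n - i)%N m); rewrite -/E; lra.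
Qed.

End Tangent.

(** Chain rule: tilting [y j] changes [[z^n] a(Y)] at the initial rate [[z^n] y_j z^j a'(Y)]. *)
Lemma fcomp_mark (y a : nat -> R) j n : y 0%N = 0 ->
  \sum_(k < n.+1) a k * marked y j k n =
  conv (mark y j) (fcomp y (fun k => INR k.+1 * a k.+1)) n.
Proof.
move=> y0; rewrite big_ord_recl {1}/marked Rmult_0_r Rplus_0_l.
transitivity (\sum_(k < n) INR k.+1 * a k.+1 * conv (mark y j) (fpow y k) n).
  by apply: eq_bigr => k _; rewrite lift0 markedE; ring.
transitivity (\sum_(k < n.+1) INR k.+1 * a k.+1 * conv (mark y j) (fpow y k) n).
  rewrite big_ord_recr /= [X in _ = _ + _ * X]big1 ?Rmult_0_r ?Rplus_0_r //.
  move=> i _; rewrite /mark; case: eqP => [ij|_]; last ring.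
  have [j0|j0] := posnP j; first by rewrite j0 y0; ring.
  by rewrite fpow_small ?Rmult_0_r //; have := ltn_ord i; lia.
rewrite /conv; under eq_bigr do rewrite rsum_distrr; rewrite rsum_exchange.
apply: eq_bigr => i _; rewrite (@fcompE y y0 _ _ n.+1) ?ltnS ?leq_subr // rsum_distrr.
by apply: eq_bigr => k _; ring.
Qed.

Lemma conv_mark (y f : nat -> R) j n : (j <= n)%N -> conv (mark y j) f n = y j * f (n - j)%N.
Proof.
move=> jn; rewrite /conv (bigD1 (Ordinal (jn : (j < n.+1)%N))) //= {1}/mark eqxx.
rewrite big1 ?Rplus_0_r // => i; rewrite /mark -val_eqE /= => /negbTE->; ring.
Qed.

Lemma psum_tilt y j L z n : (j < n)%N ->
  psum (tilt y j L) z n = psum y z n + (exp L - 1) * (y j * z ^ j).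
Proof.
move=> jn; have -> : (exp L - 1) * (y j * z ^ j) =
    \sum_(i < n) if (i : nat) == j then (exp L - 1) * (y j * z ^ j) else 0.
  by rewrite -big_mkcond /= (big_pred1 (Ordinal jn)) // => i; rewrite -val_eqE.
rewrite -rsum_add; apply: eq_bigr => i _; rewrite /tilt.
by case: eqP => [->|_]; ring.
Qed.

(** * The composition [V = M o Y] and its radius of convergence *)

Section UnlabeledSeries.
Variables a y v : nat -> R.
Hypotheses (a0 : a 0%N = 0) (a_ge0 : forall n, 0 <= a n).
Let b k := INR k.+1 * a k.+1.
Hypothesis bE : forall n, b n = delta0 n + a n + conv b a n.
Hypotheses (y0 : y 0%N = 0) (y1 : y 1%N = 1) (y2 : y 2%N = 1) (y_ge0 : forall n, 0 <= y n).
Hypotheses (v0 : v 0%N = 0)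
  (vE : forall n, zD v n = zD y n + conv (zD y) v n + conv (zD v) v n).

Let bg0 := b_ge0 a_ge0.
Let ag0 := a_gt0 a0 a_ge0 bE.
Let T := fcomp y a.
Let B := fcomp y b.

(** The equation [M' = 1 + M + M M'], evaluated at [Y] and multiplied by [z Y']. *)
Lemma zDE n : zD T n = zD y n + conv (zD y) T n + conv (zD T) T n.
Proof.
have BE i : B i = delta0 i + T i + conv B T i.
  rewrite /T /B fcomp_conv // /fcomp.
  have {1}-> : delta0 i = \sum_(k < i.+1) delta0 k * fpow y k i.
    rewrite big_ord_recl /= big1 => [|k _]; rewrite /delta0 /=; ring.
  by rewrite -!rsum_add; apply: eq_bigr => k _; rewrite bE; ring.
rewrite /T zD_fcomp // -/B.
rewrite (@eq_conv _ (zD y) _ (fun i => delta0 i + T i + conv B T i)) // convDr convDr.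
rewrite [conv _ delta0 _]convC conv_delta convA; congr (_ + _).
by apply: eq_conv => // i _; rewrite /T zD_fcomp.
Qed.

(** [vE] determines [v n] from smaller coefficients, since the constant terms of [zD y] and [v]
    vanish; [T] satisfies the same recurrence. *)
Lemma v_fcomp n : v n = fcomp y a n.
Proof.
rewrite -/(T n); have T0 : T 0%N = 0 by rewrite /T /fcomp big_ord_recl big_ord0 a0; ring.
elim/ltn_ind: n => -[|n] IH; first by rewrite v0 T0.
have e : zD v n.+1 = zD T n.+1.
  rewrite vE zDE; congr (_ + _ + _); apply: eq_bigr => i _.
    case: (posnP i) => [->|i0]; first by rewrite /zD INR_0; ring.
    by rewrite IH //; have := ltn_ord i; lia.
  case: (posnP i) => [->|i0]; first by rewrite /zD INR_0; ring.
  have [e|ne] := eqVneq (nat_of_ord i) n.+1; first by rewrite e subnn v0 T0; ring.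
  by have := ltn_ord i => lt; rewrite /zD !IH //; lia.
by apply: (Rmult_eq_reg_l (INR n.+1)); [exact: e | have := INR_gt0 n; lra].
Qed.

Lemma v_ge0 n : 0 <= v n.
Proof. by rewrite v_fcomp; apply: rsum_ge0 => k; apply: Rmult_le_pos => //; apply: fpow_ge0. Qed.

Lemma fpow_diag n : 0 < fpow y n n.
Proof.
elim: n => [|n IHn]; first by rewrite /fpow /delta0 /=; lra.
apply: Rlt_le_trans IHn _.
have -> : fpow y n n = y 1%N * fpow y n (n.+1 - 1)%N by rewrite y1 subn1 Rmult_1_l.
apply: (@rsum_ge_term (fun i => y i * fpow y n (n.+1 - i)%N)) => // i.
by apply: Rmult_le_pos => //; apply: fpow_ge0.
Qed.

Lemma fcomp_gt0 (f : nat -> R) n : (forall k, 0 <= f k) -> 0 < f n -> 0 < fcomp y f n.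
Proof.
move=> f0 fn; apply: Rlt_le_trans (_ : f n * fpow y n n <= _).
  by apply: Rmult_lt_0_compat => //; apply: fpow_diag.
apply: (@rsum_ge_term (fun k => f k * fpow y k n)) => // k.
by apply: Rmult_le_pos => //; apply: fpow_ge0.
Qed.

Lemma v_gt0 n : 0 < v n.+1.
Proof. by rewrite v_fcomp; apply: fcomp_gt0. Qed.

Lemma B_gt0 n : 0 < B n.
Proof. by apply: fcomp_gt0 => //; apply: Rmult_lt_0_compat => //; apply: INR_gt0. Qed.

Lemma psum_v_le1 z n : 0 <= z -> psum y z n <= rho1 -> psum v z n <= 1.
Proof.
move=> z0 le; have -> : psum v z n = psum (fcomp y a) z n.
  by apply: eq_bigr => i _; rewrite v_fcomp.
apply: Rle_trans (psum_fcomp_le y0 y_ge0 _ a_ge0 z0) _.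
by apply: (psum_le1 a0 a_ge0 bE); split=> //; apply: psum_ge0.
Qed.

Lemma psum_v_ge z n K : 0 <= z -> exists N, psum a (psum y z n) K <= psum v z N.
Proof.
move=> z0; have [N hN] := psum_fcomp_ge y0 y_ge0 n K a_ge0 z0; exists N.
by apply: Rle_trans hN _; apply: Req_le; apply: eq_bigr => i _; rewrite v_fcomp.
Qed.

Variable r : R.
Hypotheses (r0 : 0 < r) (rY : Rbar_lt (Rbar.Finite r) (CV_radius y)).
Hypothesis (Yr : PSeries y r = rho1).

(** The linear term of [Y] alone gains [x - r] between [r] and [x], so it suffices that a truncation
    at [r] is within [x - r] of [rho1]. Taking [N + 2] terms ensures that the linear one is
    present. *)
Lemma psum_y_lt x : r < x -> exists N, rho1 < psum y x N.
Proof.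
move=> rx; have r00 := Rlt_le _ _ r0.
have := lim_PSeries r00 rY; rewrite Yr => /is_lim_seq_spec.
have e0 : 0 < x - r by lra.
case/(_ (mkposreal _ e0)) => N /(_ (N + 2)%N) /= hN; exists (N + 2)%N.
have {hN} : rho1 - (x - r) < psum y r (N + 2).
  by have := hN _ => h; have := h (elimT leP (leq_addr 2 N)) => /Rabs_def2; lra.
suff: x - r + psum y r (N + 2) <= psum y x (N + 2) by lra.
rewrite addn2 /psum big_ord_recl [X in _ <= X]big_ord_recl y0.
rewrite big_ord_recl [X in _ <= _ + X]big_ord_recl /= /bump /= -[(1 + 0)%N]/1%N y1.
set S1 := (X in _ + (_ + (_ + X)) <= _); set S2 := (X in _ <= _ + (_ + X)).
have : S1 <= S2; last lra.
apply: rsum_le => i; apply: Rmult_le_compat_l => //.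
by apply: (pow_incr r x i.+2); lra.
Qed.

(** At [r] the truncations of [V] are at most 1. Past [r] some truncation of [Y] exceeds [rho1],
    where those of [M] are unbounded. *)
Lemma cv_radius_v : CV_radius v = Rbar.Finite r.
Proof.
have r00 := Rlt_le _ _ r0.
apply: Rbar_le_antisym; last first.
  have [ub _] := CV_radius_bounded v; apply: ub; exists 1 => n.
  have p0 i : 0 <= v i * r ^ i by apply: Rmult_le_pos; [apply: v_ge0 | apply: pow_le].
  rewrite Rabs_pos_eq //; apply: Rle_trans (_ : psum v r n.+1 <= _).
    exact: (@rsum_ge_term (fun i => v i * r ^ i)).
  by apply: psum_v_le1 => //; rewrite -Yr; apply: psum_le_PSeries.
apply: Rbar_not_lt_le => lt.
have [x [rx xR]] : exists x, r < x /\ Rbar_lt (Rbar.Finite x) (CV_radius v).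
  case: (CV_radius v) lt => [s| |] //= lt.
    by exists ((r + s) / 2); split; lra.
  by exists (r + 1); split; lra.
have x0 : 0 <= x by lra.
have [N hN] := psum_y_lt rx.
have [K hK] := psum_unbounded a0 a_ge0 bE (PSeries v x) hN.
have [N' hN'] := psum_v_ge N K x0.
by have := psum_le_PSeries N' v_ge0 x0 xR; lra.
Qed.

(** For a fixed truncation [K] of [M], continuity allows the limit in the truncation of [Y] first;
    the limit in [K] is then [psum_lim_rho]. *)
Lemma psum_v_lim : is_lim_seq (psum v r) (Rbar.Finite 1).
Proof.
have r00 := Rlt_le _ _ r0.
have le1 n : psum v r n <= 1.
  by apply: psum_v_le1 => //; rewrite -Yr; apply: psum_le_PSeries.
have mono n : psum v r n <= psum v r n.+1 by apply: psum_mono => //; apply: v_ge0.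
have [S lS] := @ex_finite_lim_seq_incr (psum v r) 1 mono le1.
have leS := is_lim_seq_incr_compare (psum v r) S lS mono.
have S1 : S <= 1.
  exact: (is_lim_seq_le (psum v r) (fun=> 1) (Rbar.Finite S) (Rbar.Finite 1) le1 lS
    (is_lim_seq_const 1)).
suff S2 : 1 <= S by have -> : 1 = S by lra.
have hK K : psum a rho1 K <= S.
  have cK : continuous (fun x => psum a x K) rho1.
    case: K => [|K].
      apply: (continuous_ext (fun=> 0)); last exact: continuous_const.
      by move=> x; rewrite /psum big_ord0.
    by apply: ex_derive_continuous; eexists; apply: is_derive_psum.
  have lK : is_lim_seq (fun n => psum a (psum y r n) K) (Rbar.Finite (psum a rho1 K)).
    apply: (is_lim_seq_continuous (fun x => psum a x K)).
      exact/continuity_pt_filterlim.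
    by rewrite -Yr; apply: lim_PSeries.
  have := is_lim_seq_le _ (fun=> S) _ (Rbar.Finite S) _ lK (is_lim_seq_const S).
  apply=> n; have [N hN] := psum_v_ge n K r00; exact: Rle_trans hN (leS N).
by have := is_lim_seq_le (psum a rho1) (fun=> S) (Rbar.Finite 1) (Rbar.Finite S) hK
  (psum_lim_rho a0 a_ge0 bE) (is_lim_seq_const S).
Qed.

(** With [q > rho1] a truncation of [Y] at [x], [coef_lower] bounds [v] below by a multiple of the
    coefficients of [1 / (1 - Y / q)], which satisfy the linear recurrence [wE]. *)
Lemma v_lower x : r < x -> exists2 c, 0 < c & forall n, c * (/ x) ^ n.+1 <= v n.+1.
Proof.
move=> rx; have x0 : 0 < x by lra.
have [J hJ] := psum_y_lt rx; set q := psum y x J in hJ.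
have rho0 := rho1_gt0; have q0 : 0 < q by lra.
have iq : 0 < / q by apply: Rinv_0_lt_compat.
have ix : 0 < / x by apply: Rinv_0_lt_compat.
have [c c0 hc] := coef_lower a0 a_ge0 bE hJ.
pose w := fcomp y (fun k => (/ q) ^ k).
have wE n : w n.+1 = / q * conv y w n.+1.
  have -> : w = fun n => fcomp y (fun k => (/ q) ^ k) n by [].
  rewrite {1}/fcomp big_ord_recl /= /delta0 /= Rmult_0_r Rplus_0_l.
  transitivity (\sum_(k < n.+2) (/ q) ^ k.+1 * fpow y k.+1 n.+1).
    rewrite [RHS]big_ord_recr /= [X in _ = _ + _ * X](_ : _ = 0) ?Rmult_0_r ?Rplus_0_r //.
    exact: (@fpow_small y y0 n.+2).
  transitivity (/ q * \sum_(k < n.+2) \sum_(i < n.+2) y i * ((/ q) ^ k * fpow y k (n.+1 - i)%N)).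
    rewrite rsum_distrr; apply: eq_bigr => k _ /=; rewrite /conv rsum_distrr rsum_distrr.
    by apply: eq_bigr => i _; ring.
  congr (_ * _); rewrite rsum_exchange; apply: eq_bigr => i _; rewrite -rsum_distrr.
  by rewrite (@fcompE y y0 _ _ n.+2) // ltnS leq_subr.
have w_gt0 n : 0 < w n by apply: fcomp_gt0 => [k|]; [apply: pow_le | apply: pow_lt]; lra.
have [d d0 hd] : exists2 d, 0 < d & forall n, (n < J)%N -> d * (/ x) ^ n <= w n.
  elim: (J) => [|m [d d0 hd]]; first by exists 1 => //; lra.
  have p0 : 0 < (/ x) ^ m by apply: pow_lt.
  have q1 : 0 < w m / (/ x) ^ m by apply: Rdiv_lt_0_compat.
  exists (Rmin d (w m / (/ x) ^ m)); first exact: Rmin_pos.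
  move=> k; rewrite ltnS leq_eqVlt => /orP[/eqP->|km].
    apply: Rle_trans (_ : w m / (/ x) ^ m * (/ x) ^ m <= _).
      by apply: Rmult_le_compat_r; [lra | apply: Rmin_r].
    by rewrite /Rdiv Rmult_assoc Rinv_l; lra.
  apply: Rle_trans (hd k km); apply: Rmult_le_compat_r; last exact: Rmin_l.
  by apply: pow_le; lra.
(* The weights [y i * x ^ i / q] for [i < J] sum to 1, so the recurrence cut at [J] preserves the
   bound; the values below [J] fix [d]. *)
have hw n : d * (/ x) ^ n <= w n.
  elim/ltn_ind: n => n IH; have [lt|le] := ltnP n J; first exact: hd.
  case: n le IH => [|n] le IH.
    by move: q0; rewrite /q (_ : J = 0%N) ?/psum ?big_ord0; [lra | lia].
  rewrite wE; apply: (Rmult_le_reg_l q) => //.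
  rewrite -[X in _ <= X]Rmult_assoc Rinv_r ?Rmult_1_l; last lra.
  have p0 i : 0 <= y i * w (n.+1 - i)%N.
    by apply: Rmult_le_pos => //; apply: Rlt_le.
  apply: Rle_trans (_ : \sum_(i < J) y i * w (n.+1 - i)%N <= _); last first.
    by apply: (@rsum_mono (fun i => y i * w (n.+1 - i)%N)) => //; apply: leq_trans le _.
  rewrite /q /psum rsum_distrl; apply: rsum_le => i.
  case: (posnP i) => [->|i0]; first by rewrite y0; lra.
  have iJ := ltn_ord i.
  have -> : y i * x ^ i * (d * (/ x) ^ n.+1) = y i * (d * (/ x) ^ (n.+1 - i)%N).
    have -> : (/ x) ^ n.+1 = (/ x) ^ i * (/ x) ^ (n.+1 - i)%N.
      by rewrite -pow_add subnKC //; lia.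
    have : x ^ i * (/ x) ^ i = 1 by rewrite -Rpow_mult_distr Rinv_r ?pow1 //; lra.
    set X := x ^ i; set X' := (/ x) ^ i => e.
    transitivity (y i * (d * (/ x) ^ (n.+1 - i)%N) * (X * X')); first ring.
    rewrite e; ring.
  by apply: Rmult_le_compat_l => //; apply: IH; lia.
exists (c * q * d); first by repeat apply: Rmult_lt_0_compat.
move=> n; rewrite v_fcomp.
apply: Rle_trans (_ : c * q * w n.+1 <= _).
  by rewrite Rmult_assoc; apply: Rmult_le_compat_l; [apply/Rlt_le/Rmult_lt_0_compat | apply: hw].
rewrite /w /fcomp rsum_distrr; apply: rsum_le => -[[|k] /= _].
  by rewrite /delta0 /= !Rmult_0_r; lra.
rewrite -Rmult_assoc; apply: Rmult_le_compat_r; first exact: (fpow_ge0 y_ge0 k.+1).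
apply: Rle_trans (hc k); apply: Req_le.
have -> : c * q * (/ q * (/ q) ^ k) = c * (q * / q) * (/ q) ^ k by ring.
rewrite Rinv_r; [ring | lra].
Qed.

(** * Asymptotics of the mean number of factors [y j] *)

Section Mean.
Variable j : nat.
Hypothesis j0 : (0 < j)%N.

(** The logarithmic derivative at [L = 0] of [[z^n] M(Y)] with [y j] tilted, that is, the weighted
    mean number of factors [y j] in its monomials. *)
Let mean n := y j * B (n - j)%N / v n.

(** The logarithm of the tilted coefficient is convex in [L], so it lies above its tangent at 0, of
    slope [mean n]. The coefficient times [z ^ n] is at most 1 because [M] is at most 1 on
    [[0, rho1]]. *)
Lemma mean_tangent n L z : (j <= n)%N -> 0 < z ->
  (forall N, psum (tilt y j L) z N <= rho1) -> exp (mean n * L) * v n * z ^ n <= 1.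
Proof.
move=> jn z0 hz; have n0 : (0 < n)%N by lia.
have vn : 0 < v n by rewrite -(prednK n0); apply: v_gt0.
pose m := mean n.
(* With [m = mean n] the terms linear in [L] cancel after summation over [k]. *)
have h : exp (m * L) * v n <= fcomp (tilt y j L) a n.
  apply: Rle_trans (_ : exp (m * L) * (v n * (1 - m * L) + L * (y j * B (n - j)%N)) <= _).
    have -> : y j * B (n - j)%N = m * v n by rewrite /m /mean; field; lra.
    by rewrite (_ : v n * (1 - m * L) + L * (m * v n) = v n); [lra | ring].
  rewrite -(@conv_mark y B j n jn) -fcomp_mark // v_fcomp /fcomp.
  rewrite rsum_distrl [L * _]rsum_distrr -rsum_add rsum_distrr; apply: rsum_le => k.
  have := Rmult_le_compat_l _ _ _ (a_ge0 k) (fpow_tilt_ge j L y_ge0 k n m).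
  lra.
have t0 : tilt y j L 0 = 0 by rewrite /tilt y0; ring.
have tg := tilt_ge0 j L y_ge0.
apply: Rle_trans (_ : fcomp (tilt y j L) a n * z ^ n <= _).
  by apply: Rmult_le_compat_r => //; apply: pow_le; lra.
have zz : 0 <= z by lra.
apply: Rle_trans (_ : psum (fcomp (tilt y j L) a) z n.+1 <= _).
  apply: (@rsum_ge_term (fun i => fcomp (tilt y j L) a i * z ^ i)) => // i.
  apply: Rmult_le_pos; last exact: pow_le.
  by apply: rsum_ge0 => k; apply: Rmult_le_pos => //; apply: fpow_ge0.
apply: Rle_trans (psum_fcomp_le t0 tg _ a_ge0 zz) _.
by apply: (psum_le1 a0 a_ge0 bE); split=> //; apply: psum_ge0.
Qed.

(** The tilted series [Y] at the point [r * exp (- k * L)]. *)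
Let Phi k L := PSeries y (r * exp (- k * L)) + (exp L - 1) * (y j * (r * exp (- k * L)) ^ j).

(** The lower bound of [v_lower] at [x = r * exp eta] is inserted into [mean_tangent] at
    [z = r * exp (- k * L)]; taking logarithms gives the claim with [C = - ln c]. *)
Lemma mean_bound k L eta : Rbar_lt (Rbar.Finite (r * exp (- k * L))) (CV_radius y) ->
  Phi k L <= rho1 -> 0 < eta ->
  exists C, forall n, (j <= n)%N -> mean n * L <= INR n * (k * L + eta) + C.
Proof.
move=> zR hPhi eta0; set z := r * exp (- k * L) in zR.
have z0 : 0 < z by apply: Rmult_lt_0_compat => //; apply: exp_pos.
have zz := Rlt_le _ _ z0.
have hz N : psum (tilt y j L) z N <= rho1.
  apply: Rle_trans (_ : psum (tilt y j L) z (N + j.+1)%N <= _).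
    by apply: psum_mono; rewrite ?leq_addr //; apply: tilt_ge0.
  rewrite psum_tilt; last by rewrite addnS ltnS leq_addl.
  by apply: Rle_trans hPhi; rewrite /Phi -/z; have := psum_le_PSeries (N + j.+1) y_ge0 zz zR; lra.
pose x := r * exp eta.
have rx : r < x by rewrite /x; have := exp_ineq1 eta; nra.
have x0 : 0 < x by lra.
have [c c0 hc] := v_lower rx.
exists (- ln c) => n jn; have n0 : (0 < n)%N by lia.
have := mean_tangent jn z0 hz; have := hc n.-1; rewrite (prednK n0) => h1 h2.
have e0 := exp_pos (mean n * L).
have h3 : exp (mean n * L) * (c * (/ x) ^ n) * z ^ n <= 1.
  apply: Rle_trans h2; apply: Rmult_le_compat_r; first exact: pow_le.
  by apply: Rmult_le_compat_l => //; lra.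
have h4 : exp (mean n * L) * c * (z / x) ^ n <= 1.
  apply: Rle_trans h3; apply: Req_le; rewrite /Rdiv Rpow_mult_distr; ring.
have zx0 : 0 < z / x by apply: Rdiv_lt_0_compat.
have p0 : 0 < (z / x) ^ n by apply: pow_lt.
have := ln_le _ _ _ h4; rewrite ln_1 ln_mult //; last exact: Rmult_lt_0_compat.
rewrite ln_mult // ln_exp ln_pow // ln_div // /z /x !ln_mult ?ln_exp //; try exact: exp_pos.
move=> h5; have := h5 _ => h6.
have : mean n * L + ln c + INR n * (ln r + - k * L - (ln r + eta)) <= 0.
  by apply: h6; repeat apply: Rmult_lt_0_compat => //; apply: exp_pos.
lra.
Qed.

Let Yp := PSeries (PS_derive y) r.
(** To first order in [L], the point where the tilted [Y] takes the value [rho1] is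
    [r * exp (- kappa0 * L)]: for [k = kappa0] the derivative in [Phi_derive] vanishes. *)
Let kappa0 := y j * r ^ j / (r * Yp).

Lemma Yp_gt0 : 0 < Yp.
Proof.
have rY' : Rbar_lt (Rbar.Finite r) (CV_radius (PS_derive y)) by rewrite CV_radius_derive.
have g0 i : 0 <= PS_derive y i by apply: Rmult_le_pos => //; apply: INR_ge0.
have := psum_le_PSeries 1 g0 (Rlt_le _ _ r0) rY'; rewrite -/Yp.
rewrite /psum big_ord_recl big_ord0 /PS_derive /= y1 INR_1; lra.
Qed.

Lemma Phi_derive k : is_derive (Phi k) 0 (- k * r * Yp + y j * r ^ j).
Proof.
have rr : Rabs r = r by rewrite Rabs_pos_eq //; lra.
have dy : is_derive (PSeries y) r Yp by apply: is_derive_PSeries; rewrite rr.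
have e1 : r * exp (- k * 0) = r by rewrite Rmult_0_r exp_0 Rmult_1_r.
rewrite /Phi; auto_derive.
  by rewrite e1; exists Yp.
rewrite !Rmult_0_r exp_0 !Rmult_1_r (is_derive_unique _ _ _ dy); ring.
Qed.

(** At 0, [Phi k] has value [rho1] and derivative [(kappa0 - k) * (r * Yp)], so a small [L] with the
    sign of [k - kappa0] brings it below [rho1]. *)
Lemma Phi_small k : k <> kappa0 -> exists L, [/\ (kappa0 < k -> 0 < L), (k < kappa0 -> L < 0),
  Rbar_lt (Rbar.Finite (r * exp (- k * L))) (CV_radius y) & Phi k L <= rho1].
Proof.
move=> ne; have Y0 := Yp_gt0; have rY0 := Rmult_lt_0_compat _ _ r0 Y0.
set D := - k * r * Yp + y j * r ^ j.
have DE : D = (kappa0 - k) * (r * Yp) by rewrite /D /kappa0; field; lra.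
have D0 : D <> 0 by rewrite DE; nra.
have P0 : Phi k 0 = rho1.
  by rewrite /Phi Rmult_0_r exp_0 Rmult_1_r Yr; ring.
have [d1 hd1] : exists d : posreal, forall L, Rabs L < d ->
    Rbar_lt (Rbar.Finite (r * exp (- k * L))) (CV_radius y).
  have [s [rs sR]] : exists s, r < s /\ Rbar_lt (Rbar.Finite s) (CV_radius y).
    case: (CV_radius y) rY => [s| |] //= lt.
      by exists ((r + s) / 2); split; lra.
    by exists (r + 1); split; lra.
  have c : continuous (fun L => r * exp (- k * L)) 0.
    by apply: ex_derive_continuous; auto_derive.
  have e0 : 0 < s - r by lra.
  have := c (ball (r * exp (- k * 0)) (mkposreal _ e0)) _.
  case; first by exists (mkposreal _ e0).
  move=> d hd; exists d => L hL; apply: Rbar_lt_trans sR => /=.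
  have := hd L; rewrite Rmult_0_r exp_0 Rmult_1_r => h.
  have : Rabs (r * exp (- k * L) - r) < s - r.
    by apply: h; rewrite /ball /= /AbsRing_ball /abs /minus /plus /opp /= Ropp_0 Rplus_0_r.
  by move/Rabs_def2; lra.
have /is_derive_Reals dP := Phi_derive k.
have aD : 0 < Rabs D by apply: Rabs_pos_lt.
(* The tolerance [Rabs D] forces the difference quotient to have the sign of [D]. *)
have [d2 hd2] := dP _ aD.
pose l := Rmin d1 d2 / 2.
have m0 : 0 < Rmin d1 d2 by apply: Rmin_pos; apply: cond_pos.
have l0 : 0 < l by rewrite /l; lra.
have lt1 : l < d1 by have := Rmin_l d1 d2; rewrite /l; lra.
have lt2 : l < d2 by have := Rmin_r d1 d2; rewrite /l; lra.
have [kk|kk] : kappa0 < k \/ k < kappa0 by lra.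
  have Dn : D < 0 by rewrite DE; nra.
  exists l; split=> //; [lra | by apply: hd1; rewrite Rabs_pos_eq //; lra | ].
  have := hd2 l _ _; rewrite Rplus_0_l P0 (Rabs_left D) // => h.
  have : Rabs ((Phi k l - rho1) / l - D) < - D by apply: h; [lra | rewrite Rabs_pos_eq; lra].
  move/Rabs_def2 => [h1 _]; have h2 : (Phi k l - rho1) / l < 0 by rewrite /D in h1 *; lra.
  have : (Phi k l - rho1) / l * l < 0 by nra.
  have -> : (Phi k l - rho1) / l * l = Phi k l - rho1 by field; lra.
  lra.
have Dn : 0 < D by rewrite DE; nra.
exists (- l); split=> //; [lra | lra | by apply: hd1; rewrite Rabs_Ropp Rabs_pos_eq //; lra | ].
have := hd2 (- l) _ _; rewrite Rplus_0_l P0 (Rabs_pos_eq D); last lra.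
move=> h; have : Rabs ((Phi k (- l) - rho1) / - l - D) < D.
  by apply: h; [lra | rewrite Rabs_Ropp Rabs_pos_eq; lra].
move/Rabs_def2 => [_ h1]; have h2 : 0 < (Phi k (- l) - rho1) / - l by lra.
have : (Phi k (- l) - rho1) / - l * - l < 0 by nra.
have -> : (Phi k (- l) - rho1) / - l * - l = Phi k (- l) - rho1 by field; lra.
lra.
Qed.

Lemma mean_lim : is_lim_seq (fun n => mean n / INR n) (Rbar.Finite kappa0).
Proof.
apply/is_lim_seq_spec => eps.
have side (s : R) : s = 1 \/ s = -1 -> exists N, forall n, (N <= n)%N ->
    s * (mean n / INR n - kappa0) < eps.
  move=> hs; have e0 := cond_pos eps.
  (* The sign [s] selects the upper or the lower bound. Half of [eps] goes into [k]; after division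
     by [n] and by [l], a quarter comes from [eta] and less than a quarter from [C]. *)
  pose k := kappa0 + s * (eps / 2).
  have [L [L1 L2 zR hP]] : exists L, [/\ (kappa0 < k -> 0 < L), (k < kappa0 -> L < 0),
      Rbar_lt (Rbar.Finite (r * exp (- k * L))) (CV_radius y) & Phi k L <= rho1].
    by apply: Phi_small; rewrite /k; case: hs => ->; lra.
  pose l := s * L.
  have l0 : 0 < l.
    rewrite /l; case: hs => hs; rewrite hs; [have := L1 | have := L2]; rewrite /k hs => h.
      by have := h _; lra.
    by have := h _; lra.
  have ss : s * s = 1 by case: hs => ->; ring.
  have LE : L = s * l by rewrite /l -Rmult_assoc ss; ring.
  have eta0 : 0 < l * (eps / 4) by nra.
  have [C hC] := mean_bound zR hP eta0.
  have [N hN] := INR_unbounded (Rabs C / (l * (eps / 4))).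
  exists (maxn (maxn N j) 1) => n; rewrite !geq_max => /andP[/andP[Nn jn] n1].
  have nn : 0 < INR n by rewrite -(prednK n1); apply: INR_gt0.
  have h := hC n jn; have Nn' := INR_le Nn.
  have hCn : C < INR n * (l * (eps / 4)).
    apply: Rle_lt_trans (Rle_abs C) _.
    have -> : Rabs C = Rabs C / (l * (eps / 4)) * (l * (eps / 4)) by field; lra.
    by apply: Rmult_lt_compat_r => //; lra.
  have h2 : mean n / INR n * L < k * L + l * (eps / 2).
    apply: (Rmult_lt_reg_r (INR n)) => //.
    have -> : mean n / INR n * L * INR n = mean n * L by field; lra.
    lra.
  have h3 : (s * (mean n / INR n) - s * k) * l < (eps / 2) * l.
    by rewrite LE in h2; lra.
  have h4 : s * (mean n / INR n) - s * k < eps / 2 by apply: (Rmult_lt_reg_r l).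
  have : s * k = s * kappa0 + eps / 2 by rewrite /k Rmult_plus_distr_l -Rmult_assoc ss; ring.
  lra.
have [N1 h1] := side 1 (or_introl erefl); have [N2 h2] := side (-1) (or_intror erefl).
exists (maxn N1 N2) => n /leP; rewrite geq_max => /andP[/h1 ? /h2 ?].
by apply: Rabs_def1; lra.
Qed.

End Mean.

Lemma v_ratio_lim : is_lim_seq (fun n => v n.+1 / v n.+2) (Rbar.Finite r).
Proof.
have Y0 := Yp_gt0; set Yp := PSeries (PS_derive y) r in Y0.
have l1 := mean_lim (isT : (0 < 1)%N); have l2 := mean_lim (isT : (0 < 2)%N).
rewrite y1 in l1; rewrite y2 in l2; rewrite -/Yp in l1 l2.
have {}l1 := proj1 (is_lim_seq_incr_1 _ _) l1.
have {}l2 := proj1 (is_lim_seq_incr_1 _ _) (proj1 (is_lim_seq_incr_1 _ _) l2).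
have k1 : 1 * r ^ 1 / (r * Yp) = / Yp by field; lra.
have k2 : 1 * r ^ 2 / (r * Yp) = r / Yp by field; lra.
rewrite k1 in l1; rewrite k2 in l2.
have iY : 0 < / Yp by apply: Rinv_0_lt_compat.
(* Both numerators are [B n], so the quotient is [v n.+1 / v n.+2] up to the factor
   [INR n.+1 / INR n.+2], which the next limit compensates. *)
have ld : is_lim_seq (fun n => (1 * B (n.+2 - 2)%N / v n.+2 / INR n.+2) /
    (1 * B (n.+1 - 1)%N / v n.+1 / INR n.+1)) (Rbar.Finite ((r / Yp) / (/ Yp))).
  apply: is_lim_seq_div' => //; lra.
have ln : is_lim_seq (fun n => 1 + / INR n.+1) (Rbar.Finite (1 + 0)).
  apply: is_lim_seq_plus'; first exact: is_lim_seq_const.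
  apply: (is_lim_seq_inv _ p_infty) => //.
  exact: (proj1 (is_lim_seq_incr_1 _ _) is_lim_seq_INR).
have := is_lim_seq_mult' _ _ _ _ ld ln.
have -> : r / Yp / / Yp * (1 + 0) = r by field; lra.
apply: is_lim_seq_ext => n; rewrite !subn1 !subn2 /=.
have := v_gt0 n; have := v_gt0 n.+1; have := B_gt0 n; have := INR_gt0 n.
by rewrite [INR n.+2]INRS => *; field; lra.
Qed.

End UnlabeledSeries.

(** * The Euler transform and numerical bounds *)

Lemma psumS (f : nat -> R) z n : psum f z n.+1 = psum f z n + f n * z ^ n.
Proof. exact: big_ord_recr. Qed.

Lemma psum0 (f : nat -> R) z : psum f z 0 = 0.
Proof. exact: big_ord0. Qed.

(* Truncation of [ln 2 = 2 * artanh (1/3)]. *)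
Lemma ln2_bounds : 693144 / 1000000 <= ln 2 <= 693152 / 1000000.
Proof.
pose S x := 2 * (x + x ^ 3 / 3 + x ^ 5 / 5 + x ^ 7 / 7 + x ^ 9 / 9).
pose f x := ln ((1 + x) / (1 - x)) - S x.
have df x : 0 <= x <= 1 / 3 -> is_derive f x (2 * x ^ 10 / (1 - x ^ 2)).
  move=> hx; rewrite /f /S; have q : 0 < (1 + x) / (1 - x) by apply: Rdiv_lt_0_compat; lra.
  auto_derive; first by split; [lra | split].
  by rewrite !INR_IZR_INZ /=; field; repeat split; nra.
have x2 x : 0 <= x <= 1 / 3 -> 8 / 9 <= 1 - x ^ 2 by move=> hx; nra.
have f0 : f 0 = 0.
  rewrite /f /S (_ : (1 + 0) / (1 - 0) = 1); last by field.
  by rewrite ln_1; field.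
have f3 : f (1 / 3) = ln 2 - S (1 / 3).
  by rewrite /f (_ : (1 + 1 / 3) / (1 - 1 / 3) = 2) //; field.
have lo : - f (1 / 3) <= - f 0.
  apply: (@derive_le0_decr (fun x => - f x) (fun x => - (2 * x ^ 10 / (1 - x ^ 2)))); first lra.
  move=> x hx; split; first exact: (@is_derive_opp _ R_NormedModule _ _ _ (df x hx)).
  have := x2 x hx => h; have : 0 <= 2 * x ^ 10 / (1 - x ^ 2); last lra.
  apply: Rmult_le_pos; first by have := pow_le x 10 (proj1 hx); lra.
  by apply/Rlt_le/Rinv_0_lt_compat; lra.
(* Since [1 - x ^ 2 >= 8 / 9], the derivative of [f] is at most [9 / 4 * x ^ 10], whose primitive is
   [9 / 44 * x ^ 11]. *)
pose g x := f x - 9 / 44 * x ^ 11.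
have hi : g (1 / 3) <= g 0.
  apply: (@derive_le0_decr g (fun x => 2 * x ^ 10 / (1 - x ^ 2) - 9 / 4 * x ^ 10)); first lra.
  move=> x hx; split.
    apply: (@is_derive_minus _ R_NormedModule) (df x hx) _.
    by auto_derive => //; rewrite !INR_IZR_INZ /=; field.
  have := x2 x hx => h; have p := pow_le x 10 (proj1 hx).
  suff: 2 * x ^ 10 / (1 - x ^ 2) <= 9 / 4 * x ^ 10 by lra.
  apply: (Rmult_le_reg_r (1 - x ^ 2)); first lra.
  have -> : 2 * x ^ 10 / (1 - x ^ 2) * (1 - x ^ 2) = 2 * x ^ 10 by field; lra.
  by have := Rmult_le_compat_l _ _ _ p h; lra.
rewrite /g f0 f3 in hi; rewrite f0 f3 in lo; rewrite /S in hi lo.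
split; lra.
Qed.

Lemma rho1E : rho1 = 2 * ln 2 - 1.
Proof. by rewrite /rho1 /phi (_ : 1 + 1 = 2) //; lra. Qed.

Section EulerTransform.
Variables u c : nat -> nat.
Hypotheses (u0 : u 0%N = 1%N) (u1 : u 1%N = 1%N) (c1 : c 1%N = 1%N).
Hypothesis cE : forall n, (1 < n)%N -> (2 * c n)%N = u n.
Hypothesis uE : forall n, (n * u n)%N =
  (\sum_(d < n) d.+1 * (c d.+1 *
     \sum_(i < n) if i.+1 * d.+1 <= n then u (n - i.+1 * d.+1) else 0))%N.

(** Proper divisors only: for positive [n], [divsum n / n] is the coefficient of
    [sum_(k >= 2) C(z^k) / k], the part of Polya's exponent other than [C(z)]. *)
Definition divsum n := (\sum_(0 <= d < n | d %| n) d * c d)%N.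

Lemma sum_multiples (f : nat -> nat) d n : (0 < d)%N ->
  (\sum_(i < n) (if i.+1 * d <= n then f (i.+1 * d) else 0) =
   \sum_(m < n.+1 | (0 < m) && (d %| m)) f m)%N.
Proof.
move=> d0; case: n => [|n]; first by rewrite big_ord0 big_pred0 // => -[[|m]].
rewrite -big_mkcond /=.
rewrite [RHS](reindex_onto (fun i : 'I_n.+1 => inord (i.+1 * d) : 'I_n.+2)
   (fun m => inord (m %/ d).-1)).
  apply: eq_big => [i|i le]; last by rewrite inordK.
  have [le|gt] := leqP (i.+1 * d)%N n.+1.
    by rewrite inordK // muln_gt0 d0 dvdn_mull //= mulnK // inord_val eqxx.
  apply/esym/negbTE/negP => /andP[/andP[m0 /dvdnP[q eq]] /eqP e].
  have q0 : (0 < q)%N by case: q eq m0 => // ->.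
  move: e; rewrite eq mulnK // => e.
  have qn : (q.-1 < n.+1)%N.
    rewrite prednK //; apply: leq_trans (_ : q * d <= _)%N; first exact: leq_pmulr.
    by rewrite -eq -ltnS ltn_ord.
  have iq : i.+1 = q by rewrite -e inordK // prednK.
  by move: gt; rewrite iq -eq ltnNge -ltnS ltn_ord.
move=> m /andP[m0 dm]; have md0 : (0 < m %/ d)%N by rewrite divn_gt0 // dvdn_leq.
have lt : ((m %/ d).-1 < n.+1)%N by rewrite prednK // (leq_trans (leq_div _ _)) // -ltnS ltn_ord.
by rewrite inordK // prednK // divnK // inord_val.
Qed.

(** The terms of [uE] are grouped by total size [m = i.+1 * d.+1]; the divisor [m] itself yields
    [m * c m]. This is the logarithmic derivative of Polya's formula. *)
Lemma u_divsum n : (n * u n)%N =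
  (\sum_(m < n.+1) (divsum m + m * c m) * (if 0 < m then u (n - m) else 0))%N.
Proof.
rewrite uE.
transitivity (\sum_(d < n) \sum_(m < n.+1) if (0 < m) && (d.+1 %| m) then
    d.+1 * c d.+1 * u (n - m) else 0)%N.
  apply: eq_bigr => d _; rewrite (sum_multiples (fun m => u (n - m)%N)) //.
  rewrite big_mkcond /= mulnA big_distrr /=.
  by apply: eq_bigr => m _; case: ifP; rewrite ?muln0.
rewrite exchange_big /=; apply: eq_bigr => m _.
case: (posnP m) => [m0|m0]; first by rewrite muln0 big1.
rewrite -big_mkcond -big_distrl /=; congr (_ * _)%N.
rewrite -(big_mkord (fun d => d.+1 %| m) (fun d => d.+1 * c d.+1)%N).
have mn : (m <= n)%N by rewrite -ltnS ltn_ord.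
rewrite -(big_add1 _ _ 0 n.+1 (fun d => d %| m) (fun d => d * c d)%N).
rewrite (@big_cat_nat _ _ _ m.+1) //= [X in (_ + X)%N]big_nat_cond.
rewrite [X in (_ + X)%N]big_pred0 ?addn0; last first.
  by move=> d; apply/negP => /andP[/andP[md _] /dvdn_leq-/(_ m0)]; lia.
rewrite big_mkcond big_nat_recr //= dvdnn -big_mkcond /divsum; congr (_ + _)%N.
by rewrite [RHS]big_ltn_cond //= dvd0n; case: eqP => // e; rewrite e in m0.
Qed.

(** Values up to 7 suffice for the numerical bounds: a proper divisor of a positive [n < 16] is at
    most 7. *)
Lemma c_values : forall d, (d < 8)%N -> (0 < d)%N ->
  c d = nth 0%N [:: 0; 1; 1; 2; 5; 12; 33; 90]%N d.
Proof.
(* The left side of [u_divsum] is [n * u n = 2 * n * c n], while the term [m = n] contains [n * c n]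
   once, so the recurrence can be solved for [c n]. *)
have step n : (1 < n)%N -> (n * c n =
    \sum_(0 <= m < n) (if (0 < m)%N then (divsum m + m * c m) * u (n - m) else 0)
    + divsum n)%N.
  move=> n1; have := u_divsum n; rewrite big_ord_recr /= subnn u0 (ltnW n1) muln1 -(cE n1).
  rewrite -(big_mkord predT (fun m => (divsum m + m * c m) * (if 0 < m then u (n - m) else 0))%N).
  under [X in _ = (X + _)%N -> _]eq_bigr do rewrite (fun_if (muln _)) muln0.
  by rewrite mulnCA mul2n -addnn addnA => /addIn.
have D n : divsum n = (\sum_(0 <= d < n | d %| n) d * c d)%N by [].
have e2 := step 2%N isT; have e3 := step 3%N isT; have e4 := step 4%N isT.
have e5 := step 5%N isT; have e6 := step 6%N isT; have e7 := step 7%N isT.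
have E2 := cE (isT : 1 < 2)%N; have E3 := cE (isT : 1 < 3)%N; have E4 := cE (isT : 1 < 4)%N.
have E5 := cE (isT : 1 < 5)%N; have E6 := cE (isT : 1 < 6)%N.
have D1 : divsum 1 = 0%N by rewrite D unlock.
have D2 : divsum 2 = c 1%N by rewrite D unlock /= mul1n addn0.
have D3 : divsum 3 = c 1%N by rewrite D unlock /= mul1n addn0.
have D4 : divsum 4 = (c 1 + (2 * c 2 + 0))%N by rewrite D unlock /= mul1n.
have D5 : divsum 5 = c 1%N by rewrite D unlock /= mul1n addn0.
have D6 : divsum 6 = (c 1 + (2 * c 2 + (3 * c 3 + 0)))%N by rewrite D unlock /= mul1n.
have D7 : divsum 7 = c 1%N by rewrite D unlock /= mul1n addn0.
move: e2 e3 e4 e5 e6 e7; rewrite unlock /= ?(subSS, subn0).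
rewrite D1 D2 D3 D4 D5 D6 D7 u1 -E2 -E3 -E4 -E5 -E6 c1 => e2.
have {e2} c2 : c 2%N = 1%N by lia.
rewrite c2 => e3; have {e3} c3 : c 3%N = 2%N by lia.
rewrite c3 => e4; have {e4} c4 : c 4%N = 5%N by lia.
rewrite c4 => e5; have {e5} c5 : c 5%N = 12%N by lia.
rewrite c5 => e6; have {e6} c6 : c 6%N = 33%N by lia.
rewrite c6 => e7; have {e7} c7 : c 7%N = 90%N by lia.
by case=> [|[|[|[|[|[|[|[|d]]]]]]]].
Qed.

(* The series [Y] with [V = M o Y]: [Y = z + sum_(k >= 2) 2 C(z^k) / k], where [C] is the
   series of [c]. *)
Definition ycoef (n : nat) : R := (2 * INR (divsum n) + (if n == 1%N then 1 else 0)) / INR n.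
(* [u 0 = 1] counts the empty graph, which [V] omits. *)
Definition vcoef (n : nat) : R := if n == 0%N then 0 else INR (u n).

Lemma divsum_values : forall n, (n < 16)%N -> divsum n =
  nth 0%N [:: 0; 0; 1; 1; 3; 1; 9; 1; 23; 7; 63; 1; 227; 1; 633; 67]%N n.
Proof.
have aux n : (n < 16)%N -> divsum n =
    (\sum_(0 <= d < n | d %| n) d * nth 0 [:: 0; 1; 1; 2; 5; 12; 33; 90] d)%N.
  move=> n16; rewrite /divsum big_nat_cond [RHS]big_nat_cond.
  apply: eq_bigr => d /andP[/andP[_ dn] /dvdnP[q qd]].
  case: (posnP d) => [->//|d0]; rewrite c_values //.
  by case: q qd => [|[|q]] qd; lia.
by do 16!(case=> [_|]; first by rewrite aux // unlock; vm_compute).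
Qed.

Lemma y_zero : ycoef 0 = 0.
Proof. by rewrite /ycoef divsum_values //= INR_0; lra. Qed.

Lemma y_nonneg n : 0 <= ycoef n.
Proof.
case: n => [|n]; first by rewrite y_zero; lra.
apply: Rmult_le_pos; last by apply/Rlt_le/Rinv_0_lt_compat/INR_gt0.
by have := INR_ge0 (divsum n.+1); case: eqP => _; lra.
Qed.

(** From [2 C(z) = V + z] and the definition of [Y], [2 sum_(k >= 1) C(z^k) / k = V + Y]; this is
    its image under [z d/dz]. The exception at [n = 1] in [ycoef] is the summand [z] of [Y]. *)
Lemma y_zD n : 2 * INR (divsum n + n * c n) = zD vcoef n + zD ycoef n.
Proof.
rewrite /zD /ycoef /vcoef; case: n => [|[|n]].
- by rewrite divsum_values // !mul0n INR_0; ring.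
- by rewrite divsum_values //= c1 u1 ?mul1n ?add0n ?INR_1 ?INR_0; field.
rewrite /= -(cE (isT : 1 < n.+2)%N) INRD !INRM !INRS INR_0; field.
have := INR_ge0 n; lra.
Qed.

Lemma v_zD n : zD vcoef n = zD ycoef n + conv (zD ycoef) vcoef n + conv (zD vcoef) vcoef n.
Proof.
(* In terms of series, [2 z V' = (z V' + z Y') (1 + V)]. *)
have h : 2 * INR (n * u n) =
    conv (fun m => zD vcoef m + zD ycoef m) (fun m => vcoef m + delta0 m) n.
  rewrite u_divsum INR_sum rsum_distrr; apply: eq_bigr => m _.
  rewrite INRM -Rmult_assoc y_zD; case: (posnP m) => [->|m0].
    by rewrite /zD INR_0; ring.
  congr Rmult; rewrite /vcoef /delta0; case: eqP => [->|_]; last by rewrite Rplus_0_r.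
  by rewrite u0 INR_1; ring.
rewrite convDl !convDr ![conv _ delta0 n]convC !conv_delta in h.
have e : INR (n * u n) = zD vcoef n.
  rewrite INRM /zD /vcoef; case: eqP => [->|//]; rewrite INR_0; ring.
rewrite e in h; lra.
Qed.

Lemma y_one : ycoef 1 = 1.
Proof. by rewrite /ycoef divsum_values //= INR_1 INR_0; field. Qed.

Lemma y_two : ycoef 2 = 1.
Proof. by rewrite /ycoef divsum_values //= !INRS INR_0; field. Qed.

Lemma y_values n : (1 < n < 16)%N -> ycoef n =
  2 * INR (nth 0%N [:: 0; 0; 1; 1; 3; 1; 9; 1; 23; 7; 63; 1; 227; 1; 633; 67]%N n) / INR n.
Proof.
case/andP=> n1 n16; rewrite /ycoef divsum_values //; case: eqP => [e|_]; first by rewrite e in n1.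
by rewrite Rplus_0_r.
Qed.

Ltac eval_y := rewrite !psumS psum0 y_zero y_one y_two !y_values //= !INR_IZR_INZ /=.

Lemma psum_y_upper : rho1 < psum ycoef (28085 / 100000) 14.
Proof. by have := ln2_bounds; rewrite rho1E; eval_y; lra. Qed.

(** The second summand is the geometric bound, of ratio [53 / 100], for the tail from degree 16 on;
    [y_tail] justifies it. *)
Lemma psum_y_lower :
  psum ycoef (28075 / 100000) 16 + (53 / 100) ^ 16 / (1 - 53 / 100) <= rho1.
Proof. by have := ln2_bounds; rewrite rho1E; eval_y; lra. Qed.

End EulerTransform.

(** * The critical point and the limits *)

Section CriticalPoint.
Variables u c : nat -> nat.
Hypotheses (u0 : u 0%N = 1%N) (u1 : u 1%N = 1%N) (c1 : c 1%N = 1%N).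
Hypothesis cE : forall n, (1 < n)%N -> (2 * c n)%N = u n.
Hypothesis uE : forall n, (n * u n)%N =
  (\sum_(d < n) d.+1 * (c d.+1 *
     \sum_(i < n) if i.+1 * d.+1 <= n then u (n - i.+1 * d.+1) else 0))%N.
Variable a : nat -> R.
Hypotheses (a0 : a 0%N = 0) (a_ge0 : forall n, 0 <= a n).
Let b k := INR k.+1 * a k.+1.
Hypothesis bE : forall n, b n = delta0 n + a n + conv b a n.

Let y := ycoef c.
Let v := vcoef u.
Let y0 : y 0%N = 0 := y_zero u0 u1 c1 cE uE.
Let y1 : y 1%N = 1 := y_one u0 u1 c1 cE uE.
Let y_ge0 : forall n, 0 <= y n := y_nonneg u0 u1 c1 cE uE.
Let v0 : v 0%N = 0 := erefl.
Let vE := v_zD u0 u1 c1 cE uE.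
Let v_ge0' n : 0 <= v n.
Proof. by rewrite /v /vcoef; case: eqP => _; [lra | apply: INR_ge0]. Qed.

(** [z0] and [z1] are [2808 / 10000] minus and plus the tolerance [5 / 100000] of the theorem. *)
Let z0 := 28075 / 100000.
Let z1 := 28085 / 100000.
(* Slightly above [sqrt z0]: [y n * z0 ^ n] has order [z0 ^ (n / 2)]. *)
Let sigma := 53 / 100.

(** A proper divisor [d] of [n] satisfies [2 * d <= n], so it lies in the range of the sum, and
    [c d <= u d] for positive [d]. *)
Lemma divsum_le n : 2 * INR (divsum c n) <= INR n * \sum_(d < (n./2).+1) v d.
Proof.
have -> : \sum_(d < (n./2).+1) v d =
    INR (\sum_(d < (n./2).+1) (if (d : nat) == 0 then 0 else u d))%N.
  by rewrite INR_sum; apply: eq_bigr => d _; rewrite /v /vcoef (fun_if INR) INR_0.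
rewrite -INR2 -!INRM; apply: INR_le.
rewrite /divsum big_distrr /= big_distrr /=.
rewrite -(big_mkord predT (fun d : nat => n * (if d == 0 then 0 else u d))%N).
case: (posnP n) => [->|n0]; first by rewrite big_geq.
rewrite (@big_cat_nat _ _ _ (n./2).+1) //=; last by lia.
rewrite [X in (_ + X)%N]big_nat_cond [X in (_ + X)%N]big_pred0 ?addn0; last first.
  move=> d; apply/negP => /andP[/andP[h1 h2] /dvdnP[q e]].
  by case: q e => [|[|q]] e; lia.
rewrite big_mkcond big_nat_cond [leqRHS]big_nat_cond.
apply: leq_sum => d /andP[/andP[_ dn2] _]; case: ifP => // _.
case: d dn2 => [//|d] dn2; rewrite [X in (_ <= _ * X)%N]/= mulnA; apply: leq_mul; first by lia.
case: (ltngtP d.+1 1%N) => // [d1|->]; last by rewrite c1 u1.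
by rewrite -(cE d1); lia.
Qed.

Lemma y_tail n : (1 < n)%N -> psum v z0 n <= 1 -> y n * z0 ^ n <= sigma ^ n.
Proof.
move=> n1 h; have nn : 0 < INR n by rewrite -(prednK (ltnW n1)); apply: INR_gt0.
pose D := n./2; have Dn : (D.+1 <= n)%N by rewrite /D; lia.
have z00 : 0 <= z0 by rewrite /z0; lra.
have hy : y n <= \sum_(d < D.+1) v d.
  rewrite /y /ycoef (gtn_eqF n1) Rplus_0_r; apply: (Rmult_le_reg_l (INR n)) => //.
  have -> : INR n * (2 * INR (divsum c n) / INR n) = 2 * INR (divsum c n) by field; lra.
  exact: divsum_le.
have hv : (\sum_(d < D.+1) v d) * z0 ^ D <= 1.
  apply: Rle_trans h; apply: Rle_trans (psum_mono v_ge0' z00 Dn).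
  rewrite /psum rsum_distrl; apply: rsum_le => d; apply: Rmult_le_compat_l => //.
  have dD : (d <= D)%N by rewrite -ltnS.
  have -> : z0 ^ D = z0 ^ d * z0 ^ (D - d)%N by rewrite -pow_add subnKC.
  rewrite -[X in _ <= X]Rmult_1_r.
  apply: Rmult_le_compat_l; first exact: pow_le.
  rewrite -(pow1 (D - d)); apply: pow_incr; rewrite /z0; lra.
have zD0 : 0 <= z0 ^ D by apply: pow_le.
(* This uses [z0 <= sigma ^ 2], [sigma <= 1] and [2 * (n - D) >= n]. *)
have hz : z0 ^ (n - D)%N <= sigma ^ n.
  apply: Rle_trans (_ : (sigma ^ 2) ^ (n - D)%N <= _).
    by apply: pow_incr; split=> //; rewrite /z0 /sigma; lra.
  rewrite -pow_mult; have -> : (2 * (n - D))%coq_nat = (n + (2 * (n - D) - n))%N by rewrite /D; lia.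
  rewrite pow_add -[X in _ <= X]Rmult_1_r; apply: Rmult_le_compat_l.
    by apply: pow_le; rewrite /sigma; lra.
  rewrite -(pow1 (2 * (n - D) - n)%N); apply: pow_incr; rewrite /sigma; lra.
have -> : z0 ^ n = z0 ^ D * z0 ^ (n - D)%N by rewrite -pow_add subnKC // ltnW.
apply: Rle_trans hz.
have p0 : 0 <= z0 ^ (n - D)%N by apply: pow_le.
have := Rmult_le_compat_r _ _ _ zD0 hy => h1.
have h2 : y n * z0 ^ D <= 1 by lra.
by have := Rmult_le_compat_r _ _ _ p0 h2; lra.
Qed.

Lemma geom_le q m n : 0 <= q < 1 -> \sum_(i < n) q ^ (m + i)%N <= q ^ m / (1 - q).
Proof.
move=> hq; have -> : \sum_(i < n) q ^ (m + i)%N = q ^ m * ((1 - q ^ n) / (1 - q)).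
  elim: n => [|n IHn]; first by rewrite big_ord0 /=; field; lra.
  by rewrite big_ord_recr /= IHn pow_add; field; lra.
apply: Rmult_le_compat_l; first by apply: pow_le; lra.
rewrite -[X in _ <= X]Rmult_1_l; apply: Rmult_le_compat_r.
  by apply/Rlt_le/Rinv_0_lt_compat; lra.
have := pow_le q n (proj1 hq); lra.
Qed.

(* Since [y n] only involves [v d] for [2 * d <= n], the bound [V(z0) <= 1] propagates from
   one truncation to the next. *)
Lemma psum_y_le n : psum y z0 n <= rho1.
Proof.
have low := psum_y_lower u0 u1 c1 cE uE; rewrite -/y -/z0 -/sigma in low.
have z00 : 0 <= z0 by rewrite /z0; lra.
have t0 : 0 <= sigma ^ 16 / (1 - sigma).
  by apply: Rmult_le_pos; [apply: pow_le | apply/Rlt_le/Rinv_0_lt_compat]; rewrite /sigma; lra.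
elim/ltn_ind: n => n IH; have [le|lt] := leqP n 16.
  by have := psum_mono y_ge0 z00 le; lra.
rewrite -(subnKC (ltnW lt)) /psum big_split_ord /= -/(psum y z0 16).
apply: Rle_trans low; apply: Rplus_le_compat_l.
apply: Rle_trans (@geom_le sigma 16 (n - 16) _); last by rewrite /sigma; lra.
apply: rsum_le => i; apply: y_tail; first by lia.
by apply: (psum_v_le1 a0 a_ge0 bE y0 y_ge0 v0 vE) => //; apply: IH; have := ltn_ord i; lia.
Qed.

(** By [y_tail] the terms [y n * (z0 / sigma) ^ n] are bounded; [z0 / sigma] is about 0.53, well
    beyond [z1]. *)
Lemma cv_radius_y : Rbar_le (Rbar.Finite (z0 / sigma)) (CV_radius y).
Proof.
have [ub _] := CV_radius_bounded y; apply: ub; exists 1 => n.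
have q0 : 0 <= z0 / sigma by rewrite /z0 /sigma; lra.
rewrite Rabs_pos_eq; last by apply: Rmult_le_pos => //; apply: pow_le.
case: n => [|[|n]]; first by rewrite y0; lra.
  by rewrite y1 /z0 /sigma /=; lra.
have z00 : 0 <= z0 by rewrite /z0; lra.
have := @y_tail n.+2 isT (psum_v_le1 a0 a_ge0 bE y0 y_ge0 v0 vE z00 (psum_y_le _)).
have s0 : 0 < sigma ^ n.+2 by apply: pow_lt; rewrite /sigma; lra.
move=> h; rewrite /Rdiv Rpow_mult_distr pow_inv -Rmult_assoc.
apply: (Rmult_le_reg_r (sigma ^ n.+2)) => //.
rewrite Rmult_assoc Rinv_l; lra.
Qed.

Lemma critical_point : exists r, [/\ z0 <= r <= z1,
  Rbar_lt (Rbar.Finite r) (CV_radius y) & PSeries y r = rho1].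
Proof.
have inR x : x <= z1 -> Rbar_lt (Rbar.Finite x) (CV_radius y).
  move=> hx; apply: Rbar_lt_le_trans cv_radius_y => /=.
  by move: hx; rewrite /z0 /z1 /sigma; lra.
have z00 : 0 <= z0 by rewrite /z0; lra.
have z01 : z0 < z1 by rewrite /z0 /z1; lra.
have f0 : PSeries y z0 <= rho1.
  have zR : Rbar_lt (Rbar.Finite z0) (CV_radius y) by apply: inR; lra.
  by have := is_lim_seq_le (psum y z0) (fun=> rho1) _ (Rbar.Finite rho1) psum_y_le
    (lim_PSeries z00 zR) (is_lim_seq_const rho1).
have f1 : rho1 < PSeries y z1.
  apply: Rlt_le_trans (psum_y_upper u0 u1 c1 cE uE) _.
  have zR : Rbar_lt (Rbar.Finite z1) (CV_radius y) by apply: inR; lra.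
  have z10 : 0 <= z1 by rewrite /z1; lra.
  exact: (psum_le_PSeries 14 y_ge0 z10 zR).
have [e|lt] : PSeries y z0 = rho1 \/ PSeries y z0 - rho1 < 0 by lra.
  by exists z0; split=> //; [lra | apply: inR; lra].
have [||||r [hr e]] := @IVT_interv (fun x => PSeries y x - rho1) z0 z1.
- move=> x hx; apply/continuity_pt_filterlim.
  apply: (@ex_derive_continuous _ _ (fun x => PSeries y x - rho1)).
  apply: (@ex_derive_minus _ R_NormedModule); last exact: ex_derive_const.
  by eexists; apply: is_derive_PSeries; rewrite Rabs_pos_eq; [apply: inR|]; lra.
- exact: z01.
- exact: lt.
- lra.
by exists r; split; [lra | apply: inR; lra | lra].
Qed.

End CriticalPoint.

(** * From coefficient ratios to probabilities *)

Lemma ratio_pow_lim (f : nat -> R) r j : (forall n, 0 < f n.+1) ->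
  is_lim_seq (fun n => f n.+1 / f n.+2) (Rbar.Finite r) ->
  is_lim_seq (fun n => f (n - j)%N / f n) (Rbar.Finite (r ^ j)).
Proof.
move=> f0 lf; apply/(is_lim_seq_incr_n _ j.+1).
apply: (is_lim_seq_ext (fun n => f n.+1 / f (n + j).+1)).
  move=> n; rewrite -[(n + j.+1)%coq_nat]/(n + j.+1)%N addnS.
  by rewrite -addSn addnK.
elim: j => [|j IHj].
  apply: (is_lim_seq_ext (fun=> 1)); last exact: is_lim_seq_const.
  by move=> n; rewrite addn0; field; have := f0 n; lra.
have lj := proj1 (is_lim_seq_incr_n _ j _) lf.
have := is_lim_seq_mult' _ _ _ _ lj IHj; apply: is_lim_seq_ext => n.
rewrite -[(n + j)%coq_nat]/(n + j)%N addnS; field.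
by have := f0 (n + j)%N; have := f0 (n + j).+1; lra.
Qed.

Lemma series_of_psum (f : nat -> R) z l : f 0%N = 0 ->
  is_lim_seq (psum f z) (Rbar.Finite l) -> is_series (fun j => z ^ j.+1 * f j.+1) l.
Proof.
move=> f0 lf; have l2 := proj1 (is_lim_seq_incr_1 _ _) (proj1 (is_lim_seq_incr_1 _ _) lf).
apply: filterlim_ext l2 => n; rewrite sum_n_big /psum big_ord_recl f0 Rmult_0_l Rplus_0_l.
by apply: eq_bigr => i _; rewrite lift0 Rmult_comm.
Qed.

Lemma M_coef0 : M_coef 0 = 0.
Proof. by rewrite /M_coef labeled_count0 INR_0 /Rdiv Rmult_0_l. Qed.

Lemma M_coef_ge0 n : 0 <= M_coef n.
Proof.
apply: Rmult_le_pos; first exact: INR_ge0.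
by apply/Rlt_le/Rinv_0_lt_compat; rewrite -(prednK (fact_gt0 n)); apply: INR_gt0.
Qed.

Lemma INR_fact_gt0 n : 0 < INR n`!.
Proof. by rewrite -(prednK (fact_gt0 n)); apply: INR_gt0. Qed.

Lemma M_coefE n : INR (lab n) / INR n`! = M_coef n + delta0 n.
Proof.
rewrite /M_coef /delta0 /lab; case: eqP => [->|_]; last by rewrite Rplus_0_r.
by rewrite labeled_count0 fact0 INR_0 INR_1; field.
Qed.

Lemma M_coef_rec n : INR n.+1 * M_coef n.+1 = delta0 n + M_coef n +
  conv (fun k => INR k.+1 * M_coef k.+1) M_coef n.
Proof.
pose b k := INR k.+1 * M_coef k.+1; rewrite -/b -/(b n).
have bE k : b k = INR (lab k.+1) / INR k`!.
  rewrite /b; have -> : M_coef k.+1 = INR (lab k.+1) / INR k.+1`! by [].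
  by rewrite factS INRM; field; split; [have := INR_fact_gt0 k | have := INR_gt0 k]; lra.
(* In terms of series, [C' = (M' + 1) / 2]; [delta0] accounts for the single vertex. *)
have cE k : INR (clab k.+1) / INR k`! = (b k + delta0 k) / 2.
  rewrite bE; case: k => [|k].
    by rewrite /clab /= lab1 /delta0 /= fact0 INR_1; field.
  rewrite -(labE (isT : 1 < k.+2)%N) INRM INR2 /delta0 /=.
  by field; have := INR_fact_gt0 k.+1; lra.
have h : b n = conv (fun k => (b k + delta0 k) / 2) (fun k => M_coef k + delta0 k) n.
  rewrite bE lab_rec INR_sum [LHS]/Rdiv rsum_distrl; apply: eq_bigr => k _.
  rewrite -cE -M_coefE !INRM.
  have kn : (k <= n)%N by rewrite -ltnS.
  have e : INR 'C(n, k) * (INR k`! * INR (n - k)`!) = INR n`!.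
    by rewrite -!INRM -(bin_fact kn) mulnA.
  have := INR_fact_gt0 n; have := INR_fact_gt0 k; have := INR_fact_gt0 (n - k).
  rewrite -e => h1 h2 h3.
  have c0 : INR 'C(n, k) <> 0 by move=> c0; rewrite c0 in h3; lra.
  by field; repeat split => //; lra.
(* In terms of series, [2 M' = (M' + 1) (M + 1)], which expands to the claim. *)
have h2 : 2 * b n = conv (fun k => b k + delta0 k) (fun k => M_coef k + delta0 k) n.
  by rewrite h rsum_distrr; apply: eq_bigr => k _; field.
rewrite convDl !convDr ![conv _ delta0 n]convC !conv_delta in h2; lra.
Qed.

Lemma V_coefE n : V_coef n = vcoef ulab n.
Proof.
rewrite /V_coef /vcoef; case: n => [|n] //=; by rewrite unlabeled_count0 INR_0.
Qed.

Lemma unif_cond_probE (U : finType) (S : {set U}) (A B : pred U) :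
  (0 < #|S|)%N -> unif_cond_prob S A B =
  INR #|[set x in S | A x && B x]| / INR #|[set x in S | B x]|.
Proof.
move=> S0; rewrite /unif_cond_prob /unif_prob.
have s0 : INR #|S| <> 0 by rewrite -(prednK S0); have := INR_gt0 #|S|.-1; lra.
have -> : [set x in S | predI A B x] = [set x in S | A x && B x] by apply/setP => x; rewrite !inE.
(* If no element of [S] satisfies [B], both numerators are 0, and so are the quotients, whatever the
   value of the inverse of 0. *)
have [e|ne] := Req_dec (INR #|[set x in S | B x]|) 0; last by field.
have -> : #|[set x in S | A x && B x]| = 0%N.
  apply/eqP; rewrite -leqn0.
  have -> : 0%N = #|[set x in S | B x]| by apply: INR_eq; rewrite e INR_0.
  by apply/subset_leq_card/subsetP => x; rewrite !inE => /and3P[-> _ ->].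
by rewrite INR_0 /Rdiv !Rmult_0_l.
Qed.

Lemma prob_kappaE n j : (0 < j)%N -> (j.*2 < n)%N ->
  prob_kappa n j = M_coef j * (M_coef (n - j) / M_coef n).
Proof.
move=> j0 jn; have n1 : (1 < n)%N by lia.
have njn : (1 < n - j)%N by lia.
have labP k : (0 < k)%N -> INR (lab k) = M_coef k * INR k`!.
  move=> k0; rewrite /M_coef /lab gtn_eqF //; field; have := INR_fact_gt0 k; lra.
have Mpos k : (0 < k)%N -> 0 < M_coef k.
  by move=> k0; rewrite -(prednK k0); apply: (a_gt0 M_coef0 M_coef_ge0 M_coef_rec).
rewrite /prob_kappa unif_cond_probE; last first.
  apply: leq_trans (_ : lab n <= _)%N; last by rewrite /lab gtn_eqF // ltnW.
  have := Mpos n (ltnW n1); have := labP n (ltnW n1); have := INR_fact_gt0 n => h1 h2 h3.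
  by case: (posnP (lab n)) => // e; move: h2; rewrite e INR_0; nra.
rewrite card_kappa // card_connected //.
have e : INR 'C(n, j) * (INR j`! * INR (n - j)`!) = INR n`!.
  by rewrite -!INRM -(@bin_fact n j) ?mulnA //; lia.
have cl k : (1 < k)%N -> INR (clab k) = M_coef k * INR k`! / 2.
  by move=> k1; rewrite -labP ?(ltnW k1) // -(labE k1) INRM INR2; field.
rewrite !INRM !cl // labP // -e.
have := INR_fact_gt0 j; have := INR_fact_gt0 (n - j); have := INR_fact_gt0 n => h1 h2 h3.
have := Mpos n (ltnW n1) => h4.
have c0 : INR 'C(n, j) <> 0 by move=> c0; rewrite c0 in e; lra.
by field; repeat split => //; lra.
Qed.

Lemma prob_kappa_uE n j : (0 < j)%N -> (j.*2 < n)%N -> (forall k, 0 < V_coef k.+1) ->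
  prob_kappa_u n j = V_coef j * (V_coef (n - j) / V_coef n).
Proof.
move=> j0 jn Vpos; have n1 : (1 < n)%N by lia.
have njn : (1 < n - j)%N by lia.
have vP k : (0 < k)%N -> INR (ulab k) = V_coef k by move=> k0; rewrite V_coefE /vcoef gtn_eqF.
have Vp k : (0 < k)%N -> 0 < V_coef k by move=> k0; rewrite -(prednK k0).
rewrite /prob_kappa_u unif_cond_probE; last first.
  have := Vp n (ltnW n1); rewrite /V_coef /unlabeled_count.
  by case: (posnP #|ucographs n|) => // ->; rewrite INR_0; lra.
rewrite card_ukappa // card_uconnected ?(ltnW n1) //.
have cl k : (1 < k)%N -> INR (uclab k) = V_coef k / 2.
  by move=> k1; rewrite -vP ?(ltnW k1) // -(ulabE k1) INRM INR2; field.
rewrite INRM !cl // vP //; field; have := Vp n (ltnW n1); lra.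
Qed.

Lemma rhoE : rho = rho1.
Proof. by rewrite rho1E. Qed.

Theorem theorem7p2 :
  [/\ CV_radius M_coef = Rbar.Finite rho,
      CV_radius V_coef = Rbar.Finite rho_u /\
        Rabs (rho_u - 2808 / 10000) <= 5 / 100000,
      is_distribution pi_lab /\ is_distribution pi_unl,
      forall j : nat, (1 <= j)%N ->
        is_lim_seq (fun n => prob_kappa n j) (Rbar.Finite (pi_lab j))
    & forall j : nat, (1 <= j)%N ->
        is_lim_seq (fun n => prob_kappa_u n j) (Rbar.Finite (pi_unl j))].
Proof.
pose a := M_coef; pose y := ycoef uclab; pose v := vcoef ulab.
have a0 := M_coef0; have ag := M_coef_ge0; have bE := M_coef_rec.
have u0 : ulab 0%N = 1%N by []; have u1 := ulab1; have c1 : uclab 1%N = 1%N by [].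
have y0 := y_zero u0 u1 c1 ulabE ulab_rec; have y1 := y_one u0 u1 c1 ulabE ulab_rec.
have y2 := y_two u0 u1 c1 ulabE ulab_rec; have yg := y_nonneg u0 u1 c1 ulabE ulab_rec.
have v0 : v 0%N = 0 by []; have vE := v_zD u0 u1 c1 ulabE ulab_rec.
have Vv : V_coef = v by apply/funext => n; apply: V_coefE.
have [r [hr rY Yr]] := critical_point u0 u1 c1 ulabE ulab_rec a0 ag bE.
have r0 : 0 < r by lra.
have cvV : CV_radius V_coef = Rbar.Finite r.
  by rewrite Vv; apply: (cv_radius_v a0 ag bE y0 y1 yg v0 vE r0 rY Yr).
have ru : rho_u = r by rewrite /rho_u cvV.
have vpos n : 0 < V_coef n.+1 by rewrite Vv; apply: (v_gt0 a0 ag bE y0 y1 yg v0 vE).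
split.
- by rewrite rhoE; apply: (cv_radius a0 ag bE).
- by rewrite ru; split=> //; apply: Rabs_le; lra.
- split; split=> [j _|].
  + by apply: Rmult_le_pos => //; apply: pow_le; rewrite rhoE; have := rho1_gt0; lra.
  + by apply: (series_of_psum a0); rewrite rhoE; apply: (psum_lim_rho a0 ag bE).
  + by rewrite /pi_unl ru; apply: Rmult_le_pos; [apply: pow_le; lra | apply: INR_ge0].
  + rewrite /pi_unl ru Vv; apply: (series_of_psum v0).
    exact: (psum_v_lim a0 ag bE y0 yg v0 vE r0 rY Yr).
- move=> j j0; rewrite /pi_lab Rmult_comm rhoE.
  have ap := a_gt0 a0 ag bE.
  (* The closed formula holds for [n > 2 j], hence for all large [n]. *)
  apply: (is_lim_seq_ext_loc (fun n => M_coef j * (M_coef (n - j) / M_coef n))).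
    by exists (j.*2.+1) => n /leP jn; rewrite prob_kappaE.
  apply: (is_lim_seq_scal_l _ _ (Rbar.Finite _)); apply: ratio_pow_lim => //.
  have := is_lim_seq_inv _ _ (ratio_lim a0 ag bE) _; rewrite /= Rinv_inv => h.
  apply: is_lim_seq_ext (h _); last first.
    by case; apply: Rinv_neq_0_compat; have := rho1_gt0; lra.
  by move=> n; field; have := ap n; have := ap n.+1; lra.
- move=> j j0; rewrite /pi_unl Rmult_comm ru.
  apply: (is_lim_seq_ext_loc (fun n => V_coef j * (V_coef (n - j) / V_coef n))).
    by exists (j.*2.+1) => n /leP jn; rewrite prob_kappa_uE.
  apply: (is_lim_seq_scal_l _ _ (Rbar.Finite _)); apply: ratio_pow_lim => //.
  by rewrite Vv; apply: (v_ratio_lim a0 ag bE y0 y1 y2 yg v0 vE r0 rY Yr).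
Qed.
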